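(* Let $\{\varepsilon_n\}_{n\ge 1}$ be a sequence of positive numbers with $\varepsilon_n\to 0$ as $n\to\infty$. Then there exist a uniformly discrete sequence of (nonzero) real numbers $\Lambda=\{\lambda_n\}_{n\ge1}$ satisfying $$\frac{\lambda_{n+1}}{\lambda_n}>1+\varepsilon_n\qquad\text{for all } n\ge 1,$$ and a function $g\in L^2(\mathbb{R})$ such that the system of translates $\{g(t-\lambda)\}_{\lambda\in\Lambda}$ is a $(QF)$-system for $L^2(\mathbb{R})$.
   Context: A set (sequence) $\Lambda$ of real numbers is uniformly discrete if $\inf_{\lambda\neq\lambda',\ \lambda,\lambda'\in\Lambda}|\lambda-\lambda'|>0$. A system of vectors $\{u_n\}$ in a Hilbert space $H$ is called a $(QF)$-system if the following two conditions hold: (i) for every $q>2$ there is a constant $C(q)$ such that, for every $f\in H$ and every $\epsilon>0$, there is a (finite) linear combination $Q=\sum c_n u_n$ with $\|f-Q\|<\epsilon$ and $\|\{c_n\}\|_{l_q}\le C(q)\|f\|$; (ii) (Bessel inequality) there is a constant $C'$, not depending on $f$, such that $\left(\sum|\langle f,u_n\rangle|^2\right)^{1/2}\le C'\|f\|$ for all $f\in H$. *)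

(* Defs.v *)
From HB Require Import structures.
From mathcomp Require Import all_boot all_order all_algebra.
From mathcomp Require Import complex.
From mathcomp Require Import all_classical all_reals all_analysis.

Set Implicit Arguments.
Unset Strict Implicit.
Unset Printing Implicit Defensive.

Import Order.TTheory GRing.Theory Num.Theory.
Import numFieldNormedType.Exports.

Local Open Scope classical_set_scope.
Local Open Scope ring_scope.
Local Open Scope complex_scope.

(* The infimum is taken in \bar R, so that it is +oo (and not 0) when L has at
   most one element. *)
Definition uniformly_discrete (R : realType) (L : set R) : Prop :=
  (0 < ereal_inf [set `|z.1 - z.2|%:E | z in
         [set z : R * R | [/\ L z.1, L z.2 & z.1 <> z.2]]])%E.

Definition cmod (R : realType) (z : R[i]) : R := ComplexField.Normc.normc z.

Definition dot_norm (R : realType) (V : lmodType R[i]) (dot : V -> V -> R[i])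
    (f : V) : R :=
  Num.sqrt (complex.Re (dot f f)).

(* A Hilbert space is presented by a set H of representatives in an ambient
   vector space V and an inner product dot, meaningful on H; representatives at
   distance 0 (functions equal almost everywhere, for L^2) stand for the same
   vector.  Nothing below distinguishes such representatives. *)
Definition QF_approximation (R : realType) (V : lmodType R[i]) (H : set V)
    (dot : V -> V -> R[i]) (u : nat -> V) : Prop :=
  forall q : R, 2 < q -> exists C : R,
    forall f : V, H f -> forall eps : R, 0 < eps ->
      exists (N : nat) (c : nat -> R[i]),
        dot_norm dot (f - \sum_(n < N) c n *: u n) < eps /\
        (\sum_(n < N) cmod (c n) `^ q) `^ q^-1 <= C * dot_norm dot f.

Definition Bessel_system (R : realType) (V : lmodType R[i]) (H : set V)
    (dot : V -> V -> R[i]) (u : nat -> V) : Prop :=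
  exists C' : R, forall f : V, H f ->
    ((\sum_(0 <= n <oo) (cmod (dot f (u n)) ^+ 2)%:E) `^ 2^-1
       <= (C' * dot_norm dot f)%:E)%E.

Definition QF_system (R : realType) (V : lmodType R[i]) (H : set V)
    (dot : V -> V -> R[i]) (u : nat -> V) : Prop :=
  [/\ forall n, H (u n), QF_approximation H dot u & Bessel_system H dot u].

Definition L2 (R : realType) : set (R -> R[i]) :=
  [set f | [/\ measurable_fun setT (fun t : measurableTypeR R => complex.Re (f t)),
               measurable_fun setT (fun t : measurableTypeR R => complex.Im (f t)) &
               finite_norm (@lebesgue_measure R) 2%:E (fun t => cmod (f t))]].

Definition cintegral (R : realType) (h : R -> R[i]) : R[i] :=
  Rintegral (@lebesgue_measure R) setT (fun t => complex.Re (h t)) +i*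
  Rintegral (@lebesgue_measure R) setT (fun t => complex.Im (h t)).

Definition L2_dot (R : realType) (f g : R -> R[i]) : R[i] :=
  cintegral (fun t => f t * (g t)^*).

Definition translate (R : realType) (g : R -> R[i]) (a : R) : R -> R[i] :=
  fun t => g (t - a).

(* Main.v *)
(* Everything is done in the time domain.  For d large compared with the support
   of g, convolving g with a sequence supported on d Z is governed by the l^2 norm
   of the sequence, that is by L^2 norms of trigonometric polynomials.  The basic
   tool is a pair (psi, phi) of trigonometric polynomials with 0 <= psi <= 1, psi
   and psi phi close to 1 in L^2, phi having positive frequencies only and small
   l^q norm: psi vanishes to high order on a small set on which phi may be huge.
   Writing x(w) = |(1 + w) / 2|^2 and mu for the mean of x^n, phi is built from
   1 - x^n / mu, averaged over many independent scales to make the l^q norm small,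
   times the one-sided polynomial 1 - (1 + tau F)^k, where F(0) = 0 and
   Re F = x^n / mu - 1; psi is a product of powers of 1 - x^n.

   Replacing g by psi * g changes it little, keeps the Bessel bound (psi is a
   contraction before normalisation) and the density of the span of its translates, and the identity
   phi * (psi * g) ~ g turns an approximation of a target by sum_s a_s g(t - x_s)
   into one using translates by d k + x_s, k > 0, with small l^q norm.  The ratio
   of consecutive translates depends only on phi and not on d, so it beats
   1 + eps_n once enough irrelevant translates have been inserted before.
   Iterating over a countable set of targets gives g as a limit. *)

Require Import Defs.
From HB Require Import structures.
From mathcomp Require Import all_boot all_order all_algebra.
From mathcomp Require Import cyclic cyclotomic separable.
From mathcomp Require Import complex ring lra zify.
From mathcomp Require Import measurable_realfun.
From mathcomp Require Import all_classical all_reals all_analysis.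

Set Implicit Arguments.
Unset Strict Implicit.
Unset Printing Implicit Defensive.

Import Order.TTheory GRing.Theory Num.Theory.
Import numFieldNormedType.Exports.

Local Open Scope classical_set_scope.
Local Open Scope ring_scope.

(** The obstacle: phi has mean zero, its frequencies being positive, yet it must be close to 1 off a
    small set, so it is huge on that set. Coefficients of small l^2 norm are ruled out, since the
    Bessel bound would make phi * (psi * g) small; for q > 2 the l^q norm can be small while the l^2
    norm is not. The balance is this: the coefficients of 1 - x^n / mu are at most 1 in absolute
    value and their l^1 norm is at most 1 / mu, so averaging over m scales with disjoint spectra
    gives a sum of q-th powers of order m^(1 - q) / mu, whereas psi differs from 1 on a set of size
    a little above m mu. Taking m slightly below 1 / mu makes both small, and this is possible
    because q > 2. One psi comes with several phi of disjoint spectra, one for each shift x_s, so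
    that coefficients belonging to different shifts never meet at the same k. The coefficients can
    be made as small in l^q as desired, independently of the size of the target; this is why small
    coefficients survive linear combinations and why C(q) = 1 suffices at the end. *)

(** * Square integrable real functions *)

Section RealL2.
Context {R : realType}.
Notation mu := (@lebesgue_measure R).
Notation TR := (measurableTypeR R).
Implicit Types (f g h : R -> R) (a x : R).

Definition sqint f : Prop :=
  measurable_fun setT (f : TR -> R) /\
  mu.-integrable setT (fun t => ((f t) ^+ 2)%:E).

Definition ip f g : R := \int[mu]_t (f t * g t).

Definition nm f : R := Num.sqrt (ip f f).

Definition tr x f : R -> R := fun t => f (t - x).

Lemma sqint_meas f : sqint f -> measurable_fun setT (f : TR -> R).
Proof. by case. Qed.

Lemma integrable_mul f g : sqint f -> sqint g ->
  mu.-integrable setT (EFin \o (fun t => f t * g t)).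
Proof.
move=> [mf If] [mg Ig].
apply: (@le_integrable _ _ _ mu setT measurableT _
   ((fun t => ((f t) ^+ 2)%:E) \+ (fun t => ((g t) ^+ 2)%:E))%E).
- by apply/measurable_EFinP; exact: measurable_funM.
- move=> t _; rewrite /= lee_fin [leRHS]ger0_norm ?ler_norml; last first.
    by rewrite addr_ge0// sqr_ge0.
  have := sqr_ge0 (f t + g t); have := sqr_ge0 (f t - g t).
  have := sqr_ge0 (f t); have := sqr_ge0 (g t).
  by move=> *; apply/andP; split; nra.
- exact: integrableD.
Qed.

Lemma integrable_EFinD (u v : R -> R) :
  mu.-integrable setT (EFin \o u) -> mu.-integrable setT (EFin \o v) ->
  mu.-integrable setT (EFin \o (fun t => u t + v t)).
Proof. by move=> hu hv; exact: (integrableD measurableT hu hv). Qed.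

Lemma sqintD f g : sqint f -> sqint g -> sqint (f + g).
Proof.
move=> hf hg; have [mf If] := hf; have [mg Ig] := hg; split.
  exact: measurable_funD.
have -> : (fun t => ((f + g) t ^+ 2)%:E) =
   (fun t => (f t ^+ 2 + (g t ^+ 2 + (f t * g t + f t * g t)))%:E).
  by apply/funext => t; congr EFin; rewrite !fctE; ring.
have Ifg := integrable_mul hf hg.
by do !apply: integrable_EFinD.
Qed.

Lemma sqintZ a f : sqint f -> sqint (a *: f).
Proof.
move=> [mf If]; split; first exact: (measurable_funM (measurable_cst a)).
have -> : (fun t => ((a *: f) t ^+ 2)%:E) =
   (fun t => (a ^+ 2)%:E * ((f t) ^+ 2)%:E)%E.
  by apply/funext => t; rewrite -EFinM fctE /= exprMn.
exact: integrableZl.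
Qed.

Lemma sqintN f : sqint f -> sqint (- f).
Proof. by move=> hf; rewrite -scaleN1r; exact: sqintZ. Qed.

Lemma sqintB f g : sqint f -> sqint g -> sqint (f - g).
Proof. by move=> hf hg; apply: sqintD => //; exact: sqintN. Qed.

Lemma sqint0 : sqint 0.
Proof.
split; first exact: measurable_cst.
have -> : (fun t => ((0 : R -> R) t ^+ 2)%:E) = cst 0%E.
  by apply/funext => t; congr EFin; exact: expr0n.
exact: integrable0.
Qed.

Lemma sqint_sum (I : Type) (s : seq I) (P : pred I) (F : I -> R -> R) :
  (forall i, P i -> sqint (F i)) -> sqint (\sum_(i <- s | P i) F i).
Proof.
by move=> h; apply: big_ind => //; [exact: sqint0|exact: sqintD].
Qed.

Definition subf x : TR -> TR := fun t => t - x.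

Lemma measurable_subf x : measurable_fun setT (subf x).
Proof. by apply: measurable_funB => //; exact: measurable_cst. Qed.

(** The pushforward is a measure that agrees with Lebesgue measure on half-open intervals, and these
    determine it. *)
Lemma lebesgue_shift x (A : set TR) : measurable A ->
  pushforward mu (subf x) A = mu A.
Proof.
pose phi := subf x; have mphi : measurable_fun setT phi := measurable_subf x.
pose m := fun h : measurable_fun setT phi =>
  measure_function_pushforward__canonical__measure_function_Measure mu h.
move=> mA; apply/esym.
have -> // := @lebesgue_measure_unique R (m mphi) _ A mA.
move=> X [[a b]] /= ab <-.
rewrite /m /pushforward /=.
have -> : subf x @^-1` `]a, b]%classic = `]a + x, b + x]%classic.
  apply/seteqP; split => t /=; rewrite /subf !in_itv /= => /andP[h1 h2];
  apply/andP; split; lra.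
rewrite !lebesgue_measure_itv /= !lte_fin ltrD2r.
by case: ifP => // _; rewrite -!EFinB; congr EFin; ring.
Qed.

Lemma ge0_integral_tr x (h : TR -> \bar R) : measurable_fun setT h ->
  (forall t, 0 <= h t)%E ->
  (\int[mu]_t h (t - x)%R = \int[mu]_t h t)%E.
Proof.
move=> mh h0.
have := @ge0_integral_pushforward _ _ TR TR R _ (measurable_subf x) mu setT h.
move=> /(_ measurableT mh (fun y _ => h0 y)).
rewrite preimage_setT => e; apply: etrans (esym e) _.
apply: (@eq_measure_integral _ _ _ setT mu (
  measure_function_pushforward__canonical__measure_function_Measure mu
    (measurable_subf x)) h) => A mA _; exact: lebesgue_shift.
Qed.

Lemma integrable_tr x (h : TR -> \bar R) : mu.-integrable setT h ->
  mu.-integrable setT (fun t => h (t - x)).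
Proof.
move=> /integrableP[mh ih]; apply/integrableP; split.
  exact: (measurableT_comp mh (measurable_subf x)).
rewrite (@ge0_integral_tr x (fun t => `|h t|)%E) //.
by apply: measurableT_comp.
Qed.

Lemma integral_tr x (h : TR -> \bar R) : mu.-integrable setT h ->
  (\int[mu]_t h (t - x)%R = \int[mu]_t h t)%E.
Proof.
move=> ih; have [mh _] := integrableP _ _ _ ih.
have := @integral_pushforward _ _ TR TR R _ (measurable_subf x) mu setT h.
move=> /(_ mh); rewrite preimage_setT => /(_ (integrable_tr x ih) measurableT) e.
apply: etrans (esym e) _.
apply: (@eq_measure_integral _ _ _ setT mu (
  measure_function_pushforward__canonical__measure_function_Measure mu
    (measurable_subf x)) h) => A mA _; exact: lebesgue_shift.
Qed.

Lemma sqint_tr x f : sqint f -> sqint (tr x f).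
Proof.
move=> [mf If]; split; last exact: (integrable_tr x If).
exact: (measurableT_comp mf (measurable_subf x)).
Qed.

Lemma ip_tr x f g : sqint f -> sqint g -> ip (tr x f) (tr x g) = ip f g.
Proof.
by move=> hf hg; rewrite /ip /Rintegral (integral_tr x (integrable_mul hf hg)).
Qed.

Lemma ipC f g : ip f g = ip g f.
Proof. by apply: eq_Rintegral => t _; rewrite mulrC. Qed.

Lemma ipDl f g h : sqint f -> sqint g -> sqint h ->
  ip (f + g) h = ip f h + ip g h.
Proof.
move=> hf hg hh; rewrite /ip -RintegralD //; try exact: integrable_mul.
by apply: eq_Rintegral => t _; rewrite fctE mulrDl.
Qed.

Lemma ipZl a f h : sqint f -> sqint h -> ip (a *: f) h = a * ip f h.
Proof.
move=> hf hh; rewrite /ip -RintegralZl //; try exact: integrable_mul.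
by apply: eq_Rintegral => t _; rewrite fctE mulrA.
Qed.

Lemma ipDr f g h : sqint f -> sqint g -> sqint h ->
  ip h (f + g) = ip h f + ip h g.
Proof. by move=> *; rewrite ipC ipDl // ipC [ip g _]ipC. Qed.

Lemma ipZr a f h : sqint f -> sqint h -> ip h (a *: f) = a * ip h f.
Proof. by move=> *; rewrite ipC ipZl // ipC. Qed.

Lemma ip0l h : ip 0 h = 0.
Proof.
rewrite /ip (@eq_Rintegral _ _ _ _ _ (cst 0)) ?Rintegral_cst ?mul0r //.
by move=> t _; rewrite /= mul0r.
Qed.

Lemma ip_suml (I : Type) (s : seq I) (P : pred I) (F : I -> R -> R) h :
  (forall i, P i -> sqint (F i)) -> sqint h ->
  ip (\sum_(i <- s | P i) F i) h = \sum_(i <- s | P i) ip (F i) h.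
Proof.
move=> hF hh; elim: s => [|i s IH]; first by rewrite !big_nil ip0l.
rewrite !big_cons; case: ifP => // Pi.
by rewrite ipDl ?IH //; [exact: hF|exact: sqint_sum].
Qed.

Lemma ip_sumr (I : Type) (s : seq I) (P : pred I) (F : I -> R -> R) h :
  (forall i, P i -> sqint (F i)) -> sqint h ->
  ip h (\sum_(i <- s | P i) F i) = \sum_(i <- s | P i) ip h (F i).
Proof.
by move=> hF hh; rewrite ipC ip_suml //; apply: eq_bigr => i _; rewrite ipC.
Qed.

Lemma ip_ge0 f : 0 <= ip f f.
Proof. by apply: Rintegral_ge0 => t _; rewrite -expr2 sqr_ge0. Qed.

Lemma nm_ge0 f : 0 <= nm f. Proof. exact: sqrtr_ge0. Qed.

Lemma nm_sqr f : nm f ^+ 2 = ip f f.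
Proof. by rewrite sqr_sqrtr // ip_ge0. Qed.

Lemma nm_leP f (b : R) : 0 <= b -> (nm f <= b) = (ip f f <= b ^+ 2).
Proof. by move=> b0; rewrite -nm_sqr ler_pXn2r // nnegrE ?nm_ge0. Qed.

Lemma ip_le_nm f g : sqint f -> sqint g -> ip f g <= nm f * nm g.
Proof.
move=> hf hg.
have key (s t : R) : 0 <= s ^+ 2 * ip f f - s * t * ip f g *+ 2 + t ^+ 2 * ip g g.
  have hs := sqintZ s hf; have ht := sqintZ (- t) hg.
  have := ip_ge0 (s *: f + (- t) *: g).
  rewrite ipDl ?ipDr ?ipZl ?ipZr // ?[ip g f]ipC; try exact: sqintD.
  by congr (_ <= _); ring.
have := key (nm g) (nm f); rewrite -!nm_sqr.
have := nm_ge0 f; have := nm_ge0 g.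
set a := nm f; set b := nm g => b0 a0 h.
have : 0 <= (a * b) * (a * b - ip f g) by lra.
move=> hab; have [//|ip_gt] := leP (ip f g) (a * b).
have ip0 : 0 < ip f g by apply: le_lt_trans ip_gt; exact: mulr_ge0.
have ab0 : a * b = 0.
  apply/eqP; rewrite eq_le mulr_ge0 // andbT leNgt; apply/negP => ab0.
  by move: hab; rewrite pmulr_rge0 // subr_ge0 leNgt ip_gt.
have /orP[/eqP a00|/eqP b00] : (a == 0) || (b == 0) by rewrite -mulf_eq0 ab0.
(* If one norm vanishes, the quadratic form is affine in the corresponding coefficient; this
   coefficient is chosen to make the form equal to - 2 (b^2 + 1) + b^2 < 0. *)
- have := key ((b ^+ 2 + 1) / ip f g) 1.
  rewrite -!nm_sqr; rewrite -/a -/b a00 mulr1 divfK ?gt_eqF //; nra.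
- have := key 1 ((a ^+ 2 + 1) / ip f g).
  rewrite -!nm_sqr; rewrite -/a -/b b00 mul1r divfK ?gt_eqF //; nra.
Qed.

Lemma nmD f g : sqint f -> sqint g -> nm (f + g) <= nm f + nm g.
Proof.
move=> hf hg; rewrite nm_leP ?addr_ge0 ?nm_ge0 //.
rewrite ipDl ?ipDr // ?[ip g f]ipC; try exact: sqintD.
rewrite sqrrD !nm_sqr; have := ip_le_nm hf hg; lra.
Qed.

Lemma nmZ a f : sqint f -> nm (a *: f) = `|a| * nm f.
Proof.
move=> hf; rewrite /nm ipZl ?ipZr ?mulrA -?expr2; try exact: sqintZ; try done.
by rewrite sqrtrM ?sqr_ge0 // sqrtr_sqr.
Qed.

Lemma nmN f : sqint f -> nm (- f) = nm f.
Proof. by move=> hf; rewrite -scaleN1r nmZ // normrN1 mul1r. Qed.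

Lemma nmB f g : sqint f -> sqint g -> nm (f - g) = nm (g - f).
Proof. by move=> hf hg; rewrite -opprB nmN //; exact: sqintB. Qed.

Lemma nm0 : nm 0 = 0. Proof. by rewrite /nm ip0l sqrtr0. Qed.

Lemma nm_sum (I : Type) (s : seq I) (P : pred I) (F : I -> R -> R) :
  (forall i, P i -> sqint (F i)) ->
  nm (\sum_(i <- s | P i) F i) <= \sum_(i <- s | P i) nm (F i).
Proof.
move=> hF; elim: s => [|i s IH]; first by rewrite !big_nil nm0.
rewrite !big_cons; case: ifP => // Pi.
apply: le_trans (nmD (hF _ Pi) (sqint_sum s hF)) _.
by rewrite lerD2l.
Qed.

Lemma nm_tri h f g : sqint f -> sqint g -> sqint h ->
  nm (f - g) <= nm (f - h) + nm (h - g).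
Proof.
move=> hf hg hh; have -> : f - g = (f - h) + (h - g).
  by rewrite addrA subrK.
by apply: nmD; exact: sqintB.
Qed.

Lemma nm_tr x f : sqint f -> nm (tr x f) = nm f.
Proof. by move=> hf; rewrite /nm ip_tr. Qed.

Lemma trD x f g : tr x (f + g) = tr x f + tr x g. Proof. by []. Qed.
Lemma trB x f g : tr x (f - g) = tr x f - tr x g. Proof. by []. Qed.
Lemma trZ x a f : tr x (a *: f) = a *: tr x f. Proof. by []. Qed.
Lemma tr_sum x (I : Type) (s : seq I) (P : pred I) (F : I -> R -> R) :
  tr x (\sum_(i <- s | P i) F i) = \sum_(i <- s | P i) tr x (F i).
Proof.
by apply/funext => t; rewrite /tr !fct_sumE.
Qed.
Lemma tr_tr x y f : tr x (tr y f) = tr (x + y) f.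
Proof. by apply/funext => t; rewrite /tr; congr f; ring. Qed.
Lemma tr0 f : tr 0 f = f.
Proof. by apply/funext => t; rewrite /tr subr0. Qed.

Lemma ip_disj f g : (forall t, f t = 0 \/ g t = 0) -> ip f g = 0.
Proof.
move=> h; rewrite /ip (@eq_Rintegral _ _ _ _ _ (cst 0)) ?Rintegral_cst ?mul0r //.
by move=> t _ /=; case: (h t) => ->; rewrite ?mul0r ?mulr0.
Qed.

End RealL2.

(** * Trigonometric polynomials and Parseval *)

Section TrigPoly.
Context {R : realType}.
Local Open Scope complex_scope.
Implicit Types (z w : R[i]) (p q : {poly R}).

Definition sqn z : R := complex.Re z ^+ 2 + complex.Im z ^+ 2.

Lemma sqn_ge0 z : 0 <= sqn z.
Proof. by rewrite addr_ge0 ?sqr_ge0. Qed.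

Lemma sqnM z w : sqn (z * w) = sqn z * sqn w.
Proof. by case: z w => [a b] [c d]; rewrite /sqn /=; ring. Qed.

Lemma sqn1 : sqn 1 = 1.
Proof. by rewrite /sqn /= expr1n expr0n addr0. Qed.

Lemma sqnX z n : sqn (z ^+ n) = sqn z ^+ n.
Proof. by elim: n => [|n IH]; rewrite ?sqn1 // !exprS sqnM IH. Qed.

Lemma sqn_real (x : R) : sqn x%:C = x ^+ 2.
Proof. by rewrite /sqn /= expr0n addr0. Qed.

Lemma sqnE z : (sqn z)%:C = z * conjc z.
Proof.
by case: z => [a b]; apply/eqP; rewrite eq_complex /sqn /=; apply/andP; split;
  apply/eqP; ring.
Qed.

Lemma sqnD_le z w : sqn (z + w) <= 2 * (sqn z + sqn w).
Proof.
case: z w => [a b] [c d]; rewrite /sqn /=.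
have := sqr_ge0 (a - c); have := sqr_ge0 (b - d); nra.
Qed.

Lemma conj_unit w : sqn w = 1 -> conjc w = w^-1.
Proof.
move=> h; have hw : w * conjc w = 1 by rewrite -sqnE h.
by apply/esym; rewrite -[LHS]mulr1 -hw mulKf //; apply: contra_eq_neq hw => ->;
  rewrite mul0r eq_sym oner_neq0.
Qed.

Definition hv p w : R[i] := (map_poly (real_complex R) p).[w].

Lemma hvD p q w : hv (p + q) w = hv p w + hv q w.
Proof. by rewrite /hv rmorphD hornerD. Qed.
Lemma hvB p q w : hv (p - q) w = hv p w - hv q w.
Proof. by rewrite /hv rmorphB hornerD hornerN. Qed.
Lemma hvM p q w : hv (p * q) w = hv p w * hv q w.
Proof. by rewrite /hv rmorphM hornerM. Qed.
Lemma hvE p n w : hv (p ^+ n) w = hv p w ^+ n.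
Proof. by rewrite /hv rmorphXn horner_exp. Qed.
Lemma hvC a w : hv a%:P w = a%:C.
Proof. by rewrite /hv map_polyC hornerC. Qed.
Lemma hv1 w : hv 1 w = 1.
Proof. by rewrite /hv rmorph1 hornerC. Qed.
Lemma hvZ a p w : hv (a *: p) w = a%:C * hv p w.
Proof. by rewrite -mul_polyC hvM hvC. Qed.
Lemma hvX w : hv 'X w = w.
Proof. by rewrite /hv map_polyX hornerX. Qed.
Lemma hvXn n w : hv 'X^n w = w ^+ n.
Proof. by rewrite hvE hvX. Qed.
Lemma hv_sum (I : Type) (s : seq I) (P : pred I) (F : I -> {poly R}) w :
  hv (\sum_(i <- s | P i) F i) w = \sum_(i <- s | P i) hv (F i) w.
Proof. by rewrite /hv rmorph_sum horner_sum. Qed.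
Lemma hv_comp_Xn p n w : hv (p \Po 'X^n) w = hv p (w ^+ n).
Proof. by rewrite /hv map_comp_poly horner_comp map_polyXn hornerXn. Qed.

Lemma hv_coef p M w : (size p <= M)%N ->
  hv p w = \sum_(i < M) (p`_i)%:C * w ^+ i.
Proof.
move=> hM; rewrite /hv (@horner_coef_wide _ M).
  by apply: eq_bigr => i _; rewrite coef_map.
by rewrite size_map_poly.
Qed.

(** The squared L^2 norm on the unit circle. Integrals over the circle never appear: they are
    replaced by averages over roots of unity of large order. *)
Definition n2 p : R := \sum_(i < size p) p`_i ^+ 2.

Lemma n2_widen p M : (size p <= M)%N -> n2 p = \sum_(i < M) p`_i ^+ 2.
Proof.
move=> hM; rewrite /n2 (big_ord_widen M (fun i => p`_i ^+ 2)) //.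
rewrite [RHS](bigID (fun i : 'I_M => (i < size p)%N)) /=.
rewrite [X in _ = _ + X]big1 ?addr0 // => i; rewrite -leqNgt => h.
by rewrite nth_default // expr0n.
Qed.

Lemma n2_ge0 p : 0 <= n2 p.
Proof. by apply: sumr_ge0 => i _; exact: sqr_ge0. Qed.

Lemma n2_coef p i : p`_i ^+ 2 <= n2 p.
Proof.
rewrite (@n2_widen p (maxn (size p) i.+1)) ?leq_maxl //.
have h : (i < maxn (size p) i.+1)%N by rewrite leq_maxr.
rewrite (bigD1 (Ordinal h)) //= lerDl; apply: sumr_ge0 => j _; exact: sqr_ge0.
Qed.

Lemma n2Z a p : n2 (a *: p) = a ^+ 2 * n2 p.
Proof.
rewrite (@n2_widen _ (size p)) ?size_scale_leq // /n2 mulr_sumr.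
by apply: eq_bigr => i _; rewrite coefZ exprMn.
Qed.

Lemma prim_root_ex M : (0 < M)%N -> exists z : R[i], M.-primitive_root z.
Proof.
move=> M0; have hM : (M%:R : R[i]) != 0 by rewrite pnatr_eq0 -lt0n.
have [r hr] := closed_field_poly_normal ('X^M - 1 : {poly R[i]}).
move: hr; rewrite lead_coefXnsubC // scale1r => hr.
have /hasP[z _ hz] : has M.-primitive_root r; last by exists z.
apply: has_prim_root => //.
- apply/allP => z zr; rewrite unity_rootE -subr_eq0.
  have : root ('X^M - 1) z by rewrite hr root_prod_XsubC.
  by rewrite rootE hornerD hornerXn hornerN hornerC.
- by rewrite -separable_prod_XsubC -hr separable_Xn_sub_1.
- by have := size_prod_XsubC r id; rewrite -hr size_XnsubC // => -[->].
Qed.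

Lemma sqn_prim_root M z : M.-primitive_root z -> sqn z = 1.
Proof.
move=> hz; apply/eqP; rewrite -(@pexpr_eq1 _ _ M) ?sqn_ge0 //.
  by rewrite -sqnX (prim_expr_order hz) sqn1.
exact: prim_order_gt0 hz.
Qed.

(** An average over the M-th roots of unity is exact below degree M: the geometric sums of (z^i /
    z^j)^k vanish for i != j. *)
Lemma parseval p M z : M.-primitive_root z -> (size p <= M)%N ->
  \sum_(k < M) sqn (hv p (z ^+ k)) = M%:R * n2 p.
Proof.
move=> hz hM; apply: (@complexI R); rewrite rmorph_sum /=.
have z0 : z != 0 by rewrite (prim_root_eq0 hz) -lt0n (prim_order_gt0 hz).
have key (i j : 'I_M) : \sum_(k < M) (z ^+ i / z ^+ j) ^+ k =
    if i == j then M%:R else 0 :> R[i].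
  have [->|ij] := eqVneq i j.
    rewrite divff ?expf_neq0 //.
    by under eq_bigr do rewrite expr1n; rewrite sumr_const card_ord.
  have u1 : z ^+ i / z ^+ j - 1 != 0.
    rewrite subr_eq0; apply: contra ij => /eqP h.
    have : z ^+ i == z ^+ j by rewrite -[z ^+ j]mul1r -h divfK // expf_neq0.
    by rewrite (eq_prim_root_expr hz) !modn_small.
  apply: (mulfI u1); rewrite mulr0 -subrX1 exprMn exprVn -!exprM.
  by rewrite ![(_ * M)%N]mulnC !exprM (prim_expr_order hz) !expr1n divr1 subrr.
have -> : \sum_(k < M) (sqn (hv p (z ^+ k)))%:C =
  \sum_(k < M) \sum_(i < M) \sum_(j < M)
     (p`_i * p`_j)%:C * (z ^+ i / z ^+ j) ^+ k.
  apply: eq_bigr => k _; rewrite sqnE (hv_coef _ hM).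
  have -> : conjc (\sum_(i < M) (p`_i)%:C * (z ^+ k) ^+ i) =
      \sum_(i < M) (p`_i)%:C * (z^-1 ^+ k) ^+ i.
    rewrite rmorph_sum; apply: eq_bigr => i _.
    rewrite -(conj_unit (sqn_prim_root hz)) -!rmorphXn.
    by rewrite -[in RHS](conjc_real p`_i) -rmorphM.
  rewrite mulr_suml.
  apply: eq_bigr => i _; rewrite mulr_sumr; apply: eq_bigr => j _.
  rewrite rmorphM /= exprMn !exprVn -!exprM [(k * i)%N]mulnC [(k * j)%N]mulnC.
  by ring.
rewrite exchange_big /= (n2_widen hM) mulr_sumr rmorph_sum.
apply: eq_bigr => i _; rewrite exchange_big /= (bigD1 i) //= [X in _ + X]big1.
  by rewrite addr0 -mulr_sumr key eqxx [RHS]rmorphM /= rmorph_nat mulrC expr2.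
move=> j ji; rewrite -mulr_sumr key eq_sym (negbTE ji) mulr0 //.
Qed.

(** The only passage from pointwise bounds on the circle to coefficient norms: sum the bound over
    roots of unity of an order exceeding all degrees involved. The list [s] encodes a majorant whose
    mean is known. *)
Lemma n2_le p (alpha : R) (s : seq (R * {poly R})) :
  (forall w, sqn w = 1 ->
     sqn (hv p w) <= alpha + \sum_(f <- s) f.1 * sqn (hv f.2 w)) ->
  n2 p <= alpha + \sum_(f <- s) f.1 * n2 f.2.
Proof.
move=> h; pose M := maxn 1 (maxn (size p) (\max_(f <- s) size f.2)).
have M0 : (0 < M)%N by rewrite leq_max.
have [z hz] := prim_root_ex M0.
have hp : (size p <= M)%N by rewrite !leq_max leqnn orbT.
have hs f : f \in s -> (size f.2 <= M)%N.
  move=> fs; rewrite !leq_max; apply/orP; right; apply/orP; right.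
  exact: (@leq_bigmax_seq _ _ xpredT (fun f : R * {poly R} => size f.2) f).
have MR : 0 < M%:R :> R by rewrite ltr0n.
rewrite -(ler_pM2l MR) -(parseval hz hp) mulrDr mulr_sumr.
apply: le_trans (_ : \sum_(k < M) (alpha + \sum_(f <- s) f.1 * sqn (hv f.2 (z ^+ k))) <= _).
  by apply: ler_sum => k _; apply: h; rewrite sqnX (sqn_prim_root hz) expr1n.
rewrite big_split /= sumr_const card_ord mulr_natl lerD2l exchange_big /=.
rewrite big_seq [leRHS]big_seq; apply: ler_sum => f fs.
by rewrite -mulr_sumr (parseval hz (hs f fs)) mulrCA.
Qed.

End TrigPoly.

(** * Powers of the kernel |(1 + w) / 2|^2 *)

Section Kernel.
Context {R : realType}.
Local Open Scope complex_scope.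
Implicit Types (z w : R[i]) (p q : {poly R}).

Definition avg : {poly R} := 2^-1 *: ('X + 1).
(** The mean of [xv w ^+ n] over the circle; it is both [n2 (avg ^+ n)] and the central coefficient
    of [avg ^+ n.*2]. *)
Definition cb (n : nat) : R := 'C(n.*2, n)%:R / 4 ^+ n.
Definition xv w : R := sqn (hv avg w).

Lemma avg_exp n : avg ^+ n = \poly_(i < n.+1) ('C(n, i)%:R / 2 ^+ n).
Proof.
rewrite /avg exprZn poly_def exprD1n scaler_sumr; apply: eq_bigr => i _.
by rewrite -[in LHS](scaler_nat 'C(n, i)) scalerA exprVn mulrC.
Qed.

Lemma coef_avg n i : (avg ^+ n)`_i = 'C(n, i)%:R / 2 ^+ n.
Proof.
by rewrite avg_exp coef_poly; case: ltnP => // h; rewrite bin_small // mul0r.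
Qed.

Lemma size_avg n : (size (avg ^+ n) <= n.+1)%N.
Proof. by rewrite avg_exp size_poly. Qed.

(** On the circle (1 + w)^2 / w is real and nonnegative, so x^n is the polynomial [avg ^+ n.*2] up
    to a shift by n. *)
Lemma hv_avg_sqr w : sqn w = 1 -> hv avg w ^+ 2 = w * (xv w)%:C.
Proof.
case: w => a b; rewrite /xv /avg hvZ hvD hvX hv1 /sqn /= => h.
have hb : b ^+ 2 = 1 - a ^+ 2 by rewrite -h addrC addKr.
apply/eqP; rewrite eq_complex !expr2 /= -!expr2; apply/andP; split; apply/eqP.
  by field: hb.
by field: hb.
Qed.

Lemma xv_ge0 w : 0 <= xv w. Proof. exact: sqn_ge0. Qed.

Lemma xv_le1 w : sqn w = 1 -> xv w <= 1.
Proof.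
case: w => a b; rewrite /xv /avg hvZ hvD hvX hv1 /sqn /= => h.
have := sqr_ge0 b; nra.
Qed.

Lemma n2_avg n : n2 (avg ^+ n) = cb n.
Proof.
rewrite (@n2_widen _ _ n.+1) ?size_avg // /cb -addnn -binomial.Vandermonde.
rewrite natr_sum mulr_suml; apply: eq_bigr => i _.
rewrite coef_avg bin_sub -1?ltnS // natrM expr_div_n -expr2; congr (_ / _).
by rewrite -exprM mulnC exprM; congr (_ ^+ _); ring.
Qed.

Lemma n2_comp_Xn p D : (0 < D)%N -> n2 (p \Po 'X^D) = n2 p.
Proof.
move=> D0; rewrite (@n2_widen _ _ (size p * D)%N); last first.
  by rewrite comp_poly_Xn // size_poly.
rewrite -(big_mkord xpredT (fun i => (p \Po 'X^D)`_i ^+ 2)) big_nat_mul big_mkord.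
apply: eq_bigr => i _.
rewrite -{1}[(i * D)%N]add0n mulSn big_addn addnK big_mkord.
rewrite (bigD1 (Ordinal D0)) //= add0n coef_comp_poly_Xn // dvdn_mull //.
rewrite mulnK // big1 ?addr0 // => j jD.
rewrite coef_comp_poly_Xn // dvdn_addl ?dvdn_mull //.
rewrite gtnNdvd ?expr0n //; rewrite lt0n; apply: contra jD => /eqP j0.
exact/eqP/val_inj.
Qed.

Lemma cbS n : cb n.+1 = cb n * (2 * n%:R + 1) / (2 * n%:R + 2).
Proof.
have h : ((n.+1) * 'C(n.+1.*2, n.+1) = 2 * (n.*2.+1 * 'C(n.*2, n)))%N.
  have := mul_bin_diag n.+1.*2 n; have := mul_bin_down n.*2.+1 n.
  rewrite doubleS /= => h1 h2.
  rewrite -h2 h1 -[n.*2.+2]doubleS -mul2n -!mulnA; congr (2 * _)%N.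
  by congr (_ * _)%N; rewrite -addnn subSn ?leq_addr // addnK.
have e : (n.+1 * 'C(n.+1.*2, n.+1))%N%:R =
   (2 * (n.*2.+1 * 'C(n.*2, n)))%N%:R :> R by rewrite h.
move: e; rewrite /cb !natrM -[n.*2.+1]addn1 natrD -(mul2n n) (natrM _ 2 n) exprS => e.
have n0 : (n.+1%:R : R) != 0 by rewrite pnatr_eq0.
have n1 : 2 * n%:R + 2 != 0 :> R.
  by rewrite gt_eqF // ltr_wpDl // mulr_ge0.
have -> : 'C(n.+1.*2, n.+1)%:R = 2 * ((2 * n%:R + 1) * 'C(2 * n, n)%:R) / n.+1%:R :> R.
  by rewrite -e mulrC mulKf.
rewrite -natr1; rewrite -natr1 in n0.
have n4 : 4 ^+ n != 0 :> R by rewrite expf_neq0.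
by field; rewrite n1 n4 addrC n0.
Qed.

Lemma cb_gt0 n : 0 < cb n.
Proof.
by rewrite divr_gt0 ?exprn_gt0 // ltr0n bin_gt0 -addnn leq_addr.
Qed.

(** By [cbS] the right-hand side is nondecreasing in n and equals 1 at n = 1, while the left-hand
    side of [cb_ub] is nonincreasing from 1. So [cb n] is of order n^(-1/2). *)
Lemma cb_lb n : (0 < n)%N -> 1 <= 4 * n%:R * cb n ^+ 2.
Proof.
case: n => // n _; elim: n => [|n IH].
  rewrite /cb bin1 (_ : 4 * 1%:R * (1.*2%:R / 4 ^+ 1) ^+ 2 = 1 :> R) //.
  by rewrite -mul2n; field.
rewrite cbS; have := cb_gt0 n.+1; move: IH; move: (cb n.+1) => c.
rewrite -[n.+2%:R]natr1; have : 1 <= n.+1%:R :> R by rewrite ler1n.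
move: (n.+1%:R : R) => m m1 IH c0.
have m2 : 0 < 2 * m + 2 by lra.
rewrite !exprMn exprVn mulrA ler_pdivlMr ?exprn_gt0 // mul1r.
have : 0 <= (4 * m * c ^+ 2 - 1) * ((m + 1) * (2 * m + 1) ^+ 2).
  by rewrite mulr_ge0 ?subr_ge0 // mulr_ge0 ?sqr_ge0 //; lra.
have m0 : 0 < m by lra.
move=> h; rewrite -(ler_pM2l m0); nra.
Qed.

Lemma cb_ub n : (2 * n%:R + 1) * cb n ^+ 2 <= 1.
Proof.
elim: n => [|n IH]; first by rewrite /cb bin0 expr0 divr1 mulr0 add0r mul1r expr1n.
rewrite cbS; have := cb_gt0 n; move: IH; move: (cb n) => c.
rewrite -[n.+1%:R]natr1; have : 0 <= n%:R :> R by [].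
move: (n%:R : R) => m m1 IH c0.
have m2 : 0 < 2 * m + 2 by lra.
rewrite !exprMn exprVn mulrA ler_pdivrMr ?exprn_gt0 // mul1r.
have : 0 <= (1 - (2 * m + 1) * c ^+ 2) * ((2 * (m + 1) + 1) * (2 * m + 1)).
  by rewrite mulr_ge0 ?subr_ge0 // mulr_ge0 //; lra.
nra.
Qed.

Lemma cb_le1 n : cb n <= 1.
Proof.
have := cb_ub n; have := cb_gt0 n => h1 h2; rewrite leNgt; apply/negP => h.
have : 0 <= n%:R :> R by []. nra.
Qed.

Definition avgX (D : nat) : {poly R} := avg \Po 'X^D.
(* Laurent polynomials are represented by ordinary ones, up to a power of 'X:
   [fac D n] stands for 1 - x(w^D)^n times w^(D n). *)
Definition fac (D n : nat) : {poly R} := 'X^(D * n) - (avgX D) ^+ n.*2.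

Lemma hv_avgX D w : hv (avgX D) w = hv avg (w ^+ D).
Proof. exact: hv_comp_Xn. Qed.

Lemma n2_avgX D n : (0 < D)%N -> n2 (avgX D ^+ n) = cb n.
Proof.
move=> D0; have -> : avgX D ^+ n = avg ^+ n \Po 'X^D by rewrite /avgX rmorphXn.
by rewrite n2_comp_Xn // n2_avg.
Qed.

Lemma hv_fac D n w : sqn w = 1 ->
  hv (fac D n) w = w ^+ (D * n) * (1 - xv (w ^+ D) ^+ n)%:C.
Proof.
move=> hw; rewrite /fac hvB hvXn hvE hv_avgX -mul2n (exprM (hv avg _)) hv_avg_sqr; last first.
  by rewrite sqnX hw expr1n.
by rewrite exprMn -exprM rmorphB rmorph1 rmorphXn /= mulrBr mulr1.
Qed.

End Kernel.

(** * Choice of exponents and of the number of scales *)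

Section KernelParams.
Context {R : realType}.
Local Open Scope complex_scope.
Implicit Types (z w : R[i]) (p q : {poly R}).

Lemma bernoulli_ge (y : R) n : -1 <= y -> 1 + n%:R * y <= (1 + y) ^+ n.
Proof.
move=> y1; elim: n => [|n IH]; first by rewrite mul0r addr0 expr0.
rewrite exprS -natr1.
have h : 0 <= 1 + y by lra.
apply: le_trans (ler_wpM2l h IH).
have : 0 <= n%:R :> R by []. have := sqr_ge0 y. nra.
Qed.

Lemma natr_ceil (x : R) : exists n : nat, (0 < n)%N /\ x <= n%:R.
Proof.
exists (Num.bound `|x|).+1; split=> //.
have h := archi_boundP (normr_ge0 x).
apply: le_trans (ler_norm x) _; apply/ltW/(lt_le_trans h).
by rewrite ler_nat.
Qed.

Lemma pow_xv_ub (x : R) n N : 0 <= x <= 1 -> 0 <= (1 - x ^+ n) ^+ N <= 1.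
Proof.
move=> /andP[x0 x1]; have h : 0 <= 1 - x ^+ n <= 1.
  by rewrite subr_ge0 exprn_ile1 // lerBlDr lerDl exprn_ge0.
by have /andP[h0 h1] := h; rewrite exprn_ge0 // exprn_ile1.
Qed.

(** With v = x^(j^(2 l)), n = l j^(2 l), T = C1 j and N = T^l, Bernoulli gives 1 - (1 - v^l)^N <= N
    v^l = (T v)^l, which is at most T v if T v <= 1; otherwise the bound is trivial. The mean of the
    left-hand side is thus at most C1 j^(1 - l), although N [cb n] is at least C: bounding by N x^n
    alone would give nothing small. *)
Lemma kernel_params (l : nat) (C : R) : (1 < l)%N ->
  exists C1 : nat, (0 < C1)%N /\ forall j : nat, (0 < j)%N ->
  [/\ C <= ((C1 * j) ^ l)%N%:R * @cb R (l * j ^ (2 * l)),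
      forall x : R, 0 <= x <= 1 ->
        1 - (1 - x ^+ (l * j ^ (2 * l))) ^+ ((C1 * j) ^ l) <=
        (C1 * j)%N%:R * x ^+ (j ^ (2 * l)),
      (j ^ l)%N%:R * @cb R (j ^ (2 * l)) <= 1 &
      1 <= 2 * l%:R * (j ^ l)%N%:R * @cb R (l * j ^ (2 * l))].
Proof.
(* Dictated by the last conclusion: as 2 l j^l [cb n] >= 1, this choice gives C1^l j^l [cb n] >=
   [|C|]. *)
move=> l1; have [C1 [C10 hC]] := natr_ceil (2 * l%:R * `|C|).
exists C1; split => // j j0.
have jl0 : (0 < j ^ (2 * l))%N by rewrite expn_gt0 j0.
have l0 : (0 < l)%N by exact: ltn_trans l1.
have hd : 1 <= 2 * l%:R * (j ^ l)%N%:R * @cb R (l * j ^ (2 * l)).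
  set c := @cb R _.
  have c0 : 0 < c by exact: cb_gt0.
  have h1 : 1 <= 4 * (l * j ^ (2 * l))%N%:R * c ^+ 2.
    by apply: cb_lb; rewrite muln_gt0 l0.
  have a0 : 0 <= 2 * l%:R * (j ^ l)%N%:R * c by rewrite !mulr_ge0 // ltW.
  rewrite -(@ler_pXn2r _ 2) // ?nnegrE // expr1n; apply: le_trans h1 _.
  rewrite [in leRHS]exprMn ler_wpM2r ?sqr_ge0 //.
  have -> : (l * j ^ (2 * l))%N%:R = l%:R * (j ^ l)%N%:R ^+ 2 :> R.
    by rewrite [(2 * l)%N]mulnC expnM natrM natrX.
  have a1 : 1 <= l%:R :> R by rewrite ler1n.
  move: (l%:R : R) ((j ^ l)%N%:R : R) a1 => a b a1.
  have : 0 <= (a - 1) * a * (b ^+ 2) by rewrite mulr_ge0 ?sqr_ge0 // mulr_ge0; lra.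
  lra.
split => //.
- set c := @cb R _ in hd *; have c0 : 0 < c by exact: cb_gt0.
  rewrite expnMn natrM.
  have h1 : C1%:R <= (C1 ^ l)%N%:R :> R by rewrite ler_nat -{1}(expn1 C1) leq_pexp2l.
  have h2 : 0 <= (j ^ l)%N%:R * c by rewrite mulr_ge0 // ltW.
  have h3 := le_trans hC h1.
  rewrite -mulrA; apply: le_trans _ (ler_wpM2r h2 h3).
  have := ler_wpM2l (normr_ge0 C) hd; have := ler_norm C.
  rewrite mulr1; lra.
- move=> x /andP[x0 x1].
  set v := x ^+ (j ^ (2 * l)); set T := (C1 * j)%N.
  have v0 : 0 <= v by exact: exprn_ge0.
  have v1 : v <= 1 by exact: exprn_ile1.
  have -> : x ^+ (l * j ^ (2 * l)) = v ^+ l by rewrite mulnC exprM.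
  have [/andP[h0 h1]] : 0 <= (1 - v ^+ l) ^+ (T ^ l) <= 1 by apply: pow_xv_ub; rewrite v0.
  have [Tv|Tv] := leP 1 (T%:R * v).
    by apply: le_trans Tv; rewrite lerBlDr lerDl.
  have vl : -1 <= - v ^+ l by rewrite lerN2 exprn_ile1.
  have := bernoulli_ge (T ^ l) vl; rewrite mulrN => h.
  apply: le_trans (_ : (T ^ l)%N%:R * v ^+ l <= _); first by lra.
  rewrite natrX -exprMn; have Tv0 : 0 <= T%:R * v by rewrite mulr_ge0.
  case: (l) l0 => // l' _; rewrite exprS ler_piMr // exprn_ile1 // ltW //.
- have := @cb_ub R (j ^ (2 * l)); set c := @cb R _ => h.
  have c0 : 0 < c by exact: cb_gt0.
  have a0 : 0 <= (j ^ l)%N%:R * c by rewrite mulr_ge0 // ltW.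
  rewrite -(@ler_pXn2r _ 2) // ?nnegrE // expr1n exprMn.
  apply: le_trans h; rewrite ler_wpM2r ?sqr_ge0 //.
  rewrite -natrX -expnM [(l * 2)%N]mulnC.
  have : 0 <= (j ^ (2 * l))%N%:R :> R by []. lra.
Qed.

(** Multiply Bernoulli's 1 + N y <= (1 + y)^N by (1 - y)^N. With y = x^n this says that N factors of
    psi damp the peak of x^n down to height 1 / N. *)
Lemma pow_mul_le (y : R) N : 0 <= y <= 1 -> N%:R * ((1 - y) ^+ N * y) <= 1.
Proof.
move=> /andP[y0 y1].
have h1 : (1 - y) ^+ N * (1 + y) ^+ N <= 1.
  rewrite -exprMn exprn_ile1 //; nra.
have h2 : 1 + N%:R * y <= (1 + y) ^+ N by apply: bernoulli_ge; lra.
have h0 : 0 <= (1 - y) ^+ N by rewrite exprn_ge0 // subr_ge0.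
have := ler_wpM2l h0 h2; nra.
Qed.

(** Take [kernel_params] with l = l0 + 2 and m = j^l0 scales. The loss of mean is of order m j^(1 -
    l) = 1 / j. The l^q quantity is of order j^(l0 (1 - q) + l), whose exponent is at most -1 once
    l0 is at least (2 q - 1) / (q - 2); this uses q > 2. A large j then makes both small. *)
Lemma small_lq_params (q Kq eta : R) (r : nat) : 2 < q -> 0 <= Kq -> 0 < eta ->
  exists m n N T n' : nat,
  [/\ (0 < m)%N /\ (0 < n)%N,
      (r * m)%N%:R * (T%:R * @cb R n') <= eta,
      forall x : R, 0 <= x <= 1 -> 1 - (1 - x ^+ n) ^+ N <= T%:R * x ^+ n',
      forall x : R, 0 <= x <= 1 -> (1 - x ^+ n) ^+ N * x ^+ n <= eta * @cb R n &
      Kq * (m%:R * m%:R^-1 `^ q / @cb R n) <= eta].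
Proof.
move=> q2 Kq0 eta0.
have [l0 [l00 hl0]] := natr_ceil ((2 * q - 1) / (q - 2)).
pose l := (l0 + 2)%N.
have hl : l%:R * (1 - q) + 2 * (q - 1) <= - 1 - l%:R.
  rewrite ler_pdivrMr ?subr_gt0 // in hl0.
  by rewrite /l natrD; nra.
have l1 : (1 < l)%N by rewrite /l addn2.
have [C1 [C10 hC1]] := kernel_params (eta^-1) l1.
have [j [j0 hj]] := natr_ceil ((r%:R * C1%:R) / eta + Kq * (2 * l%:R) / eta).
have jR : 0 < j%:R :> R by rewrite ltr0n.
have [ha hb hc hd] := hC1 j j0.
exists (j ^ l0)%N, (l * j ^ (2 * l))%N, ((C1 * j) ^ l)%N, (C1 * j)%N, (j ^ (2 * l))%N.
have c0 := @cb_gt0 R (l * j ^ (2 * l)).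
split => //.
- by rewrite muln_gt0 !expn_gt0 j0 (ltnW l1).
- have e : (r * j ^ l0)%N%:R * ((C1 * j)%N%:R * @cb R (j ^ (2 * l))) =
     (r%:R * C1%:R) / j%:R * ((j ^ l)%N%:R * @cb R (j ^ (2 * l))).
    rewrite /l expnD !natrM !natrX; field; exact: lt0r_neq0.
  rewrite e; apply: le_trans (_ : r%:R * C1%:R / j%:R <= _).
    by rewrite ler_piMr // divr_ge0 // mulr_ge0.
  rewrite ler_pdivrMr //; rewrite -ler_pdivrMl // mulrC.
  apply: le_trans hj; rewrite lerDl; apply: divr_ge0; last exact: ltW.
  by rewrite !mulr_ge0.
- move=> x /andP[x0 x1].
  have y01 : 0 <= x ^+ (l * j ^ (2 * l)) <= 1 by rewrite exprn_ge0 // exprn_ile1.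
  have := pow_mul_le ((C1 * j) ^ l) y01.
  set N := ((C1 * j) ^ l)%N in ha *; set c := @cb R _ in ha c0 *.
  have N0 : 0 < N%:R :> R by rewrite ltr0n !expn_gt0 muln_gt0 C10 j0.
  move=> h; rewrite -(ler_pM2l N0); apply: le_trans h _.
  by rewrite mulrCA -ler_pdivrMl // mulr1.
- have hpow : (j ^ l0)%N%:R * (j ^ l0)%N%:R^-1 `^ q <= (j ^ l)%N%:R^-1 / j%:R :> R.
    have j1 : 1 <= j%:R :> R by rewrite ler1n.
    have hX k : (j ^ k)%N%:R = j%:R `^ k%:R :> R by rewrite powR_mulrn ?natrX.
    rewrite !hX -!powRN -!powRrM -powRD; last by rewrite (gt_eqF jR) implybT.
    rewrite -[j%:R^-1]powR_inv1 // -powRD; last by rewrite (gt_eqF jR) implybT.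
    apply: ler_powR => //.
    by move: hl; rewrite /l natrD; lra.
  apply: le_trans (_ : Kq * ((j ^ l)%N%:R^-1 / j%:R / @cb R (l * j ^ (2 * l))) <= _).
    by rewrite ler_wpM2l // ler_wpM2r // invr_ge0 ltW.
  have jl : 0 < (j ^ l)%N%:R :> R by rewrite ltr0n expn_gt0 j0.
  have h1 : ((j ^ l)%N%:R * @cb R (l * j ^ (2 * l)))^-1 <= 2 * l%:R.
    have x0 := mulr_gt0 jl c0.
    by rewrite -(ler_pM2r x0) mulVf ?gt_eqF // mulrA.
  have -> : (j ^ l)%N%:R^-1 / j%:R / @cb R (l * j ^ (2 * l)) =
     ((j ^ l)%N%:R * @cb R (l * j ^ (2 * l)))^-1 / j%:R.
    by field; rewrite !gt_eqF.
  rewrite mulrA ler_pdivrMr //.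
  apply: le_trans (ler_wpM2l Kq0 h1) _.
  rewrite -ler_pdivrMl // mulrC; apply: le_trans hj.
  by rewrite lerDr; apply: divr_ge0; [rewrite mulr_ge0|exact: ltW].
Qed.

End KernelParams.

(** * The one-sided multiplier *)

Section OneSided.
Context {R : realType}.
Local Open Scope complex_scope.
Implicit Types (z w : R[i]) (p q : {poly R}).

Lemma Re_sum (I : Type) (s : seq I) (P : pred I) (F : I -> R[i]) :
  complex.Re (\sum_(i <- s | P i) F i) = \sum_(i <- s | P i) complex.Re (F i).
Proof. by apply: (big_morph (@complex.Re R)) => // -[a b] [c d]. Qed.

Lemma Im_sum (I : Type) (s : seq I) (P : pred I) (F : I -> R[i]) :
  complex.Im (\sum_(i <- s | P i) F i) = \sum_(i <- s | P i) complex.Im (F i).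
Proof. by apply: (big_morph (@complex.Im R)) => // -[a b] [c d]. Qed.

Lemma ReZ (a : R) z : complex.Re (a%:C * z) = a * complex.Re z.
Proof. by case: z => b c /=; ring. Qed.

Lemma ImZ (a : R) z : complex.Im (a%:C * z) = a * complex.Im z.
Proof. by case: z => b c /=; ring. Qed.

Lemma Re_inv w : sqn w = 1 -> complex.Re w^-1 = complex.Re w.
Proof. by move=> h; rewrite -(conj_unit h); case: w h. Qed.

Lemma unit_neq0 w : sqn w = 1 -> w != 0.
Proof.
move=> h; apply: contra_eq_neq h => ->.
by rewrite /sqn /= expr0n addr0 eq_sym oner_neq0.
Qed.

(** The Fourier coefficient of x^n at the frequencies j and - j. *)
Definition kc (n j : nat) : R := 'C(n.*2, n + j)%:R / 4 ^+ n.

Lemma kc_ge0 n j : 0 <= kc n j.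
Proof. by rewrite /kc divr_ge0 // exprn_ge0. Qed.

Lemma coef_avg_double n i : (avg ^+ n.*2)`_i = 'C(n.*2, i)%:R / 4 ^+ n :> R.
Proof.
rewrite coef_avg -mul2n exprM; congr (_ / _ ^+ _); by rewrite expr2; ring.
Qed.

Lemma xv_expand n w : sqn w = 1 ->
  xv w ^+ n = cb n + \sum_(j < n) 2 * kc n j.+1 * complex.Re (w ^+ j.+1).
Proof.
move=> hw; have w0 := unit_neq0 hw.
have h : (xv w ^+ n)%:C = w ^- n * hv (avg ^+ n.*2) w.
  rewrite hvE -mul2n exprM hv_avg_sqr // exprMn mulKf ?expf_neq0 //.
  by rewrite rmorphXn.
have -> : xv w ^+ n = complex.Re (w ^- n * hv (avg ^+ n.*2) w) by rewrite -h.
rewrite (@hv_coef _ _ n.*2.+1) ?size_avg // mulr_sumr Re_sum.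
have -> : \sum_(i < n.*2.+1) complex.Re (w ^- n * (((avg ^+ n.*2)`_i)%:C * w ^+ i)) =
   \sum_(0 <= i < n.*2.+1) 'C(n.*2, i)%:R / 4 ^+ n * complex.Re (w ^- n * w ^+ i).
  rewrite big_mkord; apply: eq_bigr => i _.
  by rewrite mulrCA ReZ coef_avg_double.
have nn : (n <= n.*2.+1)%N by rewrite -addnn leqW // leq_addr.
rewrite (big_cat_nat (n := n)) //= [X in _ + X]big_ltn; last first.
  by rewrite -addnn ltnS leq_addr.
rewrite mulVf ?expf_neq0 // /= mulr1 -/(cb n).
rewrite addrCA; congr (_ + _).
have -> : \sum_(0 <= i < n) 'C(n.*2, i)%:R / 4 ^+ n * complex.Re (w ^- n * w ^+ i) =
   \sum_(j < n) kc n j.+1 * complex.Re (w ^+ j.+1).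
  rewrite big_nat_rev /= big_mkord; apply: eq_bigr => i _.
  rewrite add0n; have hi : (i.+1 <= n)%N by [].
  have -> : w ^- n * w ^+ (n - i.+1) = (w ^+ i.+1)^-1.
    rewrite -{1}(subnK hi) exprD invfM mulrC mulVKf ?expf_neq0 //.
  rewrite Re_inv; last by rewrite sqnX hw expr1n.
  congr (_%:R / _ * _).
  rewrite /kc -(@bin_sub (n.*2) (n - i.+1)); last first.
    by rewrite (leq_trans (leq_subr _ _)) // -addnn leq_addr.
  by congr 'C(_, _); rewrite -addnn subnBA // addnC addnA addnK addnC.
have -> : \sum_(n.+1 <= i < n.*2.+1) 'C(n.*2, i)%:R / 4 ^+ n * complex.Re (w ^- n * w ^+ i) =
   \sum_(j < n) kc n j.+1 * complex.Re (w ^+ j.+1).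
  rewrite -{1}[n.+1]add0n big_addn -addnn -addnS addnK big_mkord.
  apply: eq_bigr => i _; rewrite /kc addnn.
  rewrite [(i + n.+1)%N]addnC addSnnS exprD mulKf ?expf_neq0 //.
by rewrite -big_split /=; apply: eq_bigr => i _; ring.
Qed.

Lemma kc_sum n : \sum_(j < n) 2 * kc n j.+1 <= 1.
Proof.
have := xv_expand n (@sqn1 R).
have -> : xv (1 : R[i]) = 1 :> R.
  by rewrite /xv /avg hvZ hvD hvX hv1 /sqn /=; field.
rewrite expr1n => e; rewrite [leRHS]e.
under [X in _ <= _ + X]eq_bigr do rewrite expr1n /= mulr1.
by rewrite lerDr ltW // cb_gt0.
Qed.

Lemma unit_Im_le1 w : sqn w = 1 -> `|complex.Im w| <= 1.
Proof.
case: w => a b; rewrite /sqn /= => h; rewrite -(@ler_pXn2r _ 2) ?nnegrE //.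
by rewrite expr1n real_normK ?num_real // -h lerDr sqr_ge0.
Qed.

(** Let y = x^n and u = 1 + tau F. Then |u|^2 <= exp (tau (2 y / mu - 1)), so with s = k tau the
    k-th power is at most exp (s (2 y / mu - 1)), while (1 - y)^(2 N) <= exp (- 2 N y). As N mu >= A
    + 1 >= s, the terms in y cancel and at most exp (- s) <= exp (- A) <= 1 / A = eta remains,
    uniformly on the circle. *)
Lemma one_sided_params (eta : R) : 0 < eta ->
  exists (n N T n' : nat) (pt : {poly R}),
  [/\ (0 < n)%N, T%:R * cb n' <= eta,
      forall x : R, 0 <= x <= 1 -> 1 - (1 - x ^+ n) ^+ N <= T%:R * x ^+ n' &
      forall w, sqn w = 1 ->
        (1 - xv w ^+ n) ^+ N.*2 * sqn (1 - w * hv pt w) <= eta].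
Proof.
move=> eta0; pose A := eta^-1.
have A0 : 0 < A by rewrite invr_gt0.
have [C1 [C10 hC1]] := kernel_params (A + 1) (isT : (1 < 2)%N).
have [j [j0 hj]] := natr_ceil (C1%:R / eta).
have jR : 0 < j%:R :> R by rewrite ltr0n.
have [ha hb hc _] := hC1 j j0.
set n := (2 * j ^ (2 * 2))%N in ha hb *; set N := ((C1 * j) ^ 2)%N in ha hb *.
pose mu : R := cb n.
have mu0 : 0 < mu by exact: cb_gt0.
have mu1 : mu <= 1 by exact: cb_le1.
have mu_ge0 := ltW mu0.
have im0 : 0 <= mu^-1 by rewrite invr_ge0.
(* Both parts of F are at most 1 / mu in absolute value, so this tau gives tau^2 |F|^2 <= tau: the
   quadratic term of |1 + tau F|^2 takes only half of the gain 2 tau. *)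
pose tau : R := mu ^+ 2 / 2.
have tau0 : 0 < tau by rewrite divr_gt0 // exprn_gt0.
have [k0 [hk1 hk2]] : exists k, A <= (k.+1)%:R * tau /\ k.+1%:R * tau <= A + 1.
  exists (Num.truncn (A / tau)).
  have /andP[h1 h2] := truncn_itv (divr_ge0 (ltW A0) (ltW tau0)).
  rewrite ltr_pdivrMr // in h2; rewrite ler_pdivlMr // in h1.
  split; first exact: ltW.
  rewrite -natr1 mulrDl mul1r lerD // /tau.
  have : mu ^+ 2 <= 1 by rewrite exprn_ile1 // ltW.
  lra.
pose F1 : {poly R} := \poly_(i < n) (2 * kc n i.+1 / mu).
pose u : {poly R} := 1 + tau *: ('X * F1).
(* The quotient of 1 - u^(k0 + 1) by 'X, which divides it because F has no constant term. *)
pose pt := - (tau *: F1) * \sum_(i < k0.+1) u ^+ i.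
exists n, N, (C1 * j)%N, (j ^ (2 * 2))%N, pt; split => //.
- by rewrite muln_gt0 expn_gt0 j0.
- have -> : (C1 * j)%N%:R * cb (j ^ (2 * 2)) =
     C1%:R / j%:R * ((j ^ 2)%N%:R * cb (j ^ (2 * 2))) :> R.
    by rewrite natrM natrX; field; exact: lt0r_neq0.
  apply: le_trans (_ : C1%:R / j%:R <= _).
    by rewrite ler_piMr // divr_ge0.
  by rewrite ler_pdivrMr // -ler_pdivrMl // mulrC.
move=> w hw.
have hpt : 1 - w * hv pt w = hv u w ^+ k0.+1.
  have e : 'X * pt = 1 - u ^+ k0.+1.
    rewrite -[RHS]opprB subrX1 /pt /u -mulNr opprB opprD addNKr mulrA mulrN.
    by rewrite scalerAr.
  have -> : w * hv pt w = hv ('X * pt) w by rewrite [RHS]hvM hvX.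
  by rewrite e hvB hv1 opprB addrC subrK hvE.
rewrite hpt sqnX.
set y := xv w ^+ n.
have /andP[y0 y1] : 0 <= y <= 1.
  by rewrite exprn_ge0 ?xv_ge0 // exprn_ile1 ?xv_ge0 ?xv_le1.
have hFw : hv ('X * F1) w = \sum_(i < n) (2 * kc n i.+1 / mu)%:C * w ^+ i.+1.
  rewrite hvM hvX (@hv_coef _ _ n) ?size_poly // mulr_sumr.
  apply: eq_bigr => i _; rewrite coef_poly ltn_ord mulrCA exprS; by [].
have hRe : complex.Re (hv ('X * F1) w) = y / mu - 1.
  rewrite hFw Re_sum.
  have -> : y / mu - 1 = (\sum_(j < n) 2 * kc n j.+1 * complex.Re (w ^+ j.+1)) / mu.
    rewrite /y xv_expand // -/mu mulrDl divff ?gt_eqF // addrC addKr //.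
  rewrite mulr_suml; apply: eq_bigr => i _.
  by rewrite ReZ mulrAC.
have hIm : `|complex.Im (hv ('X * F1) w)| <= mu^-1.
  rewrite hFw Im_sum; apply: le_trans (ler_norm_sum _ _ _) _.
  apply: le_trans (_ : \sum_(i < n) 2 * kc n i.+1 / mu <= _).
    apply: ler_sum => i _; rewrite ImZ normrM ger0_norm ?ler_piMr //.
    - by rewrite !mulr_ge0 ?kc_ge0 // invr_ge0 ltW.
    - by rewrite unit_Im_le1 // sqnX hw expr1n.
    - by rewrite !mulr_ge0 ?kc_ge0 // invr_ge0 ltW.
  by rewrite -mulr_suml ler_piMl ?kc_sum // invr_ge0 ltW.
have hF : sqn (hv u w) <= expR (tau * (2 * (y / mu) - 1)).
  apply: le_trans (expR_ge1Dx _).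
  rewrite /u hvD hv1 hvZ; move: hRe hIm; case: (hv _ w) => a b /= -> hbi.
  rewrite /sqn /=.
  have hb2 : b ^+ 2 <= mu^-1 ^+ 2 by rewrite -[b ^+ 2]real_normK ?num_real // lerXn2r ?nnegrE //.
  have mi : 1 <= mu^-1 by rewrite invf_ge1.
  have ym : 0 <= y / mu <= mu^-1.
    by rewrite divr_ge0 //= ler_piMl.
  have ha2 : (y / mu - 1) ^+ 2 <= mu^-1 ^+ 2.
    have /andP[] := ym; move: (y / mu) (mu^-1) mi => s t *; nra.
  have ht : tau ^+ 2 * mu^-1 ^+ 2 = tau / 2.
    by rewrite /tau; field; rewrite gt_eqF.
  move: ht hb2 ha2; move: (y / mu) (mu^-1) => s t ht hb2 ha2.
  have t2 : 0 <= tau ^+ 2 by exact: sqr_ge0.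
  have := ler_wpM2l t2 hb2; have := ler_wpM2l t2 ha2; rewrite ht.
  lra.
have hFk : sqn (hv u w) ^+ k0.+1 <= expR (k0.+1%:R * tau * (2 * (y / mu) - 1)).
  rewrite -mulrA expRM_natl lerXn2r ?nnegrE ?sqn_ge0 ?expR_ge0 //.
have hN : (1 - y) ^+ N.*2 <= expR (- (2 * N%:R * y)).
  have -> : - (2 * N%:R * y) = N.*2%:R * (- y) by rewrite -mul2n natrM mulrN.
  rewrite expRM_natl lerXn2r ?nnegrE ?subr_ge0 ?expR_ge0 // expR_ge1Dx //.
apply: le_trans (ler_pM _ _ hN hFk) _ => //.
- by rewrite exprn_ge0 // subr_ge0.
- by rewrite exprn_ge0 // sqn_ge0.
rewrite -expRD; apply: le_trans (_ : expR (- A) <= _).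
  rewrite ler_expR; move: hk1 hk2; set s := _ * tau => hk1 hk2.
  have hy : y / mu * s <= N%:R * y.
    have : s <= N%:R * mu by apply: le_trans hk2 ha.
    move=> h; have ym : 0 <= y / mu by rewrite divr_ge0 // ltW.
    have := ler_wpM2l ym h; move=> h'; apply: le_trans h' _.
    by rewrite mulrCA divfK ?gt_eqF.
  lra.
rewrite expRN -[leRHS]invrK lef_pV2 ?posrE ?expR_gt0 ?invr_gt0 //.
apply: le_trans (expR_ge1Dx A); rewrite /A; lra.
Qed.
End OneSided.

(** * The two-sided multiplier and its scales *)

Section ZStageComb.
Context {R : realType}.
Implicit Types (p q : {poly R}).

Lemma leq_bin_center n k : ('C(n.*2, k) <= 'C(n.*2, n))%N.
Proof.
have step m : (m < n -> 'C(n.*2, m) <= 'C(n.*2, m.+1))%N.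
  move=> mn; have := mul_bin_left n.*2 m => h.
  have : (m.+1 * 'C(n.*2, m) <= m.+1 * 'C(n.*2, m.+1))%N.
    by rewrite h leq_mul2r; apply/orP; right; rewrite -addnn; lia.
  by rewrite leq_pmul2l.
have low : forall d, (d <= n -> 'C(n.*2, n - d) <= 'C(n.*2, n))%N.
  elim=> [|d IH] hd; first by rewrite subn0.
  apply: leq_trans (IH (ltnW hd)); have := step (n - d.+1)%N.
  by rewrite subnSK //; apply; lia.
have [kn|kn] := leqP k n.
  by have := low (n - k)%N; rewrite subKn // leq_subr; apply.
have [k2|k2] := leqP k n.*2; last by rewrite bin_small.
rewrite -bin_sub //; have := low (k - n)%N.
have -> : (n - (k - n) = n.*2 - k)%N by lia.
by apply; lia.
Qed.

Lemma prod_ge_one (I : eqType) (s : seq I) (a : I -> R) :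
  (forall i, i \in s -> 0 <= a i <= 1) ->
  0 <= \prod_(i <- s) a i <= 1 /\
  1 - \prod_(i <- s) a i <= \sum_(i <- s) (1 - a i).
Proof.
elim: s => [|i s IH] h; first by rewrite !big_nil ler01 lexx subrr.
have [|/andP[h1 h2] h3] := IH.
  by move=> j js; apply: h; rewrite inE js orbT.
have /andP[a0 a1] := h i (mem_head _ _).
rewrite !big_cons mulr_ge0 //=; split; first by rewrite mulr_ile1.
move: h1 h2 h3; set P := \prod_(_ <- _) _; set S := \sum_(_ <- _) _ => h1 h2 h3.
nra.
Qed.

Lemma prod_le_factor (I : eqType) (s : seq I) (a : I -> R) i :
  (forall i, i \in s -> 0 <= a i <= 1) -> i \in s ->
  \prod_(i <- s) a i <= a i.
Proof.
move=> h si; rewrite (big_rem i) //=.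
have /andP[a0 a1] := h i si.
have [/andP[_ h1] _] := @prod_ge_one _ (rem i s) a (fun j js => h j (mem_rem js)).
by rewrite ler_piMr.
Qed.

Lemma powR_sum_single (T : finType) (F : T -> R) (q : R) : q != 0 ->
  (forall t t', F t != 0 -> F t' != 0 -> t = t') ->
  `|\sum_t F t| `^ q <= \sum_t `|F t| `^ q.
Proof.
move=> q0 h; have [/existsP[t0 ht0]|/existsPn hN] := boolP [exists t, F t != 0].
  have hF t : t != t0 -> F t = 0.
    move=> tt0; apply/eqP; apply: contraNT tt0 => ht; apply/eqP; exact: h.
  rewrite (bigD1 t0) //= [X in _ + X]big1 ?addr0; last exact: hF.
  rewrite [leRHS](bigD1 t0) //= lerDl; apply: sumr_ge0 => t _; exact: powR_ge0.
rewrite big1; last by move=> t _; apply/eqP; have := hN t; rewrite negbK.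
rewrite normr0 powR0 //; apply: sumr_ge0 => t _; exact: powR_ge0.
Qed.

(* position of a frequency: [e - n] is a signed digit at place [i] in base
   [2 n + 1], and [j + 1] the digit at place [I] *)
Definition pos (n I i e j : nat) : nat :=
  let B := n.*2.+1 in (B ^ I - n * B ^ i + (e * B ^ i + j * B ^ I))%N.

Lemma pos_bound n I i : (i < I)%N -> (n * n.*2.+1 ^ i < n.*2.+1 ^ I)%N.
Proof.
move=> iI; apply: leq_trans (_ : (n.*2.+1 ^ i.+1 <= _)%N); last first.
  by rewrite leq_pexp2l.
by rewrite expnS ltn_pmul2r ?expn_gt0 //; lia.
Qed.

(** The position is (j + 1) B^I + (e - n) B^i, and the second term is below B^I / 2 in absolute
    value, so j is read off first. If i and i' differed, dividing by the smaller of B^i and B^i' and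
    reducing modulo B would force a digit zero. That digit, e = n, is excluded: it would leave no
    trace of i. *)
Lemma pos_inj n I i e j i' e' j' : (i < I)%N -> (i' < I)%N ->
  (e < n.*2.+1)%N -> (e' < n.*2.+1)%N -> e != n -> e' != n ->
  pos n I i e j = pos n I i' e' j' -> [/\ i = i', e = e' & j = j'].
Proof.
move=> iI i'I he he' en e'n; rewrite /pos; set B := n.*2.+1.
have h1 := pos_bound n iI; have h2 := pos_bound n i'I; rewrite -/B in h1 h2.
have h3 : (2 * n * B ^ i < B ^ I)%N.
  apply: leq_trans (_ : (B ^ i.+1 <= _)%N).
    by rewrite expnS ltn_pmul2r ?expn_gt0 // /B; lia.
  by rewrite leq_pexp2l.
have h4 : (2 * n * B ^ i' < B ^ I)%N.
  apply: leq_trans (_ : (B ^ i'.+1 <= _)%N).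
    by rewrite expnS ltn_pmul2r ?expn_gt0 // /B; lia.
  by rewrite leq_pexp2l.
have h5 : (e * B ^ i <= 2 * n * B ^ i)%N by rewrite leq_mul2r; apply/orP; right; lia.
have h6 : (e' * B ^ i' <= 2 * n * B ^ i')%N by rewrite leq_mul2r; apply/orP; right; lia.
have key : forall a b c a' b' c' D : nat, (a < D -> a' < D ->
   b <= 2 * a -> b' <= 2 * a' -> 2 * a < D -> 2 * a' < D ->
   D - a + (b + j * D) = D - a' + (b' + j' * D) -> j = j' /\ b + a' = b' + a)%N.
  move=> a b _ a' b' _ D d1 d2 d3 d4 d5 d6 d7.
  have : j = j'.
    have [jj|jj|//] := ltngtP j j'.
      have : (j.+1 * D <= j' * D)%N by rewrite leq_mul2r jj orbT.
      rewrite mulSn; lia.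
    have : (j'.+1 * D <= j * D)%N by rewrite leq_mul2r jj orbT.
    rewrite mulSn; lia.
  by move=> jj; split=> //; rewrite jj in d7; lia.
move=> /(key _ _ 0 _ _ 0 _ h1 h2)%N.
rewrite !mulnA => /(_ h5 h6 h3 h4)[jj hb].
suff [-> ->] : i = i' /\ e = e' by [].
have aux k k' f f' : (f < B -> f != n -> k < k' ->
    f * B ^ k + n * B ^ k' = f' * B ^ k' + n * B ^ k -> False)%N.
  move=> hf fn kk; have -> : (k' = k + (k' - k.+1).+1)%N by lia.
  rewrite expnD expnS; have D0 : (0 < B ^ k)%N by rewrite expn_gt0.
  move: (B ^ k)%N (B ^ (k' - k.+1))%N D0 => D E D0 h.
  have : (D * (n * E * B + f) = D * (f' * E * B + n))%N by rewrite !mulnDr; lia.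
  move=> /eqP; rewrite eqn_pmul2l // => /eqP /(congr1 (modn^~ B)).
  rewrite !modnMDl !modn_small //; last by rewrite /B; lia.
  by move=> hh; rewrite hh eqxx in fn.
have [ii|ii|ii] := ltngtP i i'.
- by case: (aux i i' e e').
- by case: (aux i' i e' e) => //; rewrite addnC -hb addnC.
- split=> //; move: hb; rewrite ii => /eqP.
  by rewrite eqn_add2r eqn_pmul2r ?expn_gt0 // => /eqP.
Qed.

End ZStageComb.

(** * The multipliers phi: spectra, l^q norms, values on the circle *)

Section Multiplier.
Context {R : realType}.
Local Open Scope complex_scope.
Implicit Types (z w : R[i]) (p pt : {poly R}).

(* 1 - x(w)^n / cb n, shifted by n *)
Definition twosided (n : nat) : {poly R} := 'X^n - (cb n)^-1 *: avg ^+ n.*2.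

(** The division by [cb n] is made for this: mean zero means that the digit zero never occurs, as
    [pos_inj] requires. *)
Lemma coef_twosided_n n : (twosided n)`_n = 0.
Proof.
by rewrite /twosided coefB coefXn eqxx coefZ coef_avg_double -/(cb n) mulVf ?subrr // gt_eqF // cb_gt0.
Qed.

Lemma size_twosided n : (size (twosided n) <= n.*2.+1)%N.
Proof.
apply: (leq_trans (size_polyD _ _)); rewrite size_polyN geq_max size_polyXn.
rewrite (leq_trans (size_scale_leq _ _)) ?size_avg // andbT ltnS -addnn leq_addr //.
Qed.

(** The coefficients are at most 1 in absolute value, the central binomial coefficient being the
    largest, so q-th powers only decrease them; their sum is bounded by evaluating [avg ^+ n.*2] at
    1. *)
Lemma twosided_lq n (q : R) : 1 <= q ->
  \sum_(e < n.*2.+1) `|(twosided n)`_e| `^ q <= (cb n)^-1.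
Proof.
move=> q1; have c0 := @cb_gt0 R n; have c1 := ltW c0.
have le e : `|(twosided n)`_e| `^ q <= (avg ^+ n.*2)`_e / cb n.
  have [->|en] := eqVneq e n.
    rewrite coef_twosided_n normr0 powR0; last by rewrite gt_eqF // (lt_le_trans ltr01).
    by rewrite divr_ge0 // coef_avg divr_ge0 // exprn_ge0.
  rewrite /twosided coefB coefXn (negbTE en) sub0r normrN coefZ.
  have k0 : 0 <= (avg ^+ n.*2)`_e :> R by rewrite coef_avg divr_ge0 // exprn_ge0.
  have k1 : (avg ^+ n.*2)`_e <= cb n :> R.
    rewrite coef_avg_double /cb ler_wpM2r ?invr_ge0 ?exprn_ge0 // ler_nat.
    exact: leq_bin_center.
  rewrite ger0_norm; last by rewrite mulr_ge0 // invr_ge0 ltW.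
  rewrite mulrC; apply: le_trans (_ : ((avg ^+ n.*2)`_e / cb n) `^ 1 <= _); last first.
    by rewrite powRr1 ?divr_ge0.
  move: k0; rewrite le_eqVlt => /predU1P[<-|k0].
    by rewrite mul0r powRr1 // powR0 // gt_eqF // (lt_le_trans ltr01).
  by rewrite ger_powR // divr_gt0 //= ler_pdivrMr // mul1r.
apply: le_trans (_ : \sum_(e < n.*2.+1) (avg ^+ n.*2)`_e / cb n <= _).
  by apply: ler_sum => e _; exact: le.
rewrite -mulr_suml ler_piMl // ?invr_ge0 //.
have h : (avg ^+ n.*2).[1] = 1 :> R.
  by rewrite horner_exp /avg hornerZ hornerD hornerX hornerC mulVf ?expr1n.
rewrite -h (@horner_coef_wide _ n.*2.+1) ?size_avg //.
by apply: ler_sum => e _; rewrite expr1n mulr1.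
Qed.

Lemma comp_Xn_expand p D M : (size p <= M)%N ->
  p \Po 'X^D = \sum_(e < M) p`_e *: 'X^(e * D).
Proof.
move=> hM; have {1}-> : p = \poly_(e < M) p`_e.
  apply/polyP => i; rewrite coef_poly; case: ltnP => // Mi.
  by rewrite nth_default // (leq_trans hM).
rewrite poly_def rmorph_sum; apply: eq_bigr => e _ /=.
by rewrite comp_polyZ comp_Xn_poly -exprM mulnC.
Qed.

Section Phi.
Variables (n m I : nat) (pt : {poly R}).
Let B := n.*2.+1.

(* the average over m scales of [twosided], times 'X * pt placed at a larger
   scale so that all frequencies become positive and distinct *)
Definition zphi (s : nat) : {poly R} :=
  \sum_(l < m) (m%:R^-1) *: ('X^(B ^ I - n * B ^ (s * m + l)) *
     ((twosided n \Po 'X^(B ^ (s * m + l))) * (pt \Po 'X^(B ^ I)))).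

(** Indices of the monomials of the expanded product: scale, exponent inside [twosided n], exponent
    inside [pt]. *)
Definition ztype := ('I_m * 'I_B * 'I_(size pt))%type.
Definition zpos (s : nat) (t : ztype) : nat :=
  pos n I (s * m + t.1.1) t.1.2 t.2.
Definition zcoef (t : ztype) : R :=
  m%:R^-1 * ((twosided n)`_t.1.2 * pt`_t.2).

Lemma coef_zphi s a : (zphi s)`_a = \sum_(t : ztype) zcoef t * (a == zpos s t)%:R.
Proof.
rewrite /zphi coef_sum -(pair_bigA _ (fun le (j : 'I_(size pt)) =>
   zcoef (le, j) * (a == zpos s (le, j))%:R)) /=.
rewrite -(pair_bigA _ (fun l e => \sum_(j < size pt)
   zcoef (l, e, j) * (a == zpos s (l, e, j))%:R)) /=.
apply: eq_bigr => l _.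
rewrite (comp_Xn_expand _ (size_twosided n)) (comp_Xn_expand _ (leqnn (size pt))).
rewrite mulr_suml mulr_sumr scaler_sumr coef_sum; apply: eq_bigr => e _.
rewrite mulr_sumr mulr_sumr scaler_sumr coef_sum; apply: eq_bigr => j _.
rewrite coefZ -scalerAl -!scalerAr scalerA coefZ -!exprD coefXn /zcoef /zpos /pos /=.
by rewrite mulrA.
Qed.

Lemma zpos_inj s s' (t t' : ztype) : (s * m + t.1.1 < I)%N -> (s' * m + t'.1.1 < I)%N ->
  zcoef t != 0 -> zcoef t' != 0 -> zpos s t = zpos s' t' -> s = s' /\ t = t'.
Proof.
case: t t' => [[l e] j] [[l' e'] j'] /= h h' ht ht' /pos_inj.
have en (u : ztype) : zcoef u != 0 -> (u.1.2 : nat) != n.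
  apply: contra_neq => un.
  by rewrite /zcoef un coef_twosided_n mul0r mulr0.
case=> //; [exact: (en _ ht)|exact: (en _ ht')|].
move=> hi he hj.
have m0 : (0 < m)%N := leq_ltn_trans (leq0n _) (ltn_ord l).
have ll : l = l' :> nat.
  have := congr1 (modn^~ m) hi; rewrite !modnMDl !modn_small //.
split; last by congr (_, _, _); exact: val_inj.
by move: hi; rewrite ll => /eqP; rewrite eqn_add2r eqn_pmul2r // => /eqP.
Qed.

Lemma zphi_neq0 s a : (zphi s)`_a != 0 ->
  exists t, zcoef t != 0 /\ a = zpos s t.
Proof.
rewrite coef_zphi => h.
have [/existsP[t /andP[h1 /eqP h2]]|/existsPn hN] :=
    boolP [exists t : ztype, (zcoef t != 0) && (a == zpos s t)].
  by exists t.
case/eqP: h; apply: big1 => t _; have := hN t; rewrite negb_and negbK.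
by case/orP=> [/eqP ->|/negbTE ->]; rewrite ?mul0r ?mulr0.
Qed.

Variable r : nat.
Hypothesis hI : I = (r * m)%N.

Lemma zindex s (l : 'I_m) : (s < r)%N -> (s * m + l < I)%N.
Proof.
move=> sr; rewrite hI; apply: leq_trans (_ : (s.+1 * m <= _)%N).
  by rewrite mulSn addnC ltn_add2r.
by rewrite leq_mul2r sr orbT.
Qed.

Lemma zphi_0 s : (s < r)%N -> (zphi s)`_0 = 0.
Proof.
move=> sr; apply/eqP/negPn/negP => /zphi_neq0[t [_]].
have := pos_bound n (zindex t.1.1 sr); rewrite /zpos /pos.
set a := (n * _)%N; set b := (n.*2.+1 ^ I)%N; lia.
Qed.

Lemma zphi_disj s s' a : (s < r)%N -> (s' < r)%N ->
  (zphi s)`_a != 0 -> (zphi s')`_a != 0 -> s = s'.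
Proof.
move=> sr sr' /zphi_neq0[t [ht ->]] /zphi_neq0[t' [ht' e]].
by have [] := zpos_inj (zindex _ sr) (zindex _ sr') ht ht' e.
Qed.

(** By [zpos_inj] every coefficient is a single product [zcoef t], so the sum of q-th powers factors
    over the three components of t. *)
Lemma zphi_lq s A (q : R) : (s < r)%N -> 1 <= q ->
  \sum_(a < A) `|(zphi s)`_a| `^ q <=
  m%:R * m%:R^-1 `^ q / cb n * \sum_(j < size pt) `|pt`_j| `^ q.
Proof.
move=> sr q1; have q0 : q != 0 by rewrite gt_eqF // (lt_le_trans ltr01).
apply: le_trans (_ : \sum_(a < A) \sum_(t : ztype) `|zcoef t| `^ q * (a == zpos s t :> nat)%:R <= _).
  apply: ler_sum => a _; rewrite coef_zphi.
  apply: le_trans (powR_sum_single q0 _) _; last first.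
    apply: ler_sum => t _; case: eqP => _; rewrite ?mulr1 ?mulr0 //.
    by rewrite normr0 powR0.
  have nz (u : ztype) : zcoef u * (a == zpos s u :> nat)%:R != 0 -> zcoef u != 0 /\ a = zpos s u :> nat.
    by have [->|_] := eqVneq (a : nat) (zpos s u); rewrite ?mulr1 // mulr0 eqxx.
  move=> t t' /nz[h1 h2] /nz[h3 h4].
  by have [] := zpos_inj (zindex _ sr) (zindex _ sr) h1 h3 (etrans (esym h2) h4).
rewrite exchange_big /=.
apply: le_trans (_ : \sum_(t : ztype) `|zcoef t| `^ q <= _).
  apply: ler_sum => t _; rewrite -mulr_sumr ler_piMr ?powR_ge0 //.
  have [h|h] := ltnP (zpos s t) A.
    rewrite (bigD1 (Ordinal h)) //= eqxx big1 ?addr0 // => a.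
    by rewrite -val_eqE /= => /negbTE ->.
  rewrite big1 // => a _; case: eqP => // e.
  by have := ltn_ord a; rewrite e ltnNge h.
rewrite -(pair_bigA _ (fun le (j : 'I_(size pt)) => `|zcoef (le, j)| `^ q)) /=.
rewrite -(pair_bigA _ (fun l e => \sum_(j < size pt) `|zcoef (l, e, j)| `^ q)) /=.
under eq_bigr => l _.
  under eq_bigr => e _.
    under eq_bigr => j _.
      rewrite /zcoef /= !normrM !powRM ?mulr_ge0 // ger0_norm ?invr_ge0 //.
      over.
    rewrite -mulr_sumr -mulr_sumr; over.
  rewrite -mulr_sumr -mulr_suml; over.
rewrite sumr_const card_ord -[leLHS]mulr_natl mulrA -[in leRHS]mulrA.
rewrite ler_wpM2l ?mulr_ge0 ?powR_ge0 //.
apply: ler_wpM2r; first by apply: sumr_ge0 => j _; exact: powR_ge0.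
exact: twosided_lq.
Qed.

(** The power of 'X in [zphi] undoes the shift carried by [twosided n] at each scale; what is left
    of B^I is the factor 'X of the one-sided polynomial 'X * [pt] at scale B^I. *)
Lemma hv_zphi s w : (s < r)%N -> sqn w = 1 ->
  (0 < m)%N ->
  hv (zphi s) w = (1 - m%:R^-1 * \sum_(l < m) (xv (w ^+ (B ^ (s * m + l))) ^+ n / cb n))%:C
   * (w ^+ (B ^ I) * hv pt (w ^+ (B ^ I))) :> R[i].
Proof.
move=> sr hw m0.
have -> : 1 - m%:R^-1 * \sum_(l < m) (xv (w ^+ (B ^ (s * m + l))) ^+ n / cb n) =
   \sum_(l < m) m%:R^-1 * (1 - xv (w ^+ (B ^ (s * m + l))) ^+ n / cb n) :> R.
  rewrite -mulr_sumr sumrB mulrBr sumr_const card_ord.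
  by rewrite mulVf // pnatr_eq0 -lt0n.
rewrite rmorph_sum mulr_suml /zphi hv_sum; apply: eq_bigr => l _.
rewrite hvZ rmorphM -mulrA; congr (_ * _).
rewrite !hvM hvXn !hv_comp_Xn; set W := w ^+ (B ^ I).
rewrite /twosided hvB hvXn hvZ -mul2n hvE exprM hv_avg_sqr; last by rewrite sqnX hw expr1n.
rewrite exprMn -!exprM.
have hb := ltnW (pos_bound n (zindex l sr)); rewrite -/B in hb.
have -> : W = w ^+ (B ^ I - n * B ^ (s * m + l)) * w ^+ (B ^ (s * m + l) * n).
  by rewrite -exprD [(_ * n)%N]mulnC subnK.
rewrite rmorphB rmorph1 rmorphM /= rmorphXn fmorphV; ring.
Qed.
End Phi.
End Multiplier.

(** * The pair (psi, phi), with one psi for r multipliers *)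

Section ZStage.
Context {R : realType}.
Local Open Scope complex_scope.
Implicit Types (z w : R[i]) (p pt : {poly R}) (fs : seq (nat * nat)).

Definition pfac fs : {poly R} := \prod_(f <- fs) fac f.1 f.2.
Definition psh fs : nat := (\sum_(f <- fs) f.1 * f.2)%N.
Definition psi fs w : R := \prod_(f <- fs) (1 - xv (w ^+ f.1) ^+ f.2).

Lemma hv_pfac fs w : sqn w = 1 ->
  hv (pfac fs) w = w ^+ psh fs * (psi fs w)%:C.
Proof.
move=> hw; rewrite /pfac /psh /psi; elim: fs => [|f fs IH].
  by rewrite !big_nil hv1 expr0 mul1r.
rewrite !big_cons hvM hv_fac // IH exprD rmorphM /=; ring.
Qed.

Lemma xv_pow01 w D n : sqn w = 1 -> 0 <= 1 - xv (w ^+ D) ^+ n <= 1.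
Proof.
move=> hw; have hD : sqn (w ^+ D) = 1 by rewrite sqnX hw expr1n.
by rewrite subr_ge0 exprn_ile1 ?xv_ge0 ?xv_le1 //= gerBl exprn_ge0 // xv_ge0.
Qed.

Lemma sqn4 (a b c d : R[i]) :
  sqn (a + b + c + d) <= 4 * (sqn a + sqn b + sqn c + sqn d).
Proof.
have h1 := sqnD_le (a + b) (c + d); have h2 := sqnD_le a b; have h3 := sqnD_le c d.
rewrite -addrA; lra.
Qed.

(** psi carries a factor at each of the r m two-sided scales and one at the top scale, so it damps
    all r multipliers at once; the s-th one averages over its own m scales, which makes the spectra
    disjoint. *)
Lemma zstage (q eta : R) (r : nat) : 2 < q -> 0 < eta ->
  exists (fs : seq (nat * nat)) (phi : nat -> {poly R}),
  [/\ (forall f, f \in fs -> (0 < f.1)%N /\ (0 < f.2)%N),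
      (forall s, (s < r)%N -> (phi s)`_0 = 0) /\
      (forall s s' a, (s < r)%N -> (s' < r)%N ->
         (phi s)`_a != 0 -> (phi s')`_a != 0 -> s = s'),
      n2 (pfac fs - 'X^(psh fs)) <= eta,
      forall s, (s < r)%N -> n2 (phi s * pfac fs - 'X^(psh fs)) <= eta &
      forall A, \sum_(s < r) \sum_(a < A) `|(phi s)`_a| `^ q <= eta].
Proof.
(* 20 = 12 + 4 * 2: [sqn4] costs a factor 4, three of its four terms are at most e pointwise, and
   the mean of 1 - psi is at most 2 e. *)
move=> q2 eta0; pose e : R := Num.min 1 (eta / 20).
have e0 : 0 < e by rewrite lt_min ltr01 divr_gt0.
have e1 : e <= 1 by rewrite ge_min lexx.
have e20 : 20 * e <= eta.
  have : e <= eta / 20 by rewrite ge_min lexx orbT.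
  lra.
have [n2_ [N2 [T2 [n2' [pt [n20 hT2 hE2 hR2]]]]]] := one_sided_params e0.
(* [pt] is fixed before n and m, since its coefficients enter the l^q bound that m has to beat. *)
pose Kp := \sum_(j < size pt) `|pt`_j| `^ q.
have Kp0 : 0 <= Kp by apply: sumr_ge0 => j _; exact: powR_ge0.
have rKp0 : 0 <= r%:R * Kp by rewrite mulr_ge0.
have [m [n [N [T [n' [[m0 n0] hT hE hR hK]]]]]] := small_lq_params r q2 rKp0 e0.
pose I := (r * m)%N; pose B := n.*2.+1.
pose fs := flatten [seq nseq N (B ^ i, n)%N | i <- iota 0 I] ++
  nseq N2 (B ^ I, n2_)%N.
have BX i : (0 < B ^ i)%N by rewrite expn_gt0.
pose yA i w : R := (1 - xv (w ^+ (B ^ i)) ^+ n) ^+ N.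
pose yB w : R := (1 - xv (w ^+ (B ^ I)) ^+ n2_) ^+ N2.
have psiE w : psi fs w = (\prod_(i <- iota 0 I) yA i w) * yB w.
  rewrite /psi /fs big_cat big_flatten big_map /=; congr (_ * _).
    by apply: eq_bigr => i _; rewrite big_nseq -/(iter _ _ _) iter_mulr_1.
  by rewrite big_nseq iter_mulr_1.
have yA01 i w : sqn w = 1 -> 0 <= yA i w <= 1.
  move=> hw; have /andP[h1 h2] := xv_pow01 (B ^ i) n hw.
  by rewrite exprn_ge0 // exprn_ile1.
have yB01 w : sqn w = 1 -> 0 <= yB w <= 1.
  move=> hw; have /andP[h1 h2] := xv_pow01 (B ^ I) n2_ hw.
  by rewrite exprn_ge0 // exprn_ile1.
have psi01 w : sqn w = 1 -> 0 <= psi fs w <= 1.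
  move=> hw; have [/andP[h1 h2] _] := @prod_ge_one _ _ (iota 0 I) (yA^~ w) (fun i _ => yA01 i w hw).
  by have /andP[h3 h4] := yB01 w hw; rewrite psiE mulr_ge0 // mulr_ile1.
have x01 i w : sqn w = 1 -> 0 <= xv (w ^+ i) <= 1.
  by move=> hw; rewrite xv_ge0 xv_le1 // sqnX hw expr1n.
(* 1 - psi is at most the sum over the scales of 1 - (1 - x^n)^N <= T x^n', and the mean of each
   x^n' is [cb n'] whatever the scale. *)
have main p alpha c : 0 <= c -> (forall w, sqn w = 1 -> sqn (hv p w) <= c * (1 - psi fs w) + alpha) ->
    n2 p <= alpha + c * (2 * e).
  move=> c0 h.
  pose s := (c * T2%:R, avgX (B ^ I) ^+ n2') :: [seq (c * T%:R, avgX (B ^ i) ^+ n') | i <- iota 0 I] : seq (R * {poly R}).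
  apply: le_trans (@n2_le _ p alpha s _) _.
    move=> w hw; apply: le_trans (h w hw) _; rewrite addrC lerD2l.
    have /andP[hB0 hB1] := yB01 w hw.
    have [/andP[hA0 hA1] hA] := @prod_ge_one _ _ (iota 0 I) (yA^~ w) (fun i _ => yA01 i w hw).
    apply: le_trans (_ : c * ((1 - yB w) + \sum_(i <- iota 0 I) (1 - yA i w)) <= _).
      rewrite ler_wpM2l // psiE; apply: le_trans (_ : (1 - yB w) + (1 - \prod_(i <- iota 0 I) yA i w) <= _); last by rewrite lerD2l.
      move: hA0 hA1; set P := \prod_(_ <- _) _ => hA0 hA1; nra.
    rewrite /s big_cons big_map /= mulrDr lerD //.
      rewrite -mulrA ler_wpM2l // hvE hv_avgX sqnX; apply: hE2; exact: x01.
    rewrite mulr_sumr; apply: ler_sum => i _; rewrite -mulrA ler_wpM2l //.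
    by rewrite hvE hv_avgX sqnX; apply: hE; exact: x01.
  rewrite lerD2l /s big_cons big_map /= n2_avgX //.
  under eq_bigr do rewrite n2_avgX //.
  rewrite big_const_seq count_predT size_iota -/(iter _ _ _) iter_addr_0 -mulrA -mulr_natl.
  have := ler_wpM2l c0 hT; have := ler_wpM2l c0 hT2; rewrite -/I; lra.
exists fs, (zphi n m I pt); split.
- move=> f; rewrite mem_cat => /orP[/flattenP[s /mapP[i _ ->]]|]; rewrite mem_nseq => /andP[_ /eqP ->] //=.
- split=> [s sr|s s' a sr sr'].
    exact: (@zphi_0 R n m I pt r (erefl I) s sr).
  exact: (@zphi_disj R n m I pt r (erefl I) s s' a sr sr').
- apply: le_trans (main _ 0 1 _ _) _ => //; last by lra.
  move=> w hw; rewrite hvB hv_pfac // hvXn -[X in _ - X]mulr1 -mulrBr sqnM sqnX hw expr1n mul1r.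
  rewrite -(rmorph1 (real_complex R)) -rmorphB sqn_real addr0 mul1r.
  have /andP[h1 h2] := psi01 w hw; nra.
- move=> s sr; apply: le_trans (main _ (12 * e) 4 _ _) _ => //; last by lra.
  move=> w hw; rewrite hvB hvM hv_pfac // hvXn (@hv_zphi R n m I pt r (erefl I)) // -/B.
  set W := w ^+ (B ^ I); set a : R := m%:R^-1 * _; set ps := psi fs w.
  set Rr := 1 - W * hv pt W.
  (* Here a is large near the peaks of the two-sided scales, where the factor P of psi is tiny, and
     Rr near that of the top scale, where [yB] is tiny. Expanding (1 - a) (1 - Rr) ps - 1 leaves
     four terms, each controlled by one of these facts or by the mean of 1 - psi. *)
  have -> : (1 - a)%:C * (W * hv pt W) * (w ^+ psh fs * ps%:C) - w ^+ psh fs =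
     w ^+ psh fs * ((ps - 1)%:C + (- (ps * a))%:C + (ps * a)%:C * Rr + (- ps)%:C * Rr).
    by rewrite /Rr !rmorphB !rmorphN !rmorphM !rmorph1; ring.
  rewrite sqnM sqnX hw expr1n mul1r.
  apply: le_trans (sqn4 _ _ _ _) _; rewrite !sqnM !sqn_real !sqrrN.
  have hW : sqn W = 1 by rewrite sqnX hw expr1n.
  have hBR : yB w ^+ 2 * sqn Rr <= e.
    rewrite /yB -exprM muln2; exact: hR2.
  have /andP[ps0 ps1] := psi01 w hw; rewrite -/ps in ps0 ps1.
  have [/andP[hA0 hA1] _] := @prod_ge_one _ _ (iota 0 I) (yA^~ w) (fun i _ => yA01 i w hw).
  have /andP[hB0 hB1] := yB01 w hw.
  have psE := psiE w; rewrite -/ps in psE.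
  move: hA0 hA1 psE; set P := \prod_(_ <- _) _ => hA0 hA1 psE.
  have a0 : 0 <= a.
    rewrite mulr_ge0 // ?invr_ge0 //; apply: sumr_ge0 => l _.
    by rewrite divr_ge0 ?exprn_ge0 ?xv_ge0 // ltW // cb_gt0.
  have Pa : P * a <= e.
    rewrite /a mulrCA ler_pdivrMl ?ltr0n // mulr_sumr.
    apply: le_trans (_ : \sum_(l < m) e <= _); last by rewrite sumr_const card_ord mulr_natl.
    apply: ler_sum => l _; rewrite mulrA ler_pdivrMr ?cb_gt0 //.
    apply: le_trans (hR _ (x01 (B ^ (s * m + l))%N w hw)).
    rewrite ler_wpM2r ?exprn_ge0 ?xv_ge0 //.
    apply: (@prod_le_factor _ _ _ (yA^~ w)); first by move=> i _; exact: yA01.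
    by rewrite mem_iota add0n leq0n /= (@zindex m I r (erefl I)).
  have Rr0 := sqn_ge0 Rr.
  have Pa0 : 0 <= P * a by rewrite mulr_ge0.
  have psa : (ps * a) ^+ 2 <= e ^+ 2.
    have h : ps * a <= e by rewrite psE mulrAC; apply: le_trans Pa; rewrite ler_piMr.
    have h' : 0 <= ps * a by rewrite mulr_ge0.
    nra.
  have h3 : (ps * a) ^+ 2 * sqn Rr <= e.
    have -> : (ps * a) ^+ 2 * sqn Rr = (P * a) ^+ 2 * (yB w ^+ 2 * sqn Rr) by rewrite psE; ring.
    apply: le_trans (_ : 1 * e <= _); last by rewrite mul1r.
    apply: ler_pM => //; first by rewrite exprn_ge0.
      by rewrite mulr_ge0 // sqr_ge0.
    rewrite exprn_ile1 //; exact: le_trans Pa e1.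
  have h4 : ps ^+ 2 * sqn Rr <= e.
    have -> : ps ^+ 2 * sqn Rr = P ^+ 2 * (yB w ^+ 2 * sqn Rr) by rewrite psE; ring.
    apply: le_trans (_ : 1 * e <= _); last by rewrite mul1r.
    apply: ler_pM => //; first by rewrite exprn_ge0.
      by rewrite mulr_ge0 // sqr_ge0.
    by rewrite exprn_ile1.
  have h1 : (ps - 1) ^+ 2 <= 1 - ps by nra.
  have h2 : e ^+ 2 <= e by nra.
  lra.
- move=> A; apply: le_trans (_ : \sum_(s < r) (m%:R * m%:R^-1 `^ q / cb n * Kp) <= _).
    by apply: ler_sum => s _; apply: (@zphi_lq R n m I pt r (erefl I)) => //; apply: ltW; apply: lt_trans q2; rewrite ltr1n.
  rewrite sumr_const card_ord -[leLHS]mulr_natr.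
  have -> : m%:R * m%:R^-1 `^ q / cb n * Kp * r%:R =
    r%:R * Kp * (m%:R * m%:R^-1 `^ q / cb n) by ring.
  apply: le_trans hK _; lra.
Qed.
End ZStage.

(** * Convolution with a sequence supported on d Z *)

Section Act.
Context {R : realType}.
Implicit Types (f g u v : R -> R) (p : {poly R}) (d x S : R).

Definition act d p g : R -> R := \sum_(i < size p) p`_i *: tr (i%:R * d) g.

Lemma act_wide d p g M : (size p <= M)%N ->
  act d p g = \sum_(i < M) p`_i *: tr (i%:R * d) g.
Proof.
move=> hM; rewrite /act (big_ord_widen M (fun i => p`_i *: tr (i%:R * d) g)) //.
rewrite [RHS](bigID (fun i : 'I_M => (i < size p)%N)) /=.
rewrite [X in _ = _ + X]big1 ?addr0 // => i; rewrite -leqNgt => h.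
by rewrite nth_default // scale0r.
Qed.

Lemma actD d p r g : act d (p + r) g = act d p g + act d r g.
Proof.
pose M := maxn (size p) (size r).
rewrite (@act_wide d (p + r) g M) ?size_polyD // (@act_wide d p g M) ?leq_maxl //.
rewrite (@act_wide d r g M) ?leq_maxr // -big_split; apply: eq_bigr => i _.
by rewrite coefD scalerDl.
Qed.

Lemma act0 d g : act d 0 g = 0.
Proof. by rewrite /act size_poly0 big_ord0. Qed.

Lemma actZ d a p g : act d (a *: p) g = a *: act d p g.
Proof.
rewrite (@act_wide d _ g (size p)) ?size_scale_leq // /act scaler_sumr.
by apply: eq_bigr => i _; rewrite coefZ scalerA.
Qed.

Lemma actN d p g : act d (- p) g = - act d p g.
Proof. by rewrite -scaleN1r actZ scaleN1r. Qed.

Lemma actB d p r g : act d (p - r) g = act d p g - act d r g.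
Proof. by rewrite actD actN. Qed.

Lemma act_sum d (I : Type) (s : seq I) (P : pred I) (F : I -> {poly R}) g :
  act d (\sum_(i <- s | P i) F i) g = \sum_(i <- s | P i) act d (F i) g.
Proof.
by apply: (big_morph (fun p => act d p g)) => [p r|]; [exact: actD|exact: act0].
Qed.

Lemma actXn d n g : act d 'X^n g = tr (n%:R * d) g.
Proof.
rewrite /act size_polyXn (bigD1 ord_max) //= coefXn eqxx scale1r big1 ?addr0 //.
move=> i hi; rewrite coefXn; have /negbTE -> : (i : nat) != n by apply: contra hi => /eqP h; apply/eqP/val_inj.
by rewrite scale0r.
Qed.

Lemma act1 d g : act d 1 g = g.
Proof. by rewrite -(expr0 'X) actXn mul0r tr0. Qed.

Lemma act_lin d p a u v : act d p (a *: u + v) = a *: act d p u + act d p v.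
Proof.
rewrite /act scaler_sumr -big_split; apply: eq_bigr => i _.
by rewrite trD trZ scalerDr !scalerA mulrC.
Qed.

Lemma actDr d p u v : act d p (u + v) = act d p u + act d p v.
Proof. by have := act_lin d p 1 u v; rewrite !scale1r. Qed.

Lemma act_r0 d p : act d p 0 = 0.
Proof.
by rewrite /act; apply: big1 => i _; rewrite (_ : tr _ 0 = 0) ?scaler0.
Qed.

Lemma actZr d p a u : act d p (a *: u) = a *: act d p u.
Proof. by have := act_lin d p a u 0; rewrite !addr0 act_r0 addr0. Qed.

Lemma act_sumr d p (I : Type) (s : seq I) (P : pred I) (F : I -> R -> R) :
  act d p (\sum_(i <- s | P i) F i) = \sum_(i <- s | P i) act d p (F i).
Proof.
by apply: (big_morph (act d p)) => [u v|]; [exact: actDr|exact: act_r0].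
Qed.

Lemma act_tr d p x g : act d p (tr x g) = tr x (act d p g).
Proof.
by rewrite /act tr_sum; apply: eq_bigr => i _; rewrite trZ !tr_tr addrC.
Qed.

Lemma actXnM d n p g : act d ('X^n * p) g = tr (n%:R * d) (act d p g).
Proof.
rewrite {1}(_ : p = \poly_(i < size p) p`_i); last by rewrite coefK.
rewrite poly_def mulr_sumr act_sum tr_sum; apply: eq_bigr => i _.
by rewrite -scalerAr actZ -exprD actXn trZ tr_tr natrD mulrDl.
Qed.

Lemma actM d p r g : act d (p * r) g = act d p (act d r g).
Proof.
rewrite {1}(_ : p = \poly_(i < size p) p`_i); last by rewrite coefK.
rewrite poly_def mulr_suml act_sum; apply: eq_bigr => i _.
by rewrite -scalerAl actZ actXnM.
Qed.

Lemma sqint_act d p g : sqint g -> sqint (act d p g).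
Proof. by move=> hg; apply: sqint_sum => i _; apply: sqintZ; exact: sqint_tr. Qed.

Definition supp S g := forall t, S < `|t| -> g t = 0.

Lemma ip_tr_disj S g x y : supp S g -> 2 * S < `|x - y| ->
  ip (tr x g) (tr y g) = 0.
Proof.
move=> hS hxy; apply: ip_disj => t.
have [h|h] := ltP S `|t - x|; first by left; exact: hS.
right; apply: hS; rewrite ltNge; apply/negP => h'.
have : `|x - y| <= S + S.
  have -> : x - y = (t - y) - (t - x) by ring.
  by apply: le_trans (ler_normB _ _) _; rewrite lerD.
lra.
Qed.

Lemma ip_act S d p g : sqint g -> supp S g -> 2 * S < d ->
  ip (act d p g) (act d p g) = n2 p * ip g g.
Proof.
move=> hg hS hd.
have ht (i : nat) : sqint (p`_i *: tr (i%:R * d) g).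
  by apply: sqintZ; exact: sqint_tr.
have ha := sqint_act d p hg.
have hi (i : nat) : sqint (tr (i%:R * d) g) by exact: sqint_tr.
rewrite {1}/act ip_suml // /n2 mulr_suml; apply: eq_bigr => i _.
rewrite /act ip_sumr // (bigD1 i) //= big1 ?addr0.
  by rewrite ipZl // ipZr // ip_tr //; ring.
move=> j ji; rewrite ipZl // ipZr // (ip_tr_disj hS) ?mulr0 // -mulrBl normrM.
have [d0|d0] := leP 0 d; last first.
  have : 0 <= `|i%:R - j%:R| * `|d| by [].
  by rewrite [`|d|]ltr0_norm //; nra.
rewrite [`|d|]ger0_norm //.
have : 1 <= `|i%:R - j%:R : R|.
  rewrite distrC; have [ij|ij|/val_inj ij] := ltngtP i j.
  - by rewrite ger0_norm -natrB ?ler1n ?subn_gt0 // ltnW.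
  - by rewrite distrC ger0_norm -natrB ?ler1n ?subn_gt0 // ltnW.
  - by rewrite ij eqxx in ji.
nra.
Qed.

Lemma nm_act S d p g (b : R) : sqint g -> supp S g -> 2 * S < d -> 0 <= b ->
  n2 p <= b ^+ 2 -> nm (act d p g) <= b * nm g.
Proof.
move=> hg hS hd b0 hb; rewrite nm_leP ?mulr_ge0 ?nm_ge0 //.
by rewrite (ip_act _ hg hS hd) exprMn nm_sqr ler_wpM2r // ip_ge0.
Qed.

Lemma act_avgX d D u : act d (avgX D) u = 2^-1 *: (tr (D%:R * d) u + u).
Proof.
rewrite /avgX /avg comp_polyZ comp_polyD comp_polyX (_ : 1 \Po _ = 1); last first.
  by rewrite -[1]/(1%:P) comp_polyC.
by rewrite actZ actD actXn act1.
Qed.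

Lemma nm_act_avgX d D n u : sqint u -> nm (act d (avgX D ^+ n) u) <= nm u.
Proof.
elim: n u => [|n IH] u hu; first by rewrite expr0 act1.
rewrite exprSr actM; apply: le_trans (IH _ (sqint_act _ _ hu)) _.
have h1 := sqint_tr (D%:R * d) hu.
rewrite act_avgX nmZ; last exact: sqintD.
have := nmD h1 hu; rewrite nm_tr // ger0_norm ?invr_ge0 //; lra.
Qed.

(** For a unitary translation T the adjoint of (T + 1) / 2 is T^-1 (T + 1) / 2; the translation of
    the second argument absorbs T^-n. *)
Lemma ip_act_avgX d D n u v : sqint u -> sqint v ->
  ip (act d (avgX D ^+ n) u) (tr ((D * n)%N%:R * d) v) = ip u (act d (avgX D ^+ n) v).
Proof.
elim: n u v => [|n IH] u v hu hv; first by rewrite expr0 !act1 muln0 mul0r tr0.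
have hA w : sqint w -> sqint (act d (avgX D ^+ n) w) by move=> hw; exact: sqint_act.
rewrite {1}exprSr actM.
have -> : tr ((D * n.+1)%N%:R * d) v = tr ((D * n)%N%:R * d) (tr (D%:R * d) v).
  by rewrite tr_tr mulnS natrD mulrDl addrC.
rewrite IH ?act_tr; [|exact: sqint_act|exact: sqint_tr].
rewrite [in RHS]exprS actM !act_avgX.
move: (hA _ hv); set w := act _ _ v => hw.
have h1 := sqint_tr (D%:R * d) hu; have h2 := sqint_tr (D%:R * d) hw.
rewrite ipZl ?ipZr //; try exact: sqintD.
by rewrite ipDl ?ipDr // ip_tr // addrC.
Qed.

(** With A the action of [avgX D ^+ n], the squared norm is |u|^2 - 2 |A u|^2 + |A A u|^2 by
    [ip_act_avgX], and A is a contraction. Nothing is assumed on the support of u, which in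
    [bess_pfac] is a combination of arbitrary translates. *)
Lemma nm_act_fac d D n u : sqint u -> nm (act d (fac D n) u) <= nm u.
Proof.
move=> hu; rewrite nm_leP ?nm_ge0 // nm_sqr /fac actB actXn -addnn exprD actM.
have h1 := sqint_act d (avgX D ^+ n) hu; have h2 := sqint_act d (avgX D ^+ n) h1.
have h3 := sqint_tr ((D * n)%N%:R * d) hu.
have hc : nm (act d (avgX D ^+ n) (act d (avgX D ^+ n) u)) <= nm (act d (avgX D ^+ n) u).
  exact: nm_act_avgX.
rewrite -scaleN1r ipDl ?ipDr ?ipZl ?ipZr //; try exact: sqintZ; try by apply: sqintD => //; exact: sqintZ.
rewrite ip_tr // -[ip (act _ _ (act _ _ u)) (tr _ _)]ipC ?[ip (tr _ _) (act _ _ _)]ipC.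
rewrite ip_act_avgX //.
rewrite nm_leP ?nm_ge0 // nm_sqr in hc.
have := ip_ge0 (act d (avgX D ^+ n) u); lra.
Qed.

Lemma nm_act_pfac d fs u : sqint u -> nm (act d (pfac fs) u) <= nm u.
Proof.
move=> hu; rewrite /pfac; elim: fs => [|f fs IH]; first by rewrite big_nil act1.
rewrite big_cons actM; apply: le_trans IH; apply: nm_act_fac; exact: sqint_act.
Qed.
End Act.

(** * Spans of translates and Bessel bounds *)

Section Generation.
Context {R : realType}.
Implicit Types (f g u v : R -> R) (d x S : R).

Definition comb (s : seq (R * R)) v : R -> R :=
  \sum_(p <- s) p.1 *: tr p.2 v.

Definition inspan v f := exists s, f = comb s v.

Lemma sqint_comb s v : sqint v -> sqint (comb s v).
Proof. by move=> hv; apply: sqint_sum => i _; apply: sqintZ; exact: sqint_tr. Qed.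

Lemma inspan_refl v : inspan v v.
Proof. by exists [:: (1, 0)]; rewrite /comb big_seq1 scale1r tr0. Qed.

Lemma inspanD v f g : inspan v f -> inspan v g -> inspan v (f + g).
Proof. by move=> [s ->] [t ->]; exists (s ++ t); rewrite /comb big_cat. Qed.

Lemma inspanZ a v f : inspan v f -> inspan v (a *: f).
Proof.
move=> [s ->]; exists [seq (a * p.1, p.2) | p <- s].
by rewrite /comb big_map scaler_sumr; apply: eq_bigr => p _; rewrite scalerA.
Qed.

Lemma inspan_tr x v f : inspan v f -> inspan v (tr x f).
Proof.
move=> [s ->]; exists [seq (p.1, x + p.2) | p <- s].
by rewrite /comb big_map tr_sum; apply: eq_bigr => p _; rewrite trZ tr_tr.
Qed.

Lemma inspan0 v : inspan v 0.
Proof. by exists [::]; rewrite /comb big_nil. Qed.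

Lemma inspan_sum v (I : Type) (s : seq I) (P : pred I) (F : I -> R -> R) :
  (forall i, P i -> inspan v (F i)) -> inspan v (\sum_(i <- s | P i) F i).
Proof. by move=> h; apply: big_ind => //; [exact: inspan0|exact: inspanD]. Qed.

Lemma inspan_trans v w f : inspan w f -> inspan v w -> inspan v f.
Proof.
move=> [s ->] hw; apply: inspan_sum => p _; apply: inspanZ; exact: inspan_tr.
Qed.

Lemma inspan_act d (p : {poly R}) v : inspan v (act d p v).
Proof.
apply: inspan_sum => i _; apply: inspanZ; apply: inspan_tr; exact: inspan_refl.
Qed.

Lemma comb_nm s v : sqint v -> nm (comb s v) <= (\sum_(p <- s) `|p.1|) * nm v.
Proof.
move=> hv; apply: le_trans (nm_sum _ _) _.
  by move=> p _; apply: sqintZ; exact: sqint_tr.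
rewrite mulr_suml; apply: ler_sum => p _.
by rewrite nmZ ?nm_tr //; exact: sqint_tr.
Qed.

Lemma combB s u v : comb s u - comb s v = comb s (u - v).
Proof.
rewrite /comb -sumrB; apply: eq_bigr => p _.
by rewrite trB scalerBr.
Qed.

Definition gen g0 v := forall eta : R, 0 < eta ->
  exists f, inspan v f /\ nm (g0 - f) < eta.

Lemma gen_refl v : gen v v.
Proof.
by move=> e e0; exists v; split; [exact: inspan_refl|rewrite subrr nm0].
Qed.

Lemma gen_trans g0 v w : sqint g0 -> sqint v -> sqint w ->
  gen g0 v -> gen v w -> gen g0 w.
Proof.
move=> h0 hv hw H1 H2 e e0; have e2 : 0 < e / 2 by rewrite divr_gt0.
have [_ [[s ->] hs]] := H1 _ e2.
pose M := \sum_(p <- s) `|p.1| + 1.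
have M1 : 0 <= \sum_(p <- s) `|p.1| by apply: sumr_ge0.
have M0 : 0 < M by rewrite /M; lra.
have [f [hf hfe]] := H2 _ (divr_gt0 e2 M0).
exists (comb s f); split.
  by apply: inspan_trans hf; exists s.
have hfs : sqint f by case: hf => t ->; exact: sqint_comb.
have h1 := sqint_comb s hv; have h2 := sqint_comb s hfs.
apply: le_lt_trans (nm_tri h0 h2 h1) _.
rewrite combB; have := comb_nm s (sqintB hv hfs).
have : (\sum_(p <- s) `|p.1|) * nm (v - f) <= M * (e / 2 / M).
  by apply: ler_pM => //; [exact: nm_ge0|rewrite /M lerDl|exact: ltW].
rewrite mulrCA divff ?gt_eqF // mulr1; lra.
Qed.

Lemma gen_scale_tr v a x : sqint v -> a != 0 -> gen v (a *: tr x v).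
Proof.
move=> hv a0 e e0; exists v; split; last by rewrite subrr nm0.
exists [:: (a^-1, - x)]; rewrite /comb big_seq1 /= trZ tr_tr addNr tr0.
by rewrite scalerA mulVf // scale1r.
Qed.

(** [fac D n] divides 'X^(D n k) - [avgX D] ^+ (2 n k), as a - b divides a^k - b^k. So a translate
    of v lies in the span of the new function up to an error that tends to 0 with the powers of the
    average. *)
Lemma gen_fac d D n v : sqint v ->
  (forall eta : R, 0 < eta -> exists k, nm (act d (avgX D ^+ (n.*2 * k)) v) < eta) ->
  gen v (act d (fac D n) v).
Proof.
move=> hv H e e0; have [k hk] := H e e0.
have hX : 'X^(D * n * k) - avgX D ^+ (n.*2 * k) = (\sum_(i < k) 'X^(D * n) ^+ (k.-1 - i) * (avgX D ^+ n.*2) ^+ i) * fac D n :> {poly R}.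
  by rewrite mulrC -subrXX -!exprM.
move: hX; set Sg := \sum_(i < k) _ => hX.
exists (tr (- ((D * n * k)%N%:R * d)) (act d (Sg * fac D n) v)); split.
  by apply: inspan_tr; rewrite actM; exact: inspan_act.
rewrite -hX actB actXn trB tr_tr addNr tr0 opprB addrC subrK nm_tr //.
exact: sqint_act.
Qed.

Lemma cb_small (n : nat) (eta : R) : (0 < n)%N -> 0 < eta ->
  exists k, cb (n.*2 * k) <= eta ^+ 2.
Proof.
move=> n0 e0; have [k [k0 hk]] := natr_ceil (eta ^- 4).
exists k; have := @cb_ub R (n.*2 * k); set c := cb _ => h.
have c0 : 0 < c by exact: cb_gt0.
have hk2 : k%:R <= 2 * (n.*2 * k)%N%:R + 1 :> R.
  have : k%:R <= (n.*2 * k)%N%:R :> R.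
    by rewrite ler_nat leq_pmull // double_gt0.
  have : 0 <= k%:R :> R by []. lra.
have h1 : eta ^- 4 * c ^+ 2 <= 1.
  apply: le_trans h; rewrite ler_wpM2r ?sqr_ge0 //; exact: le_trans hk hk2.
have e4 : 0 < eta ^+ 4 by rewrite exprn_gt0.
rewrite mulrC ler_pdivrMr // mul1r in h1.
rewrite -(@ler_pXn2r _ 2) ?nnegrE ?sqr_ge0 ?(ltW c0) //.
by rewrite -exprM.
Qed.

Lemma gen_pfac S d (fs : seq (nat * nat)) g : sqint g -> supp S g ->
  (forall p, p \in fs -> (0 < p.1)%N /\ (0 < p.2)%N) -> 2 * S < d -> 0 < d ->
  gen g (act d (pfac fs) g).
Proof.
move=> hg hS; rewrite /pfac.
elim: fs => [|[D n] fs IH] hfs hd d0; first by rewrite big_nil act1; exact: gen_refl.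
have [/= D0 n0] := hfs _ (mem_head _ _).
rewrite big_cons actM /=; set C := \prod_(_ <- _) _.
have hC : sqint (act d C g) by exact: sqint_act.
apply: (gen_trans hg hC); first exact: sqint_act.
  by apply: IH => // p ff; apply: hfs; rewrite inE ff orbT.
apply: gen_fac => // eta eta0.
pose b := eta / (2 * (nm g + 1)).
have g0 := nm_ge0 g; have g1 : 0 < 2 * (nm g + 1) by lra.
have b0 : 0 < b by rewrite divr_gt0.
have [k hk] := cb_small n0 b0; exists k.
rewrite -actM mulrC actM.
have hX : 'X * 'X = 'X^2 :> {poly R} by rewrite expr2.
apply: le_lt_trans (nm_act_pfac d fs (sqint_act _ _ hg)) _.
have KDX : n2 (avgX D ^+ (n.*2 * k)) <= b ^+ 2 by rewrite n2_avgX.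
apply: le_lt_trans (nm_act hg hS hd (ltW b0) KDX) _.
rewrite /b mulrAC ltr_pdivrMr //; nra.
Qed.

(** The dual form of the Bessel inequality, for all 1-separated shifts: the sequence Lambda is not
    yet known while the generator is being modified. *)
Definition bess (C : R) v := forall (N : nat) (c x : nat -> R),
  (forall i j, (i < N)%N -> (j < N)%N -> i != j -> 1 <= `|x i - x j|) ->
  nm (\sum_(n < N) c n *: tr (x n) v) <= C * Num.sqrt (\sum_(n < N) c n ^+ 2).

Lemma bess_pfac C v d fs a y : sqint v -> bess C v ->
  bess (`|a| * C) (a *: tr y (act d (pfac fs) v)).
Proof.
move=> hv hb N c x hx.
have -> : \sum_(n < N) c n *: tr (x n) (a *: tr y (act d (pfac fs) v)) =
   a *: tr y (act d (pfac fs) (\sum_(n < N) c n *: tr (x n) v)).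
  rewrite act_sumr tr_sum scaler_sumr; apply: eq_bigr => n _.
  by rewrite actZr act_tr !trZ !tr_tr !scalerA mulrC [y + _]addrC.
have hs : sqint (\sum_(n < N) c n *: tr (x n) v).
  by apply: sqint_sum => n _; apply: sqintZ; exact: sqint_tr.
rewrite nmZ; last by apply: sqint_tr; exact: sqint_act.
rewrite nm_tr; last exact: sqint_act.
rewrite -mulrA ler_wpM2l //; apply: le_trans (hb N c x hx).
exact: nm_act_pfac.
Qed.
End Generation.

(** * One block of translates *)

Section Stage.
Context {R : realType}.
Implicit Types (f g u v : R -> R) (d x S : R).

Lemma n2_mono (p r : {poly R}) : (forall i, p`_i ^+ 2 <= r`_i ^+ 2) -> n2 p <= n2 r.
Proof.
move=> h; rewrite (@n2_widen _ p (maxn (size p) (size r))) ?leq_maxl //.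
rewrite (@n2_widen _ r (maxn (size p) (size r))) ?leq_maxr //.
by apply: ler_sum => i _.
Qed.

Lemma small_tolerance (C Sa ng q eta tau : R) : C < 2 -> 0 <= Sa -> 0 <= ng ->
  0 < eta -> 0 < tau ->
  exists th, [/\ 0 < th <= 1 / 2, 2 * th < 2 - C, Sa * (th * ng) <= eta / 2,
    2 * th * ng <= tau & (2 * Sa) `^ q * th ^+ 2 <= eta].
Proof.
move=> C2 Sa0 ng0 eta0 tau0; have p0 := powR_ge0 (2 * Sa) q.
have Sg0 : 0 <= Sa * ng by rewrite mulr_ge0.
pose b1 : R := 1 / 2.
pose b5 := (2 - C) / 4.
pose b2 := eta / (2 * (Sa * ng + 1)).
pose b3 := tau / (2 * ng + 1).
pose b4 := eta / ((2 * Sa) `^ q + 1).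
have b10 : 0 < b1 by rewrite divr_gt0.
have b50 : 0 < b5 by rewrite divr_gt0 //; lra.
have b20 : 0 < b2 by rewrite divr_gt0 //; lra.
have b30 : 0 < b3 by rewrite divr_gt0 //; lra.
have b40 : 0 < b4 by rewrite divr_gt0 //; lra.
exists (Num.min (Num.min b1 b2) (Num.min b3 (Num.min b4 b5))); set th := Num.min _ _.
have th0 : 0 < th by rewrite !lt_min b10 b20 b30 b40 b50.
have th2 : th <= b2 by rewrite !ge_min lexx !orbT.
have th3 : th <= b3 by rewrite !ge_min lexx !orbT.
have th4 : th <= b4 by rewrite !ge_min lexx !orbT.
have th1 : th <= 1 / 2 by rewrite !ge_min lexx.
have th1' : th <= (2 - C) / 4 by rewrite !ge_min lexx !orbT.
rewrite ler_pdivlMr in th2; last lra.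
rewrite ler_pdivlMr in th3; last lra.
rewrite ler_pdivlMr in th4; last lra.
clearbody th; clear b1 b2 b3 b4 b5 b10 b20 b30 b40 b50.
rewrite th0 th1; split => //.
- lra.
- rewrite mulrCA; lra.
- rewrite -mulrA mulrCA; lra.
- apply: le_trans (_ : (2 * Sa) `^ q * th <= _); last lra.
  by rewrite ler_wpM2l //; nra.
Qed.

Lemma shift_far (S W d t : R) (k i : nat) : S + W < d -> 0 < d -> `|t| <= W -> k != i ->
  S < `|t + k%:R * d - i%:R * d|.
Proof.
move=> hd d0 ht ki.
have h1 : `|k%:R * d - i%:R * d| <= `|t + k%:R * d - i%:R * d| + `|t|.
  rewrite -[X in _ <= _ + X]normrN; apply: le_trans (ler_normD _ _).
  by rewrite [leRHS](_ : _ = `|k%:R * d - i%:R * d|) //; congr `|_|; ring.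
have h2 : 1 * d <= `|k%:R * d - i%:R * d|.
  rewrite -mulrBl normrM (gtr0_norm d0) ler_pM2r //.
  have [ij|ij|ij] := ltngtP k i; last by rewrite ij eqxx in ki.
  - by rewrite distrC ger0_norm -natrB ?ler1n ?subn_gt0 // ltnW.
  - by rewrite ger0_norm -natrB ?ler1n ?subn_gt0 // ltnW.
lra.
Qed.

Lemma shift_bounded (S d t : R) (k i M : nat) : 0 < d -> (i <= M)%N ->
  S + (M + k)%N%:R * d < `|t| -> S < `|t + k%:R * d - i%:R * d|.
Proof.
move=> d0 iM; rewrite natrD.
have hi : i%:R <= M%:R :> R by rewrite ler_nat.
have hb0 : 0 <= k%:R :> R by [].
have i0 : 0 <= i%:R :> R by [].
move: hi hb0 i0; set a := M%:R; set b := k%:R; set j := i%:R => hi hb0 i0 ht.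
have h1 : `|t| <= `|t + b * d - j * d| + `|j * d - b * d|.
  by apply: le_trans (ler_normD _ _); rewrite addrA addrNK addrK.
have h2 : `|j * d - b * d| <= (a + b) * d by rewrite ler_norml; apply/andP; split; nra.
lra.
Qed.

(** The increment is at least d - 2 Y >= d / 2, against a point of size at most about A d: d
    cancels, and the gain 1 / (4 (A + 1)) depends on A alone. *)
Lemma block_ratio (A a : nat) (d Y y y' : R) : (a.+1 < A)%N -> 0 <= Y ->
  4 * Y + 4 <= d -> `|y| <= Y -> `|y'| <= Y ->
  a.+1%:R * d + y + 1 <= a.+2%:R * d + y' /\
  (1 + (4 * (A%:R + 1))^-1) * (a.+1%:R * d + y) < a.+2%:R * d + y'.
Proof.
move=> aA Y0 hd; rewrite !ler_norml => /andP[h1 h2] /andP[h3 h4].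
rewrite -[a.+2%:R]natr1 mulrDl mul1r; split; first by lra.
have haA : a.+1%:R <= A%:R :> R by rewrite ler_nat ltnW.
have A0 : 0 <= A%:R :> R by [].
rewrite mulrDl mul1r.
have : (4 * (A%:R + 1))^-1 * (a.+1%:R * d + y) <= d / 4.
  rewrite mulrC ler_pdivrMr; last lra.
  have : a.+1%:R * d <= A%:R * d by rewrite ler_wpM2r //; lra.
  lra.
lra.
Qed.

(** The order of the quantifiers matters: [rho] and [A] come from phi alone and precede [X0], while
    d is chosen after [X0]. The caller can first add points until eps_n < rho and then ask for a
    block beyond them. *)
Lemma l2stage g0 g S C x0 q eta tau W :
  sqint g0 -> sqint g -> supp S g -> gen g0 g -> bess C g -> 0 < C < 2 ->
  2 < q -> 0 < eta -> 0 < tau ->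
  exists rho : R, exists A : nat, [/\ 0 < rho, (0 < A)%N &
  forall X0 : R, exists (g' : R -> R) (S' C' : R) (lam c : nat -> R),
   [/\ sqint g', supp S' g', gen g0 g', bess C' g' & 0 < C' < 2] /\
   [/\ nm (g' - g) <= tau /\ (forall t, `|t| <= W -> g' t = g t),
       X0 < lam 0%N,
       forall a, (a.+1 < A)%N ->
         lam a + 1 <= lam a.+1 /\ (1 + rho) * lam a < lam a.+1,
       nm (tr x0 g0 - \sum_(a < A) c a *: tr (lam a) g') <= eta &
       \sum_(a < A) `|c a| `^ q <= eta]].
Proof.
move=> h0 hg hS hgen hbess /andP[C0 C2] q2 eta0 tau0.
have eta2 : 0 < eta / 2 by rewrite divr_gt0.
have [_ [[s ->] hs]] := hgen _ eta2.
pose r := size s.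
pose a_ k := (nth (0, 0) s k).1; pose y_ k := x0 + (nth (0, 0) s k).2.
have combE v : tr x0 (comb s v) = \sum_(k < r) a_ k *: tr (y_ k) v.
  rewrite /comb tr_sum (big_nth (0, 0)) big_mkord; apply: eq_bigr => k _.
  by rewrite trZ tr_tr.
pose Sa := \sum_(k < r) `|a_ k|.
have Sa0 : 0 <= Sa by apply: sumr_ge0.
pose Y := \sum_(k < r) `|y_ k|.
have Y0 : 0 <= Y by apply: sumr_ge0.
have hY k : (k < r)%N -> `|y_ k| <= Y.
  move=> kr; rewrite /Y (bigD1 (Ordinal kr)) //= lerDl; exact: sumr_ge0.
have ha k : (k < r)%N -> `|a_ k| <= Sa.
  move=> kr; rewrite /Sa (bigD1 (Ordinal kr)) //= lerDl; exact: sumr_ge0.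
have ng := nm_ge0 g.
have [th [/andP[th0 thh] thC th2 th3 th4]] :=
  @small_tolerance C Sa (nm g) q eta tau C2 Sa0 ng eta0 tau0.
have [fs [phi [hfs [hphi0 hdisj] hb hphi hlq]]] :=
  @zstage R q (th ^+ 2) r q2 (exprn_gt0 2 th0).
(* The central coefficient of psi. Dividing by it makes g' equal to g exactly on [- W, W], where for
   large d only the central translate is seen; its being close to 1 keeps the Bessel constant below
   2. *)
pose beta := (pfac fs : {poly R})`_(psh fs).
have hbeta : `|beta - 1| <= th.
  rewrite -(@ler_pXn2r _ 2) ?nnegrE ?(ltW th0) // real_normK ?num_real //.
  apply: le_trans hb; apply: le_trans (n2_coef _ (psh fs)).
  by rewrite coefB coefXn eqxx.
have /andP[be1 be2] : 1 - th <= beta <= 1 + th.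
  by move: hbeta; rewrite ler_norml; clear; lra.
have beta0 : 0 < beta by clear -be1 thh; lra.
have beta_neq0 : beta != 0 by rewrite gt_eqF.
pose A := (\sum_(k < r) size (phi k)).+1.
have hA k : (k < r)%N -> (size (phi k) <= A.+1)%N.
  move=> kr; rewrite /A (bigD1 (Ordinal kr)) //=.
  by apply: leq_trans (leq_addr _ _) _; rewrite !leqW.
pose rho : R := (4 * (A%:R + 1))^-1.
exists rho, A; split => //.
  by rewrite invr_gt0 mulr_gt0 // ltr_wpDl.
move=> X0.
have [d [dS dW dY dX d0]] : exists d, [/\ 2 * S < d, S + W < d, 4 * Y + 4 <= d, X0 + Y < d & 0 < d].
  exists (2 * `|S| + `|S| + `|W| + 4 * Y + `|X0| + 4).
  have := ler_norm S; have := ler_norm W; have := ler_norm X0.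
  have := normr_ge0 S; have := normr_ge0 W; have := normr_ge0 X0.
  by clear -Y0 => *; split; lra.
have sqA := sqint_act d (pfac fs) hg.
pose g' := beta^-1 *: tr (- ((psh fs)%:R * d)) (act d (pfac fs) g).
have hg' : sqint g' by apply: sqintZ; exact: sqint_tr.
have gE M' t : (size (pfac fs : {poly R}) <= M')%N -> g' t =
    beta^-1 * \sum_(i < M') (pfac fs)`_i * g (t + (psh fs)%:R * d - i%:R * d).
  move=> hM; rewrite /g' (act_wide _ _ hM) tr_sum -[LHS]/(beta^-1 * _); congr (_ * _).
  rewrite fct_sumE; apply: eq_bigr => i _.
  by rewrite -[LHS]/(_ * _) /tr opprK.
(* At most one phi has the frequency k, which decides the shift; frequencies of no phi get shift 0
   and, in [c], coefficient 0. *)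
pose sx k := if [pick i : 'I_r | (phi i)`_k != 0] is Some i then y_ i else 0.
have sxE k i : (i < r)%N -> (phi i)`_k != 0 -> sx k = y_ i.
  move=> ir hik; rewrite /sx; case: pickP => [j hj|/(_ (Ordinal ir))]; last by rewrite hik.
  by rewrite (hdisj j i k).
have sxY k : `|sx k| <= Y.
  by rewrite /sx; case: pickP => [j _|_]; [exact: hY|rewrite normr0].
(* Indexing starts at frequency 1, as the constant terms vanish. The factor beta in [c] compensates
   the normalisation of g'. *)
pose lam (a : nat) := (a.+1)%:R * d + sx a.+1.
pose c (a : nat) := \sum_(k < r) a_ k * (beta * (phi k)`_a.+1).
exists g', (S + (size (pfac fs : {poly R}) + psh fs)%N%:R * d), (beta^-1 * C), lam, c.
split; split.
- by [].
- move=> t ht; rewrite (gE _ t (leqnn _)) big1 ?mulr0 // => i _.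
  by rewrite hS ?mulr0 //; apply: shift_bounded ht => //; exact: ltnW.
- apply: gen_trans (h0) (hg) _ hgen _ => //.
  apply: (gen_trans hg sqA hg').
    exact: gen_pfac hg hS hfs dS d0.
  exact: (gen_scale_tr _ sqA (invr_neq0 beta_neq0)).
- have := @bess_pfac R C g d fs beta^-1 (- ((psh fs)%:R * d)) hg hbess.
  by rewrite ger0_norm // invr_ge0 ltW.
- rewrite mulr_gt0 ?invr_gt0 //= mulrC ltr_pdivrMr //.
  by clear -be1 thC C0; lra.
- split.
    have -> : g' - g = tr (- ((psh fs)%:R * d)) (act d (beta^-1 *: pfac fs - 'X^(psh fs)) g).
      by rewrite actB actXn actZ trB tr_tr addNr tr0.
    rewrite nm_tr; last exact: sqint_act.
    have hn : n2 (beta^-1 *: pfac fs - 'X^(psh fs)) <= (2 * th) ^+ 2.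
      have bi : 0 < beta^-1 by rewrite invr_gt0.
      have bi2 : beta^-1 <= 2.
        by rewrite -(ler_pM2r beta0) mulVf //; clear -be1 thh; lra.
      (* Both polynomials agree off the central coefficient, which on the left is exactly zero. *)
      apply: le_trans (_ : n2 (beta^-1 *: (pfac fs - 'X^(psh fs))) <= _).
        apply: n2_mono => i; rewrite !coefB !coefZ coefB coefXn.
        have [->|ii] := eqVneq i (psh fs); last by rewrite !subr0.
        by rewrite -/beta mulVf // subrr expr0n sqr_ge0.
      rewrite n2Z [leRHS]exprMn; apply: ler_pM => //; rewrite ?sqr_ge0 ?n2_ge0 //.
      by rewrite lerXn2r ?nnegrE // ltW.
    have th20 : 0 <= 2 * th by rewrite mulr_ge0 // ltW.
    exact: le_trans (nm_act hg hS dS th20 hn) th3.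
  move=> t ht.
  rewrite (gE _ t (leq_maxl _ (psh fs).+1)).
  have hsh : (psh fs < maxn (size (pfac fs : {poly R})) (psh fs).+1)%N by rewrite leq_maxr.
  rewrite (bigD1 (Ordinal hsh)) //= addrK big1 ?addr0 ?mulKf // => i hi.
  rewrite hS ?mulr0 //; apply: shift_far dW d0 ht _.
  by apply: contra hi => /eqP e; apply/eqP/val_inj.
- rewrite /lam mul1r; have := sxY 1%N; rewrite ler_norml => /andP[h1 _].
  by clear -h1 dX; lra.
- by move=> a aA; exact: block_ratio aA Y0 dY (sxY _) (sxY _).
- have hsq k : sqint (tr (y_ k) g) by exact: sqint_tr.
  have step1 : \sum_(a < A) c a *: tr (lam a) g' =
     \sum_(k < r) a_ k *: tr (y_ k) (tr (- ((psh fs)%:R * d)) (act d (phi k * pfac fs) g)).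
    transitivity (\sum_(a < A) \sum_(k < r) a_ k *: ((beta * (phi k)`_a.+1) *:
        tr (y_ k) (tr (a.+1%:R * d) g'))).
      apply: eq_bigr => a _; rewrite /c scaler_suml; apply: eq_bigr => k _.
      rewrite -scalerA; congr (_ *: _).
      have [->|hk] := eqVneq (phi k)`_a.+1 0; first by rewrite mulr0 !scale0r.
      by rewrite /lam (sxE _ _ (ltn_ord k) hk) tr_tr addrC.
    rewrite exchange_big; apply: eq_bigr => k _ /=.
    rewrite -scaler_sumr; congr (_ *: _).
    rewrite actM.
    have -> : tr (- ((psh fs)%:R * d)) (act d (phi k) (act d (pfac fs) g)) =
       beta *: act d (phi k) g'.
      by rewrite /g' actZr act_tr scalerA divff // scale1r.
    rewrite (act_wide _ _ (hA k (ltn_ord k))) [in RHS]big_ord_recl.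
    rewrite (hphi0 k (ltn_ord k) : (phi k)`_(@ord0 A) = 0) scale0r add0r.
    rewrite trZ tr_sum scaler_sumr; apply: eq_bigr => a _.
    by rewrite -scalerA; congr (_ *: _).
  rewrite step1.
  have hcomb : sqint (comb s g) by exact: sqint_comb.
  have h1 : sqint (tr x0 g0) by exact: sqint_tr.
  have h2 : sqint (tr x0 (comb s g)) by exact: sqint_tr.
  have sqP k : sqint (act d (phi k * pfac fs) g) by exact: sqint_act.
  have h3 : sqint (\sum_(k < r) a_ k *: tr (y_ k) (tr (- ((psh fs)%:R * d)) (act d (phi k * pfac fs) g))).
    by apply: sqint_sum => k _; apply: sqintZ; do 2 apply: sqint_tr.
  apply: le_trans (nm_tri h1 h3 h2) _.
  rewrite -trB nm_tr; last exact: sqintB.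
  have -> : tr x0 (comb s g) - \sum_(k < r) a_ k *: tr (y_ k) (tr (- ((psh fs)%:R * d)) (act d (phi k * pfac fs) g)) =
    - \sum_(k < r) a_ k *: tr (y_ k) (tr (- ((psh fs)%:R * d)) (act d (phi k * pfac fs - 'X^(psh fs)) g)).
    rewrite combE -sumrB -sumrN; apply: eq_bigr => k _.
    have -> : tr (- ((psh fs)%:R * d)) (act d (phi k * pfac fs - 'X^(psh fs)) g) =
        tr (- ((psh fs)%:R * d)) (act d (phi k * pfac fs) g) - g.
      by rewrite actB actXn trB (tr_tr _ _ g) addNr tr0.
    by rewrite trB scalerBr opprB.
  have sq4 k : sqint (act d (phi k * pfac fs - 'X^(psh fs)) g) by exact: sqint_act.
  rewrite nmN; last by apply: sqint_sum => k _; apply: sqintZ; do 2 apply: sqint_tr.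
  have : nm (\sum_(k < r) a_ k *: tr (y_ k) (tr (- ((psh fs)%:R * d)) (act d (phi k * pfac fs - 'X^(psh fs)) g))) <= Sa * (th * nm g).
    apply: le_trans (nm_sum _ _) _.
      by move=> k _; apply: sqintZ; do 2 apply: sqint_tr.
    rewrite /Sa mulr_suml; apply: ler_sum => k _.
    rewrite nmZ; last by do 2 apply: sqint_tr.
    rewrite nm_tr; last exact: sqint_tr.
    rewrite nm_tr //; apply: ler_wpM2l => //.
    by apply: nm_act hg hS dS (ltW th0) _; exact: hphi.
  by move: th2 (ltW hs); clear; lra.
- have q_gt0 : 0 < q by apply: lt_trans q2.
  have q0 : q != 0 by rewrite gt_eqF.
  have hc a : `|c a| `^ q <= \sum_(k < r) (2 * Sa) `^ q * `|(phi k)`_a.+1| `^ q.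
    apply: le_trans (powR_sum_single q0 _) _.
      move=> k k'; rewrite !mulf_eq0 !negb_or => /and3P[_ _ h1] /and3P[_ _ h2].
      by apply: val_inj; exact: hdisj h1 h2.
    apply: ler_sum => k _; rewrite mulrA normrM powRM // ler_wpM2r ?powR_ge0 //.
    apply: ge0_ler_powR; rewrite ?nnegrE ?mulr_ge0 ?(ltW q_gt0) //.
    rewrite normrM (gtr0_norm beta0) mulrC; apply: ler_pM => //.
    - exact: ltW.
    - by clear -be2 thh; lra.
    - exact: ha.
  apply: le_trans (_ : \sum_(a < A) \sum_(k < r) (2 * Sa) `^ q * `|(phi k)`_a.+1| `^ q <= _).
    by apply: ler_sum => a _; exact: hc.
  rewrite exchange_big /=.
  under eq_bigr do rewrite -mulr_sumr.
  rewrite -mulr_sumr.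
  have hle : \sum_(k < r) \sum_(a < A) `|(phi k)`_a.+1| `^ q <= th ^+ 2.
    apply: le_trans (hlq A.+1); apply: ler_sum => k _.
    by rewrite [leRHS]big_ord_recl lerDr powR_ge0.
  by apply: le_trans th4; rewrite ler_wpM2l // powR_ge0.
Qed.
End Stage.

(** * Indicator functions and Fatou's lemma *)

Section Box.
Context {R : realType}.
Notation mu := (@lebesgue_measure R).
Notation TR := (measurableTypeR R).
Implicit Types (f g u v : R -> R) (h x : R).

Definition box h : R -> R := \1_(`[0, h[%classic : set R).

Lemma boxE h t : box h t = (0 <= t < h)%R%:R.
Proof.
rewrite /box indicE; congr (_%:R); congr nat_of_bool.
by apply/idP/idP; rewrite inE /= in_itv.
Qed.

Lemma integral_box_sqr h : 0 <= h ->
  (\int[mu]_t (box h t ^+ 2)%:E = h%:E)%E.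
Proof.
move=> h0.
have -> : (\int[mu]_t (box h t ^+ 2)%:E = \int[mu]_t (box h t)%:E)%E.
  apply: eq_integral => t _; congr EFin; rewrite boxE.
  by case: (_ && _); rewrite ?expr1n ?expr0n.
have hm : mu (`[0, h[%classic : set R) = h%:E.
  rewrite lebesgue_measure_itv /= lte_fin.
  by case: ltgtP h0 => // [h0|<-] _; rewrite ?sube0.
by rewrite /box integral_indic // setIT.
Qed.

Lemma sqint_box h : 0 <= h -> sqint (box h).
Proof.
move=> h0.
have mb : measurable_fun setT (box h : TR -> R) by exact: measurable_indic.
split => //; apply/integrableP; split.
  by apply/measurable_EFinP; apply: measurable_funX.
have -> : (\int[mu]_t `|(box h t ^+ 2)%:E| = \int[mu]_t (box h t ^+ 2)%:E)%E.
  by apply: eq_integral => t _; rewrite gee0_abs // lee_fin sqr_ge0.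
by rewrite integral_box_sqr // ltry.
Qed.

Lemma ip_box h : 0 <= h -> ip (box h) (box h) = h.
Proof.
move=> h0; rewrite /ip /Rintegral.
have -> : (\int[mu]_t (box h t * box h t)%:E = \int[mu]_t (box h t ^+ 2)%:E)%E.
  by apply: eq_integral => t _; rewrite expr2.
by rewrite integral_box_sqr.
Qed.

Lemma ip_box_disj h x y : h <= `|x - y| -> ip (tr x (box h)) (tr y (box h)) = 0.
Proof.
move=> hxy; apply: ip_disj => t; rewrite /tr !boxE.
case: andP => [[h1 h2]|_]; last by left.
case: andP => [[h3 h4]|_]; last by right.
by exfalso; move: hxy; case: ler0P => _; lra.
Qed.

Lemma sqint_ip f : sqint f -> (\int[mu]_t ((f t) ^+ 2)%:E = (ip f f)%:E)%E.
Proof.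
move=> [mf If]; rewrite /ip /Rintegral fineK.
  by apply: eq_integral => t _; rewrite expr2.
exact: (integrable_fin_num measurableT If).
Qed.

(** Stands in for completeness of L^2: the generators are frozen on growing intervals, so at each
    point the sequence is eventually constant and Fatou applies. *)
Lemma fatou_nm (u_ : nat -> R -> R) u (b : R) : 0 <= b ->
  (forall j, sqint (u_ j)) -> (forall j, nm (u_ j) <= b) ->
  (forall t, exists J, forall j, (J <= j)%N -> u_ j t = u t) ->
  sqint u /\ nm u <= b.
Proof.
move=> b0 hu hb hcv.
have mu_ j : measurable_fun setT (u_ j : TR -> R) by case: (hu j).
have cv t : u_ j t @[j --> \oo] --> u t.
  have [J hJ] := hcv t; apply: cvg_near_cst.
  by near=> j; apply: hJ; near: j; exists J.
have mu' : measurable_fun setT (u : TR -> R).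
  by apply: (@measurable_fun_cvg _ _ _ setT u_ u) => // t _; exact: cv.
have hF : (\int[mu]_t ((u t) ^+ 2)%:E <= (b ^+ 2)%:E)%E.
  have mf j : measurable_fun setT (fun t : TR => ((u_ j t) ^+ 2)%:E).
    by apply/measurable_EFinP; apply: measurable_funX.
  have f0 j (t : TR) : setT t -> (0 <= ((u_ j t) ^+ 2)%:E)%E.
    by move=> _; rewrite lee_fin sqr_ge0.
  have := fatou mu measurableT mf f0.
  have -> : (\int[mu]_t limn_einf (fun j => ((u_ j t) ^+ 2)%:E) =
     \int[mu]_t ((u t) ^+ 2)%:E)%E.
    apply: eq_integral => t _.
    have c2 : ((u_ j t) ^+ 2)%:E @[j --> \oo] --> ((u t) ^+ 2)%:E.
      have [J hJ] := hcv t; apply: cvg_near_cst.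
      by near=> j; rewrite hJ //; near: j; exists J.
    by rewrite is_cvg_limn_einfE; [apply/cvg_lim|apply/cvg_ex; eexists; exact: c2].
  move=> h; apply: le_trans h _.
  rewrite limn_einf_lim; apply: lime_le; first exact: is_cvg_einfs.
  near=> j; apply: le_trans (_ : (\int[mu]_t ((u_ j t) ^+ 2)%:E <= _)%E).
    by apply: ereal_inf_lbound => /=; exists j => //=.
  by rewrite sqint_ip // lee_fin -nm_leP.
have su : sqint u.
  split => //; apply/integrableP; split.
    by apply/measurable_EFinP; apply: measurable_funX.
  have -> : (\int[mu]_t `|(u t ^+ 2)%:E| = \int[mu]_t (u t ^+ 2)%:E)%E.
    by apply: eq_integral => t _; rewrite gee0_abs // lee_fin sqr_ge0.
  by apply: le_lt_trans hF _; rewrite ltry.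
split=> //; rewrite nm_leP // -lee_fin -sqint_ip //.
Unshelve. all: by end_near.
Qed.
End Box.

(** * Iteration *)

Section Recursion.
Context {R : realType}.
Implicit Types (f g u v : R -> R) (x : R) (L : seq R).

Lemma bess_box (h : R) : 0 <= h <= 1 -> bess 1 (@box R h).
Proof.
move=> /andP[h0 h1] N c x hx; have hb := sqint_box h0.
have ht y : sqint (tr y (@box R h)) by exact: sqint_tr.
have hZ n : sqint (c n *: tr (x n) (@box R h)) by exact: sqintZ.
rewrite mul1r /nm ler_sqrt; last by apply: sumr_ge0 => n _; exact: sqr_ge0.
rewrite ip_suml //; last exact: sqint_sum.
apply: ler_sum => n _; rewrite ip_sumr // (bigD1 n) //= big1 ?addr0.
  by rewrite ipZl // ipZr // ip_tr // ip_box // mulrA -expr2 ler_piMr // sqr_ge0.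
move=> j jn; rewrite ipZl // ipZr // ip_box_disj ?mulr0 //.
by apply: le_trans h1 _; apply: hx => //; rewrite eq_sym.
Qed.

Lemma supp_box (h : R) : 0 <= h -> supp h (@box R h).
Proof.
move=> h0 t; rewrite boxE; case: andP => // -[t0 th].
by rewrite ger0_norm // ltNge (ltW th).
Qed.

Variable eps : nat -> R.
Hypothesis eps_gt0 : forall n, 0 < eps n.
Hypothesis eps_cvg0 : eps n @[n --> \oo] --> (0 : R).

Lemma eps_small (rho : R) : 0 < rho -> exists F, forall n, (F <= n)%N -> eps n < rho.
Proof.
move=> r0; have /cvgrPdist_lt /(_ rho r0) [F _ hF] := eps_cvg0.
exists F => n Fn; have := hF n Fn; rewrite /= sub0r normrN gtr0_norm //.
Qed.

Lemma eps_bound : exists E : R, 0 < E /\ forall n, eps n < E.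
Proof.
have [F hF] := eps_small (@ltr01 R).
exists (1 + \sum_(i < F) eps i).
have h k : 0 <= \sum_(i < k) eps i by apply: sumr_ge0 => i _; exact: ltW.
split; first by rewrite ltr_pwDl.
move=> n; have [nF|nF] := ltnP n F; last first.
  by apply: lt_le_trans (hF n nF) _; rewrite lerDl.
rewrite (bigD1 (Ordinal nF)) //= addrCA; apply: ltr_pwDr => //.
rewrite ltr_pwDl //; apply: sumr_ge0 => i _; exact: ltW.
Qed.

Definition vlist L : Prop :=
  [/\ (0 < size L)%N, 0 < nth 0 L 0 &
   forall n, (n.+1 < size L)%N -> nth 0 L n + 1 <= nth 0 L n.+1 /\
     (1 + eps n) * nth 0 L n < nth 0 L n.+1].

Lemma vlist_pos L n : vlist L -> (n < size L)%N -> 0 < nth 0 L n.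
Proof.
move=> [h0 h1 h2]; elim: n => [//|n IH] hn.
have [h3 _] := h2 n hn; have := IH (ltnW hn); lra.
Qed.

Lemma vlist_last L : vlist L -> 0 < last 0 L.
Proof.
move=> hL; have [s0 _ _] := hL; rewrite -nth_last; apply: vlist_pos => //.
by rewrite prednK.
Qed.

Lemma vlist_cat L (A : nat) (lam : nat -> R) : vlist L -> (0 < A)%N ->
  last 0 L + 1 <= lam 0%N -> (1 + eps (size L).-1) * last 0 L < lam 0%N ->
  (forall a, (a.+1 < A)%N -> lam a + 1 <= lam a.+1 /\
     (1 + eps (size L + a)%N) * lam a < lam a.+1) ->
  vlist (L ++ mkseq lam A).
Proof.
move=> [s0 l0 hL] A0 hl1 hl2 hlam; split.
- by rewrite size_cat addn_gt0 s0.
- by rewrite nth_cat s0.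
move=> n; rewrite size_cat size_mkseq => hn; rewrite !nth_cat.
have [h1|h1] := ltnP n.+1 (size L); first by rewrite (ltnW h1); exact: hL.
have [h2|h2] := ltnP n (size L).
  have e : size L = n.+1 by apply/eqP; rewrite eqn_leq h1 h2.
  rewrite e subnn nth_mkseq //.
  have -> : nth 0 L n = last 0 L by rewrite (last_nth 0) e; case: (L) e.
  by move: hl2; rewrite e.
have h3 : ((n - size L).+1 < A)%N by rewrite -subSn // ltn_subLR.
rewrite subSn // !nth_mkseq //; last exact: ltnW.
by have := hlam _ h3; rewrite subnKC.
Qed.

Lemma vlist_extend L F : vlist L ->
  exists B, vlist (L ++ B) /\ (F <= size (L ++ B))%N.
Proof.
move=> hL; elim: F => [|F [B [hB hF]]]; first by exists [::]; rewrite cats0.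
have [E [E0 hE]] := eps_bound.
pose y := last 0 (L ++ B).
have y0 : 0 < y by exact: vlist_last.
exists (B ++ mkseq (fun _ => (1 + E) * y + 1) 1); rewrite catA; split; last first.
  by rewrite size_cat size_mkseq addn1.
apply: vlist_cat => //.
- rewrite -/y; nra.
- rewrite -/y; have := hE (size (L ++ B)).-1; nra.
Qed.

(* [st] bounds the L^2 norm of all the later modifications of [sg]. *)
Record state := State { sg : R -> R; sL : seq R; st : R }.

Definition valid (s : state) : Prop :=
  [/\ sqint (sg s), exists S, supp S (sg s), gen (@box R 1) (sg s),
      exists C, 0 < C < 2 /\ bess C (sg s) & 0 < st s /\ vlist (sL s)].

Variable tgt : nat -> R * R * R.
Hypothesis tgtP : forall k, 2 < (tgt k).1.2 /\ 0 < (tgt k).2.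

(** The first two clauses make the modifications telescope, the third gives a pointwise limit, and
    the last keeps the approximation valid when [sg s'] is replaced by the limit, at distance at
    most [st s']. *)
Definition step (k : nat) (s s' : state) : Prop :=
  [/\ st s' <= st s / 2, nm (sg s' - sg s) <= st s / 2,
      forall t, `|t| <= k%:R -> sg s' t = sg s t,
      exists B, (0 < size B)%N /\ sL s' = sL s ++ B &
      exists c : nat -> R,
       [/\ nm (tr (tgt k).1.1 (@box R 1) -
             \sum_(n < size (sL s')) c n *: tr (nth 0 (sL s') n) (sg s')) <= (tgt k).2 / 2,
          \sum_(n < size (sL s')) `|c n| `^ (tgt k).1.2 <= (tgt k).2 &
          st s' * \sum_(n < size (sL s')) `|c n| <= (tgt k).2 / 2]].

Lemma step_ex k s : valid s -> exists s', valid s' /\ step k s s'.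
Proof.
case: s => g L tau [/= hg [S hS] hgen [C [hC hb]] [tau0 hL]].
have [q2 eta0] := tgtP k.
set x0 := (tgt k).1.1; set q := (tgt k).1.2 in q2 *; set eta := (tgt k).2 in eta0 *.
have tau2 : 0 < tau / 2 by rewrite divr_gt0.
have eta2 : 0 < eta / 2 by rewrite divr_gt0.
have [rho [A [rho0 A0 H]]] := @l2stage R (@box R 1) g S C x0 q (eta / 2) (tau / 2) k%:R
  (sqint_box ler01) hg hS hgen hb hC q2 eta2 tau2.
have [F hF] := eps_small rho0.
have [B [hB FB]] := vlist_extend F hL.
have [E [E0 hE]] := eps_bound.
set L1 := L ++ B in hB FB.
have y0 : 0 < last 0 L1 by exact: vlist_last.
have [g' [S' [C' [lam [c [[hg' hS' hgen' hb' hC'] [[hn hw] hX hlam happ hlq]]]]]]] :=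
  H ((1 + E) * last 0 L1 + 1).
pose L' := L1 ++ mkseq lam A.
have hL' : vlist L'.
  apply: vlist_cat => //.
  - by apply: ltW; apply: le_lt_trans hX; nra.
  - by apply: le_lt_trans hX; have := hE (size L1).-1; nra.
  have lpos a : (a < A)%N -> 0 < lam a.
    elim: a => [_|a IH aA]; first by apply: lt_trans hX; nra.
    have [h1 _] := hlam a aA; have := IH (ltnW aA); lra.
  move=> a aA; have [h1 h2] := hlam a aA; split=> //.
  apply: lt_trans h2; rewrite ltr_pM2r ?lpos ?(ltnW aA) // ltrD2l; apply: hF.
  by apply: leq_trans FB _; rewrite leq_addr.
(* Earlier points and filler points get coefficient zero; only the new block is used. *)
pose c' n := if (n < size L1)%N then 0 else c (n - size L1)%N.
have sL' : size L' = (size L1 + A)%N by rewrite size_cat size_mkseq.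
have sumE (V : nmodType) (G : nat -> R -> V) : (forall n, G n 0 = 0) ->
    \sum_(n < size L') G n (c' n) = \sum_(a < A) G (size L1 + a)%N (c a).
  move=> G0; rewrite sL' big_split_ord /= big1 ?add0r; last first.
    by move=> i _; rewrite /c' ltn_ord.
  by apply: eq_bigr => a _; rewrite /c' ltnNge leq_addr /= addKn.
pose Sc := \sum_(a < A) `|c a|.
have Sc0 : 0 <= Sc by apply: sumr_ge0.
have Sc1 : 0 < Sc + 1 by lra.
pose tau' := Num.min (tau / 2) (eta / 2 / (Sc + 1)).
exists (State g' L' tau'); split; split => //=.
- by exists S'.
- by exists C'.
- by split => //; rewrite lt_min tau2 divr_gt0.
- by rewrite ge_min lexx.
- exists (B ++ mkseq lam A); split; last by rewrite /L' /L1 catA.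
  by rewrite size_cat size_mkseq addn_gt0 A0 orbT.
exists c'; split.
- have -> : \sum_(n < size L') c' n *: tr (nth 0 L' n) g' =
     \sum_(a < A) c a *: tr (lam a) g'.
    rewrite (sumE _ (fun n y => y *: tr (nth 0 L' n) g')); last by move=> n; rewrite scale0r.
    apply: eq_bigr => a _; rewrite /L' nth_cat ltnNge leq_addr /= addKn.
    by rewrite nth_mkseq.
  exact: happ.
- rewrite (sumE _ (fun n y => `|y| `^ q)); last first.
    by move=> n; rewrite normr0 powR0 // gt_eqF //; lra.
  apply: le_trans hlq _; lra.
- rewrite (sumE _ (fun n y => `|y|)); last by move=> n; rewrite normr0.
  rewrite -/Sc; apply: le_trans (_ : tau' * (Sc + 1) <= _).
    by rewrite ler_wpM2l ?lerDl // le_min ltW //= ltW // divr_gt0.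
  by rewrite -ler_pdivlMr // ge_min lexx orbT.
Qed.
End Recursion.

(** * The limit generator and the sequence Lambda *)

Section Limit.
Context {R : realType}.
Variable eps : nat -> R.
Hypothesis eps_gt0 : forall n, 0 < eps n.
Hypothesis eps_cvg0 : eps n @[n --> \oo] --> (0 : R).
Variable tgt : nat -> R * R * R.
Hypothesis tgtP : forall k, 2 < (tgt k).1.2 /\ 0 < (tgt k).2.

Lemma states_ex : exists S_ : nat -> @state R,
  forall k, valid eps (S_ k) /\ step tgt k (S_ k) (S_ k.+1).
Proof.
have /choice[F hF] : forall ks : nat * @state R, exists s',
    valid eps ks.2 -> valid eps s' /\ step tgt ks.1 ks.2 s'.
  move=> [k s] /=; have [hs|hs] := pselect (valid eps s).
    by have [s' hs'] := step_ex eps_gt0 eps_cvg0 tgtP k hs; exists s'.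
  by exists s.
pose s0 := State (@box R 1) [:: 1] 1.
have v0 : valid eps s0.
  split => //=.
  - exact: sqint_box.
  - by exists 1; exact: supp_box.
  - exact: gen_refl.
  - exists 1; split; [lra|by apply: bess_box; rewrite ler01 lexx].
pose S_ := fix S_ k := if k is k'.+1 then F (k', S_ k') else s0.
have hv : forall k, valid eps (S_ k).
  by elim=> [//|k IH] /=; have [] := hF (k, S_ k) IH.
by exists S_ => k; split=> //; have [] := hF (k, S_ k) (hv k).
Qed.

Lemma main_real : exists (lambda : nat -> R) (G : R -> R),
  [/\ forall n, 0 < lambda n,
      forall n, lambda n + 1 <= lambda n.+1 /\
        (1 + eps n) * lambda n < lambda n.+1,
      sqint G, bess 2 G &
      forall k, exists (N : nat) (c : nat -> R),
        nm (tr (tgt k).1.1 (@box R 1) - \sum_(n < N) c n *: tr (lambda n) G)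
          <= (tgt k).2 /\
        \sum_(n < N) `|c n| `^ (tgt k).1.2 <= (tgt k).2].
Proof.
have [S_ hS] := states_ex.
have hv k := (hS k).1; have hst k := (hS k).2.
have hg k : sqint (sg (S_ k)) by have [] := hv k.
have ht k : 0 < st (S_ k) by have [_ _ _ _ []] := hv k.
have hL k : vlist eps (sL (S_ k)) by have [_ _ _ _ []] := hv k.
have pre k j : exists B, sL (S_ (k + j)%N) = sL (S_ k) ++ B.
  elim: j => [|j [B hB]]; first by exists [::]; rewrite addn0 cats0.
  have [_ _ _ [B' [_ hB']] _] := hst (k + j)%N.
  by exists (B ++ B'); rewrite addnS hB' hB catA.
have sz k : (k < size (sL (S_ k)))%N.
  elim: k => [|k IH]; first by have [] := hL 0%N.
  have [_ _ _ [B [hB e]] _] := hst k; rewrite e size_cat.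
  by rewrite -addn1 leq_add.
have nthE k n : (n < size (sL (S_ k)))%N ->
    nth 0 (sL (S_ k)) n = nth 0 (sL (S_ n)) n.
  move=> hn; have [nk|kn] := leqP n k.
    by have [B e] := pre n (k - n)%N; rewrite subnKC // in e; rewrite e nth_cat sz.
  have [B e] := pre k (n - k)%N; rewrite subnKC ?(ltnW kn) // in e.
  by rewrite e nth_cat hn.
pose lambda n := nth 0 (sL (S_ n)) n.
(* From stage [Num.bound |t|] on, the value at t is frozen. *)
pose G t := sg (S_ (Num.bound `|t|)) t.
have stab t j k : (Num.bound `|t| <= k)%N -> sg (S_ (k + j)%N) t = sg (S_ k) t.
  move=> hk; elim: j => [|j IH]; first by rewrite addn0.
  rewrite addnS -IH; have [_ _ h _ _] := hst (k + j)%N; apply: h.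
  apply: ltW; apply: lt_le_trans (archi_boundP (normr_ge0 t)) _.
  by rewrite ler_nat (leq_trans hk) // leq_addr.
have GE t k : (Num.bound `|t| <= k)%N -> sg (S_ k) t = G t.
  by move=> hk; rewrite /G -(subnKC hk) stab.
(* As [st] at least halves, a modification of size [st s / 2] is at most [st s - st s'], and the sum
   telescopes. *)
have dist k j : nm (sg (S_ (k + j)%N) - sg (S_ k)) <= st (S_ k) - st (S_ (k + j)%N).
  elim: j => [|j IH]; first by rewrite addn0 !subrr nm0.
  have [h1 h2 _ _ _] := hst (k + j)%N.
  rewrite addnS; apply: le_trans (nm_tri (hg _) (hg _) (hg (k + j)%N)) _; lra.
have lim k : sqint (G - sg (S_ k)) /\ nm (G - sg (S_ k)) <= st (S_ k).
  apply: (@fatou_nm R (fun j => sg (S_ (k + j)%N) - sg (S_ k))).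
  - exact: ltW.
  - by move=> j; exact: sqintB.
  - by move=> j; have := dist k j; have := ht (k + j)%N; lra.
  - move=> t; exists (Num.bound `|t|) => j hj; rewrite !fctE GE //.
    by rewrite (leq_trans hj) // leq_addl.
have sG : sqint G.
  have [h _] := lim 0%N; have := sqintD h (hg 0%N).
  by rewrite subrK.
exists lambda, G; split => //.
- by move=> n; apply: vlist_pos (hL n) (sz n).
- move=> n; have h1 := sz n.+1.
  have [_ _ h] := hL n.+1; have := h n h1.
  by rewrite (nthE n.+1 n) // ltnW.
- move=> N c x hx.
  have hb k : nm (\sum_(n < N) c n *: tr (x n) (sg (S_ k))) <=
      2 * Num.sqrt (\sum_(n < N) c n ^+ 2).
    have [_ _ _ [C [C02 hC]] _] := hv k; apply: le_trans (hC N c x hx) _.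
    by rewrite ler_wpM2r ?sqrtr_ge0 //; lra.
  apply: (@fatou_nm R (fun k => \sum_(n < N) c n *: tr (x n) (sg (S_ k))) _ _ _ _ hb _).2.
  - by rewrite mulr_ge0 // sqrtr_ge0.
  - by move=> k; apply: sqint_sum => n _; apply: sqintZ; exact: sqint_tr.
  - move=> t; exists (\max_(n < N) Num.bound (`|t - x n|)%R)%N => j hj.
    rewrite !fct_sumE; apply: eq_bigr => n _.
    rewrite -[LHS]/(c n * sg (S_ j) (t - x n)) GE //.
    by apply: leq_trans hj; exact: leq_bigmax.
- move=> k; have [_ _ _ _ [c [h1 h2 h3]]] := hst k.
  exists (size (sL (S_ k.+1))), c; split => //.
  have -> : \sum_(n < size (sL (S_ k.+1))) c n *: tr (lambda n) G =
     \sum_(n < size (sL (S_ k.+1))) c n *: tr (nth 0 (sL (S_ k.+1)) n) G.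
    by apply: eq_bigr => n _; rewrite /lambda -(nthE k.+1) //.
  set s := \sum_(n < _) c n *: tr (nth 0 _ n) (sg _) in h1.
  set s' := \sum_(n < _) _.
  have hs : sqint s by apply: sqint_sum => n _; apply: sqintZ; exact: sqint_tr.
  have hs' : sqint s' by apply: sqint_sum => n _; apply: sqintZ; exact: sqint_tr.
  have hb : sqint (tr (tgt k).1.1 (@box R 1)) by apply: sqint_tr; exact: sqint_box.
  apply: le_trans (nm_tri hb hs' hs) _.
  suff : nm (s - s') <= (tgt k).2 / 2 by move: h1; lra.
  apply: le_trans h3.
  have -> : s - s' = \sum_(n < size (sL (S_ k.+1))) c n *:
      tr (nth 0 (sL (S_ k.+1)) n) (sg (S_ k.+1) - G).
    by rewrite /s /s' -sumrB; apply: eq_bigr => n _; rewrite trB scalerBr.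
  have [hd hdn] := lim k.+1.
  have hd' : sqint (sg (S_ k.+1) - G) by exact: sqintB.
  apply: le_trans (nm_sum _ _) _.
    by move=> n _; apply: sqintZ; exact: sqint_tr.
  rewrite mulr_sumr; apply: ler_sum => n _.
  rewrite nmZ ?nm_tr //; last exact: sqint_tr.
  by rewrite mulrC ler_wpM2r // nmB.
Qed.
End Limit.

(** * Density of the translates of an indicator function *)

Section Density.
Context {R : realType}.
Notation mu := (@lebesgue_measure R).
Notation TR := (measurableTypeR R).
Implicit Types (f g u v : R -> R) (h x : R).

Lemma sqint_le u v : measurable_fun setT (u : TR -> R) -> sqint v ->
  (forall t, `|u t| <= `|v t|) -> sqint u.
Proof.
move=> mu_ [mv Iv] huv; split => //.
apply: (le_integrable measurableT _ _ Iv).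
  by apply/measurable_EFinP; apply: measurable_funX.
move=> t _; rewrite !gee0_abs ?lee_fin ?sqr_ge0 //.
by rewrite -[leLHS]real_normK ?num_real // -[leRHS]real_normK ?num_real // lerXn2r ?nnegrE.
Qed.

Lemma nm_dct (u_ : nat -> R -> R) u v :
  (forall j, measurable_fun setT (u_ j : TR -> R)) -> sqint v ->
  (forall j t, `|u_ j t| <= `|v t|) ->
  (forall t, u_ j t @[j --> \oo] --> u t) ->
  [/\ sqint u, forall j, sqint (u_ j) &
    forall eta : R, 0 < eta -> exists j, nm (u - u_ j) < eta].
Proof.
move=> mu_ sv huv cv.
have mU : measurable_fun setT (u : TR -> R).
  by apply: (@measurable_fun_cvg _ _ _ setT u_ u) => // t _; exact: cv.
have huv' t : `|u t| <= `|v t|.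
  have c1 : `|u_ j t| @[j --> \oo] --> `|u t| by apply: cvg_norm; exact: cv.
  rewrite -(cvg_lim _ c1) //; apply: limr_le; first by apply/cvg_ex; exists `|u t|.
  by apply: nearW => j; exact: huv.
have su := sqint_le mU sv huv'.
have suj j := sqint_le (mu_ j) sv (huv j).
split => // eta eta0.
pose F j (t : TR) : \bar R := ((u t - u_ j t) ^+ 2)%:E.
have mF j : measurable_fun setT (F j).
  by apply/measurable_EFinP; apply: measurable_funX; exact: measurable_funB.
have cF : {ae mu, forall t, setT t -> F^~ t @ \oo --> 0%E}.
  apply/aeW => t _; rewrite /F; apply: cvg_EFin; first exact: nearW.
  have c1 : u t - u_ j t @[j --> \oo] --> u t - u t.
    by apply: cvgB; [exact: cvg_cst|exact: cv].
  rewrite subrr in c1; have := cvgM c1 c1; rewrite mulr0 => c2.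
  rewrite (_ : fine \o _ = (fun j => (u t - u_ j t) * (u t - u_ j t))).
    exact: c2.
  by apply/funext => j; rewrite /= expr2.
have [mv Iv] := sv.
have Ig : mu.-integrable setT (fun t => 4%:E * ((v t) ^+ 2)%:E)%E.
  exact: integrableZl.
have Fg : {ae mu, forall t j, setT t -> (`|F j t| <= 4%:E * ((v t) ^+ 2)%:E)%E}.
  apply/aeW => t j _; rewrite gee0_abs ?lee_fin ?sqr_ge0 //.
  have h1 := huv j t; have h2 := huv' t.
  rewrite -[leLHS]real_normK ?num_real // -[v t ^+ 2]real_normK ?num_real //.
  have h3 : `|u t - u_ j t| <= 2 * `|v t| by apply: le_trans (ler_normB _ _) _; lra.
  have : `|u t - u_ j t| ^+ 2 <= (2 * `|v t|) ^+ 2 by rewrite lerXn2r ?nnegrE // mulr_ge0.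
  rewrite exprMn; lra.
have m0 : measurable_fun setT (cst 0%E : TR -> \bar R) by exact: measurable_cst.
have [_ _] := dominated_convergence measurableT mF m0 cF Ig Fg.
rewrite integral0 => hc.
have e2 : 0 < eta ^+ 2 by rewrite exprn_gt0.
have hnear : \forall j \near \oo, (\int[mu]_t F j t < (eta ^+ 2)%:E)%E.
  have : nbhs (0%E : \bar R) [set x | (x < (eta ^+ 2)%:E)%E].
    apply: open_nbhs_nbhs; split; first exact: open_ereal_lt_ereal.
    by rewrite /= lte_fin.
  by move=> /hc.
have [J _ hJ] := hnear.
exists J; have := hJ J (leqnn J) => /=.
have -> : (\int[mu]_t F J t = \int[mu]_t (((u - u_ J) t) ^+ 2)%:E)%E by [].
rewrite sqint_ip ?lte_fin; last exact: sqintB.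
by rewrite -nm_sqr ltr_pXn2r // ?nnegrE ?nm_ge0 // ltW.
Qed.

(** Rational shifts, so that the iteration has only countably many targets. *)
Definition combq (s : seq (R * rat)) : R -> R :=
  \sum_(p <- s) p.1 *: tr (ratr p.2) (box 1).

Definition dens f := sqint f /\
  forall eta : R, 0 < eta -> exists s, nm (f - combq s) < eta.

Lemma sqint_combq s : sqint (combq s).
Proof.
by apply: sqint_sum => p _; apply: sqintZ; apply: sqint_tr; exact: sqint_box.
Qed.

Lemma dens_lim f : sqint f ->
  (forall eta : R, 0 < eta -> exists g, dens g /\ nm (f - g) < eta) -> dens f.
Proof.
move=> hf H; split=> // eta eta0; have e2 : 0 < eta / 2 by rewrite divr_gt0.
have [g [[hg hd] hfg]] := H _ e2; have [s hs] := hd _ e2.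
exists s; apply: le_lt_trans (nm_tri hf (sqint_combq s) hg) _; lra.
Qed.

Lemma dens_combq s : dens (combq s).
Proof.
by split=> [|e e0]; [exact: sqint_combq|exists s; rewrite subrr nm0].
Qed.

Lemma densD f g : dens f -> dens g -> dens (f + g).
Proof.
move=> [hf df] [hg dg]; split; first exact: sqintD.
move=> eta eta0; have e2 : 0 < eta / 2 by rewrite divr_gt0.
have [s hs] := df _ e2; have [s' hs'] := dg _ e2.
exists (s ++ s'); have -> : combq (s ++ s') = combq s + combq s'.
  by rewrite /combq big_cat.
rewrite opprD addrACA; have h1 := sqintB hf (sqint_combq s).
have h2 := sqintB hg (sqint_combq s').
apply: le_lt_trans (nmD h1 h2) _; lra.
Qed.

Lemma densZ a f : dens f -> dens (a *: f).
Proof.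
move=> [hf df]; split; first exact: sqintZ.
move=> eta eta0; have a0 : 0 < `|a| + 1 by rewrite ltr_wpDl.
have [s hs] := df _ (divr_gt0 eta0 a0).
exists [seq (a * p.1, p.2) | p <- s].
have -> : combq [seq (a * p.1, p.2) | p <- s] = a *: combq s.
  by rewrite /combq big_map scaler_sumr; apply: eq_bigr => p _; rewrite scalerA.
rewrite -scalerBr nmZ; last by apply: sqintB => //; exact: sqint_combq.
move: hs; rewrite ltr_pdivlMr // => hs; apply: le_lt_trans hs.
by rewrite mulrC ler_wpM2l ?nm_ge0 // lerDl.
Qed.

Lemma dens_tr (x : rat) f : dens f -> dens (tr (ratr x) f).
Proof.
move=> [hf df]; split; first exact: sqint_tr.
move=> eta eta0; have [s hs] := df _ eta0.
exists [seq (p.1, x + p.2) | p <- s].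
have -> : combq [seq (p.1, x + p.2) | p <- s] = tr (ratr x) (combq s).
  rewrite /combq big_map tr_sum; apply: eq_bigr => p _.
  by rewrite trZ tr_tr /= rmorphD.
by rewrite -trB nm_tr //; apply: sqintB => //; exact: sqint_combq.
Qed.

Lemma dens0 : dens 0.
Proof. by have := dens_combq [::]; rewrite /combq big_nil. Qed.

Lemma dens_sum (I : Type) (s : seq I) (P : pred I) (F : I -> R -> R) :
  (forall i, P i -> dens (F i)) -> dens (\sum_(i <- s | P i) F i).
Proof. by move=> h; apply: big_ind => //; [exact: dens0|exact: densD]. Qed.

Lemma dens_box1 : dens (box 1).
Proof.
have := dens_combq [:: (1, 0)].
by rewrite /combq big_seq1 scale1r rmorph0 tr0.
Qed.

Lemma box_shift h : 0 <= h <= 1 ->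
  @box R 1 - tr h (box 1) = box h - tr 1 (box h).
Proof.
move=> /andP[h0 h1]; apply/funext => t; rewrite !fctE /tr !boxE.
case: (leP 0 t) => t0; case: (ltP t 1) => t1; case: (leP 0 (t - h)) => t2;
  case: (ltP (t - h) 1) => t3; case: (ltP t h) => t4; case: (leP 0 (t - 1)) => t5;
  case: (ltP (t - 1) h) => t6 /=; rewrite ?subr0 ?sub0r ?subrr //; lra.
Qed.

(** By [box_shift], telescoped, the closed span contains [box h - tr K (box h)] for every integer K.
    Averaging over K < n leaves [box h] up to the mean of n disjoint translates, whose norm is at
    most n^(-1/2). *)
Lemma dens_box (k : nat) : dens (box (k.+1%:R^-1)).
Proof.
pose h : R := k.+1%:R^-1.
have k0 : 0 < k.+1%:R :> R by [].
have h0 : 0 <= h by rewrite invr_ge0.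
have h1 : h <= 1 by rewrite invf_le1 // ler1n.
have h01 : 0 <= h <= 1 by rewrite h0.
have hb := sqint_box h0.
have d0 (x : nat) f : dens f -> dens (tr x%:R f).
  by move=> hf; have := dens_tr (x%:R) hf; rewrite ratr_nat.
have dh f : dens f -> dens (tr h f).
  by move=> hf; have := dens_tr (k.+1%:R^-1) hf; rewrite fmorphV /= ratr_nat.
have d1 (K : nat) : dens (box h - tr K%:R (box h)).
  elim: K => [|K IH]; first by rewrite tr0 subrr; exact: dens0.
  have -> : box h - tr K.+1%:R (box h) =
     (box h - tr K%:R (box h)) + tr K%:R (box 1 - tr h (box 1)).
    rewrite (box_shift h01) trB tr_tr natr1 addrA addrNK //.
  apply: densD => //; apply: d0; apply: densD; first exact: dens_box1.
  by rewrite -scaleN1r; apply: densZ; apply: dh; exact: dens_box1.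
apply: dens_lim => // eta eta0.
have [n [n0 hn]] := natr_ceil ((2 / eta) ^+ 2).
have nR : 0 < n%:R :> R by rewrite ltr0n.
exists (\sum_(K < n) n%:R^-1 *: (box h - tr (K : nat)%:R (box h))); split.
  by apply: dens_sum => K _; apply: densZ; exact: d1.
have -> : box h - \sum_(K < n) n%:R^-1 *: (box h - tr (K : nat)%:R (box h)) =
   \sum_(K < n) n%:R^-1 *: tr (K : nat)%:R (box h).
  under eq_bigr do rewrite scalerBr.
  rewrite sumrB sumr_const card_ord -scaler_nat scalerA divff ?gt_eqF // scale1r.
  by rewrite opprB addrC subrK.
have := @bess_box R h h01 n (fun _ => n%:R^-1) (fun K => K%:R) _.
rewrite mul1r => H; apply: le_lt_trans (H _) _.
  move=> i j _ _ ij; have [l|l|l] := ltngtP i j; last by rewrite l eqxx in ij.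
  - by rewrite distrC ger0_norm -natrB ?ler1n ?subn_gt0 // ltnW.
  - by rewrite ger0_norm -natrB ?ler1n ?subn_gt0 // ltnW.
rewrite sumr_const card_ord -[_ *+ n]mulr_natl expr2 mulrA divff ?gt_eqF // mul1r.
rewrite -[ltRHS]ger0_norm ?(ltW eta0) // -sqrtr_sqr ltr_sqrt ?exprn_gt0 //.
rewrite -[ltRHS]invrK ltf_pV2 ?posrE ?invr_gt0 ?exprn_gt0 //.
apply: lt_le_trans hn; rewrite exprMn exprVn.
have : 0 < eta ^- 2 by rewrite invr_gt0 exprn_gt0.
lra.
Qed.
End Density.

(** * From step functions to continuous, bounded and general functions *)

Section DensityAll.
Context {R : realType}.
Notation mu := (@lebesgue_measure R).
Notation TR := (measurableTypeR R).
Implicit Types (f g u v : R -> R) (h x : R).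

(** The indicator of [- n, n + 1). *)
Definition window (n : nat) : R -> R := tr (- n%:R) (box (n.*2.+1)%:R).

Lemma windowE n t : window n t = (0 <= t + n%:R < (n.*2.+1)%:R)%R%:R.
Proof. by rewrite /window /tr boxE opprK. Qed.

Lemma sqint_window n : sqint (window n).
Proof. by apply: sqint_tr; exact: sqint_box. Qed.

Definition step_approx g (n k : nat) : R -> R :=
  \sum_(i < n.*2.+1 * k.+1) g (i%:R / k.+1%:R - n%:R) *:
     tr (i%:R / k.+1%:R - n%:R) (box k.+1%:R^-1).

Lemma step_approxE g n k t : step_approx g n k t =
  g ((Num.truncn ((t + n%:R) * k.+1%:R))%:R / k.+1%:R - n%:R) * window n t.
Proof.
have k0 : 0 < k.+1%:R :> R by [].
have key (i : nat) : tr (i%:R / k.+1%:R - n%:R) (box k.+1%:R^-1) t =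
    (i%:R <= (t + n%:R) * k.+1%:R < i.+1%:R)%R%:R.
  rewrite /tr boxE; congr ((nat_of_bool _)%:R).
  have -> : t - (i%:R / k.+1%:R - n%:R) = ((t + n%:R) * k.+1%:R - i%:R) / k.+1%:R.
    field; apply/lt0r_neq0; move: k0; rewrite -natr1; lra.
  rewrite pmulr_lge0 ?invr_gt0 // subr_ge0; congr (_ && _).
  by rewrite ltr_pdivrMr // mulVf ?gt_eqF // ltrBlDr nat1r.
rewrite /step_approx fct_sumE windowE.
under eq_bigr do rewrite -[_ t]/(_ * _) key.
case: (boolP (0 <= t + n%:R < n.*2.+1%:R)%R) => [/andP[y0 y1]|hN].
  have h0 : 0 <= (t + n%:R) * k.+1%:R by rewrite mulr_ge0.
  have hi : (Num.truncn ((t + n%:R) * k.+1%:R) < n.*2.+1 * k.+1)%N.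
    rewrite -(ltr_nat R); apply: le_lt_trans (_ : (t + n%:R) * k.+1%:R < _).
      by have /andP[] := truncn_itv h0.
    by rewrite natrM ltr_pM2r.
  rewrite (bigD1 (Ordinal hi)) //= truncn_itv // big1 ?addr0 // => i hni.
  case: (boolP (_ <= _ < _)) => h; last by rewrite mulr0.
  by move/eqP: hni; case; apply: val_inj; rewrite /= (truncn_def h).
rewrite mulr0 big1 // => i _.
case: (boolP (_ <= _ < _)) => h; last by rewrite mulr0.
exfalso; move/negP: hN; apply; have /andP[h1 h2] := h.
apply/andP; split.
  by rewrite -(pmulr_lge0 _ k0); apply: le_trans h1.
rewrite -(ltr_pM2r k0) -natrM; apply: lt_le_trans h2 _.
by rewrite ler_nat.
Qed.

Lemma dens_step g n k : dens (step_approx g n k).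
Proof.
apply: dens_sum => i _; apply: densZ.
have := dens_tr (i%:R / k.+1%:R - n%:R) (@dens_box R k).
by rewrite rmorphB rmorphM /= fmorphV /= !ratr_nat.
Qed.

Lemma dens_cont g n (B : R) : continuous g -> (forall t, `|g t| <= B) ->
  dens (fun t => g t * window n t).
Proof.
move=> gc gB.
have B0 : 0 <= B by apply: le_trans (gB 0).
have hm k : measurable_fun setT (step_approx g n k : TR -> R).
  by have [[]] := dens_step g n k.
have hv : sqint (B *: window n) by apply: sqintZ; exact: sqint_window.
have hb k t : `|step_approx g n k t| <= `|(B *: window n) t|.
  rewrite step_approxE -[(B *: window n) t]/(B * window n t) !normrM ler_wpM2r //.
  by rewrite (ger0_norm B0).
have cv t : step_approx g n k t @[k --> \oo] --> g t * window n t.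
  under eq_fun do rewrite step_approxE.
  rewrite windowE; case: (boolP (_ <= _ < _)) => [/andP[y0 _]|_]; last first.
    by under eq_fun do rewrite mulr0; rewrite mulr0; exact: cvg_cst.
  under eq_fun do rewrite mulr1; rewrite mulr1.
  suff ca : (fun k => (Num.truncn ((t + n%:R) * k.+1%:R))%:R / k.+1%:R - n%:R) @ \oo --> t.
    exact: (cvg_comp _ _ ca (gc t)).
  apply/cvgrPdist_le => e e0.
  have [N [N0 hN]] := natr_ceil (e^-1).
  exists N => // k /= Nk.
  have k0 : 0 < k.+1%:R :> R by [].
  set y := (t + n%:R) * k.+1%:R; have hy : 0 <= y by rewrite mulr_ge0.
  have /andP[h1 h2] := truncn_itv hy.
  have -> : t - ((Num.truncn y)%:R / k.+1%:R - n%:R) = (y - (Num.truncn y)%:R) / k.+1%:R.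
    rewrite /y; field; apply/lt0r_neq0; move: k0; rewrite -natr1; lra.
  rewrite ger0_norm; last by rewrite divr_ge0 // subr_ge0.
  rewrite ler_pdivrMr //; apply: le_trans (_ : 1 <= _).
    by rewrite -natr1 in h2; lra.
  have : e^-1 <= k.+1%:R by apply: le_trans hN _; rewrite ler_nat ltnW.
  move=> h; have := ler_wpM2l (ltW e0) h; rewrite divff ?gt_eqF //.
have [sf _ hl] := nm_dct hm hv hb cv.
apply: dens_lim => // eta eta0; have [j hj] := hl _ eta0.
by exists (step_approx g n j); split => //; exact: dens_step.
Qed.

(** A continuous L^1 approximation is clamped to [- n, n], which only brings it closer to f; then |f
    - g|^2 <= 2 n |f - g| turns L^1 closeness into L^2 closeness. *)
Lemma dens_bounded f n : sqint f -> (forall t, `|f t| <= n%:R) ->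
  (forall t, f t = f t * window n t) -> dens f.
Proof.
move=> hf fb fw.
pose E : set TR := `[- n%:R, n.+1%:R[%classic.
have wE t : window n t = \1_E t.
  rewrite windowE indicE; congr ((nat_of_bool _)%:R).
  have -> : (n.*2.+1)%:R = n.+1%:R + n%:R :> R by rewrite -natrD addSn addnn.
  by apply/idP/idP; rewrite inE /E /= in_itv /= ltrD2r -lerBlDr sub0r.
have mE : measurable E by exact: measurable_itv.
have muE : (mu E < +oo)%E.
  rewrite /E lebesgue_measure_itv /=; case: ifP => _; last by rewrite ltry.
  by rewrite -EFinB ltry.
have If : mu.-integrable setT (EFin \o f).
  have := integrable_mul hf (sqint_window n); apply: eq_integrable => // t _.
  by rewrite /= -fw.
have IfE : mu.-integrable E (EFin \o f) by exact: integrableS If.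
have [g_ [gc gi gl]] := approximation_continuous_integrable mE muE IfE.
apply: dens_lim => // eta eta0.
have nn : 0 <= n%:R :> R by [].
pose dl : R := eta ^+ 2 / (2 * n%:R + 1).
have dl0 : 0 < dl by rewrite divr_gt0 ?exprn_gt0 //; lra.
have hnear : \forall j \near \oo, (\int[mu]_(t in E) `|(f t - g_ j t)%:E| < dl%:E)%E.
  have : nbhs (0%E : \bar R) [set x | (x < dl%:E)%E].
    apply: open_nbhs_nbhs; split; first exact: open_ereal_lt_ereal.
    by rewrite /= lte_fin.
  by move=> /gl.
have [J _ /(_ J (leqnn J)) /= hJ] := hnear.
pose g t := Num.max (- n%:R) (Num.min n%:R (g_ J t)).
have gB t : `|g t| <= n%:R.
  rewrite ler_norml /g le_max lexx /= ge_max ge_min lexx /= andbT; lra.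
have cg : continuous g.
  move=> t; apply: (@continuous_max R R (cst (- n%:R)) (fun t => Num.min n%:R (g_ J t))).
    exact: cst_continuous.
  by apply: (@continuous_min R R (cst n%:R) (g_ J)); [exact: cst_continuous|exact: gc].
have hd := dens_cont n cg gB.
exists (fun t => g t * window n t); split => //.
set p := f - _.
have sp : sqint p by apply: sqintB => //; case: hd.
have pE t : p t = (f t - g t) * window n t.
  by rewrite /p -[LHS]/(f t - g t * window n t) {1}fw mulrBl.
have fg1 t : `|f t - g t| <= `|f t - g_ J t|.
  have := fb t; rewrite ler_norml => /andP[f1 f2].
  rewrite /g; case: (leP n%:R (g_ J t)) => h1; case: (leP (- n%:R) _) => h2; rewrite ?lexx //.
  - rewrite ler0_norm ?subr_le0 // ler0_norm ?subr_le0 //; lra.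
  - lra.
  - rewrite ger0_norm ?ger0_norm; lra.
have ht (t : TR) : E t -> ((p t ^+ 2)%:E <= (2 * n%:R)%:E * `|(f t - g_ J t)%:E|)%E.
  move=> Et; rewrite lee_fin pE wE indicE mem_set // mulr1.
  rewrite -real_normK ?num_real // expr2; apply: ler_pM => //.
  apply: le_trans (ler_normB _ _) _; have := fb t; have := gB t; lra.
have hint : (\int[mu]_t ((p t) ^+ 2)%:E <= (2 * n%:R)%:E * \int[mu]_(t in E) `|(f t - g_ J t)%:E|)%E.
  have -> : (\int[mu]_t ((p t) ^+ 2)%:E = \int[mu]_(t in E) ((p t) ^+ 2)%:E)%E.
    rewrite [RHS]integral_mkcond; apply: eq_integral => t _; rewrite patchE.
    by case: ifPn => // tE; rewrite pE wE indicE (negbTE tE) mulr0 expr0n.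
  have mfg : measurable_fun E (fun t : TR => `|(f t - g_ J t)%:E|%E).
    apply: measurableT_comp => //; apply/measurable_EFinP.
    apply: measurable_funB.
      by have /integrableP[/measurable_EFinP] := IfE.
    by have /integrableP[/measurable_EFinP] := gi J.
  rewrite -ge0_integralZl //.
  apply: ge0_le_integral => //.
  - by move=> t _; rewrite lee_fin sqr_ge0.
  - apply/measurable_EFinP; apply: measurable_funX; apply: measurable_funTS.
    exact: (sqint_meas sp).
  - by apply: measurable_funeM.
rewrite sqint_ip // -nm_sqr in hint.
have : ((nm p ^+ 2)%:E < (eta ^+ 2)%:E)%E.
  apply: le_lt_trans hint _; apply: le_lt_trans (_ : ((2 * n%:R)%:E * dl%:E < _)%E).
    by apply: lee_wpmul2l; [rewrite lee_fin mulr_ge0|exact: ltW].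
  rewrite -EFinM lte_fin /dl mulrCA -[ltRHS]mulr1 ltr_pM2l ?exprn_gt0 //.
  by rewrite ltr_pdivrMr; lra.
by rewrite lte_fin ltr_pXn2r // ?nnegrE ?nm_ge0 // ltW.
Qed.

Lemma dens_all f : sqint f -> dens f.
Proof.
move=> hf; have mf := sqint_meas hf.
pose u_ (j : nat) : R -> R := fun t => f t * (\1_[set t : TR | `|f t| <= j%:R] t * window j t).
have mA (j : nat) : measurable [set t : TR | `|f t| <= j%:R].
  have h : measurable_fun setT (fun t : TR => `|f t| <= j%:R).
    apply: measurable_fun_ler; last exact: measurable_cst.
    exact: measurableT_comp.
  by have := h measurableT [set true] I; rewrite setTI.
have mu_ j : measurable_fun setT (u_ j : TR -> R).
  apply: measurable_funM => //; apply: measurable_funM.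
    exact: measurable_indic.
  exact: sqint_meas (sqint_window j).
have w01 j t : 0 <= (\1_[set t : TR | `|f t| <= j%:R] t * window j t : R) <= 1.
  rewrite windowE indicE; set b1 := (t \in _); set b2 := (_ <= _ < _)%R.
  by case: b1; case: b2; rewrite ?mulr0 ?mulr1 ?lexx ?ler01.
have hb j t : `|u_ j t| <= `|f t|.
  have /andP[h1 h2] := w01 j t.
  by rewrite normrM (ger0_norm h1) ler_piMr.
have cv t : u_ j t @[j --> \oo] --> f t.
  apply: cvg_near_cst.
  have [N [N0 hN]] := natr_ceil (`|f t| + `|t| + 1).
  exists N => // j /= Nj.
  have hj : `|f t| + `|t| + 1 <= j%:R by apply: le_trans hN _; rewrite ler_nat.
  have f0 := normr_ge0 (f t); have t0 := normr_ge0 t.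
  have h1 := ler_norm t; have h2 := ler_norm (- t); rewrite normrN in h2.
  rewrite /u_ windowE indicE mem_set /=; last by lra.
  rewrite (_ : (0 <= t + j%:R < j.*2.+1%:R)%R) ?mulr1 //.
  by rewrite -[j.*2.+1]addn1 natrD -addnn natrD; apply/andP; split; lra.
have [_ su hl] := nm_dct mu_ hf hb cv.
apply: dens_lim => // eta eta0; have [j hj] := hl _ eta0.
exists (u_ j); split => //; apply: (@dens_bounded _ j) => //.
  move=> t; rewrite /u_ indicE; case: (boolP (t \in _)) => [|_].
    rewrite inE /= mul1r => h; rewrite normrM; apply: le_trans h.
    by rewrite ler_piMr // windowE; case: (_ && _); rewrite ?normr1 ?normr0.
  by rewrite mul0r mulr0 normr0.
move=> t; rewrite /u_ -!mulrA; congr (_ * (_ * _)).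
by rewrite windowE; case: (_ && _); rewrite ?mulr1 ?mulr0.
Qed.
End DensityAll.

(** * Approximation and reduction of the complex case to the real one *)

Section ComplexReduction.
Context {R : realType}.
Notation mu := (@lebesgue_measure R).
Notation TR := (measurableTypeR R).
Implicit Types (f g : R -> R[i]).
Local Open Scope complex_scope.

Definition rpart f : R -> R := fun t => complex.Re (f t).
Definition ipart f : R -> R := fun t => complex.Im (f t).

Lemma cmodE (z : R[i]) : cmod z = Num.sqrt (complex.Re z ^+ 2 + complex.Im z ^+ 2).
Proof. by case: z. Qed.

Lemma cmod_sqr (z : R[i]) : cmod z ^+ 2 = complex.Re z ^+ 2 + complex.Im z ^+ 2.
Proof. by rewrite cmodE sqr_sqrtr // addr_ge0 ?sqr_ge0. Qed.

Lemma cmod_ge0 (z : R[i]) : 0 <= cmod z.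
Proof. by rewrite cmodE sqrtr_ge0. Qed.

Lemma cmod_le (z : R[i]) : cmod z <= `|complex.Re z| + `|complex.Im z|.
Proof.
rewrite -(@ler_pXn2r _ 2) ?nnegrE ?addr_ge0 ?cmod_ge0 //.
rewrite cmod_sqr -[complex.Re z ^+ 2]real_normK ?num_real //.
rewrite -[complex.Im z ^+ 2]real_normK ?num_real // sqrrD.
by rewrite addrAC lerDl mulrn_wge0 // mulr_ge0.
Qed.

Lemma finite_norm2 (F : R -> R) : (forall t, 0 <= F t) ->
  finite_norm mu 2%:E F <-> (\int[mu]_t ((F t) ^+ 2)%:E < +oo)%E.
Proof.
move=> F0; rewrite /finite_norm unlock.
have -> : (\int[mu]_t (`|(EFin \o F) t| `^ 2) = \int[mu]_t ((F t) ^+ 2)%:E)%E.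
  by apply: eq_integral => t _; rewrite /= ger0_norm // powR_mulrn.
split=> h; last exact: poweR_lty.
exact: (lty_poweRy _ h).
Qed.

Lemma L2P f : L2 f <-> sqint (rpart f) /\ sqint (ipart f).
Proof.
have hE : (\int[mu]_t ((cmod (f t)) ^+ 2)%:E =
    \int[mu]_t (rpart f t ^+ 2 + ipart f t ^+ 2)%:E)%E.
  by apply: eq_integral => t _; rewrite cmod_sqr.
rewrite /L2 /=; split=> [[mr mi /finite_norm2]|[hr hi]].
- rewrite hE => /(_ (fun t => cmod_ge0 (f t))) hfin.
  have sub (h : R -> R) : measurable_fun setT (h : TR -> R) ->
      (forall t, h t ^+ 2 <= rpart f t ^+ 2 + ipart f t ^+ 2) -> sqint h.
    move=> mh hh; split=> //; apply/integrableP; split.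
      by apply/measurable_EFinP; apply: measurable_funX.
    apply: le_lt_trans hfin; apply: ge0_le_integral => //.
    - by apply/measurable_EFinP; apply: measurableT_comp => //; apply: measurable_funX.
    - by apply/measurable_EFinP; apply: measurable_funD; apply: measurable_funX.
    - by move=> t _; rewrite gee0_abs lee_fin ?sqr_ge0.
  split; apply: sub => // t; first by rewrite lerDl sqr_ge0.
  by rewrite lerDr sqr_ge0.
- split; [exact: sqint_meas hr|exact: sqint_meas hi|].
  apply/finite_norm2; first by move=> t; exact: cmod_ge0.
  rewrite hE; have := integrable_EFinD hr.2 hi.2 => /integrableP[_].
  apply: le_lt_trans; apply: ge0_le_integral => //.
  - by move=> t _; rewrite lee_fin addr_ge0 ?sqr_ge0.
  - apply/measurable_EFinP; apply: measurable_funD; apply: measurable_funX.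
      exact: sqint_meas hr.
    exact: sqint_meas hi.
  - apply: measurableT_comp => //; apply/measurable_EFinP.
    apply: measurable_funD; apply: measurable_funX.
      exact: sqint_meas hr.
    exact: sqint_meas hi.
  - by move=> t _; rewrite /= lee_fin ler_norm.
Qed.

Lemma dot_norm_E f : L2 f -> dot_norm (@L2_dot R) f =
  Num.sqrt (ip (rpart f) (rpart f) + ip (ipart f) (ipart f)).
Proof.
move=> /L2P[hr hi]; rewrite /dot_norm /L2_dot /cintegral /=; congr Num.sqrt.
rewrite /ip -RintegralD //; try exact: integrable_mul.
apply: eq_Rintegral => t _; rewrite /rpart /ipart.
by case: (f t) => a b /=; ring.
Qed.

Lemma dot_norm_le f : L2 f -> dot_norm (@L2_dot R) f <= nm (rpart f) + nm (ipart f).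
Proof.
move=> hf; rewrite dot_norm_E //; have h1 := nm_ge0 (rpart f); have h2 := nm_ge0 (ipart f).
rewrite -[leRHS]ger0_norm ?addr_ge0 // -sqrtr_sqr ler_wsqrtr //.
by rewrite sqrrD !nm_sqr addrAC lerDl mulrn_wge0 // mulr_ge0.
Qed.

Lemma dot_norm_real f : L2 f -> ip (rpart f) (rpart f) + ip (ipart f) (ipart f) =
  dot_norm (@L2_dot R) f ^+ 2.
Proof. by move=> hf; rewrite dot_norm_E // sqr_sqrtr // addr_ge0 ?ip_ge0. Qed.

Lemma cmod_dot_real f (u : R -> R) :
  cmod (L2_dot f (fun t => (u t)%:C)) ^+ 2 = ip (rpart f) u ^+ 2 + ip (ipart f) u ^+ 2.
Proof.
rewrite cmod_sqr /L2_dot /cintegral /= /ip; congr (_ ^+ 2 + _ ^+ 2).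
  by apply: eq_Rintegral => t _; rewrite /rpart; case: (f t) => a b /=; ring.
by apply: eq_Rintegral => t _; rewrite /ipart; case: (f t) => a b /=; ring.
Qed.

End ComplexReduction.

(** * Approximation with arbitrarily small l^q coefficients *)

Section Approximable.
Context {R : realType}.
Variable u : nat -> R -> R.
Hypothesis hu : forall n, sqint (u n).
Implicit Types (f g : R -> R) (q eta : R).

(** The bound on the coefficients does not involve f. This is what makes the property stable under
    sums, scalar multiples and limits, unlike an approximation with a fixed constant C(q). *)
Definition appr f := forall q eta : R, 2 < q -> 0 < eta -> exists (N : nat) (c : nat -> R),
  nm (f - \sum_(n < N) c n *: u n) < eta /\ \sum_(n < N) `|c n| `^ q <= eta.

Lemma powR_add_le (x a b q : R) : 0 <= q -> 0 <= x -> 0 <= a -> 0 <= b -> x <= a + b ->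
  x `^ q <= 2 `^ q * (a `^ q + b `^ q).
Proof.
move=> q0 x0 a0 b0 hx.
wlog ab : a b a0 b0 hx / a <= b.
  move=> H; have [ab|ba] := leP a b; first exact: H.
  by rewrite addrC; apply: H => //; [rewrite addrC|exact: ltW].
apply: le_trans (_ : (2 * b) `^ q <= _).
  by apply: ge0_ler_powR; rewrite ?nnegrE ?mulr_ge0 //; lra.
rewrite powRM // ler_wpM2l ?powR_ge0 // lerDr powR_ge0 //.
Qed.

Lemma trunc_sum (V : nmodType) (N M : nat) (c : nat -> R) (G : nat -> R -> V) :
  (forall n, G n 0 = 0) ->
  \sum_(n < maxn N M) G n (if (n < N)%N then c n else 0) = \sum_(n < N) G n (c n).
Proof.
move=> G0; rewrite [RHS](big_ord_widen (maxn N M) (fun n => G n (c n))) ?leq_maxl //.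
rewrite [RHS]big_mkcond; apply: eq_bigr => n _ /=.
by case: ifP.
Qed.

Lemma two_coeffs f g q eta : 2 < q -> 0 < eta -> appr f -> appr g ->
  exists (N : nat) (c d : nat -> R), [/\ nm (f - \sum_(n < N) c n *: u n) < eta,
    nm (g - \sum_(n < N) d n *: u n) < eta &
    \sum_(n < N) 2 `^ q * (`|c n| `^ q + `|d n| `^ q) <= eta].
Proof.
move=> q2 eta0 hf hg; have q0 : q != 0 by rewrite gt_eqF //; lra.
pose e := Num.min eta (eta / (2 * 2 `^ q)).
have p0 : 0 < 2 * 2 `^ q :> R by rewrite mulr_gt0 // powR_gt0.
have e0 : 0 < e by rewrite lt_min eta0 divr_gt0.
have [N [c [c1 c2]]] := hf q e q2 e0; have [M [d [d1 d2]]] := hg q e q2 e0.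
have ee : e <= eta by rewrite ge_min lexx.
have ee' : 2 * 2 `^ q * e <= eta.
  by rewrite mulrC -ler_pdivlMr // ge_min lexx orbT.
exists (maxn N M), (fun n => if (n < N)%N then c n else 0),
  (fun n => if (n < M)%N then d n else 0).
have tU N' M' (c' : nat -> R) : \sum_(n < maxn N' M') (if (n < N')%N then c' n else 0) *: u n =
    \sum_(n < N') c' n *: u n.
  by apply: (trunc_sum N' M' c' (G := fun n y => y *: u n)) => n; rewrite scale0r.
have tq N' M' (c' : nat -> R) : \sum_(n < maxn N' M') `|if (n < N')%N then c' n else 0| `^ q =
    \sum_(n < N') `|c' n| `^ q.
  apply: (trunc_sum N' M' c' (G := fun _ y => `|y| `^ q)) => n.
  by rewrite normr0 powR0.
split.
- by rewrite tU; apply: lt_le_trans c1 ee.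
- by rewrite maxnC tU; apply: lt_le_trans d1 ee.
rewrite -mulr_sumr big_split /= tq maxnC tq.
have := ler_wpM2l (powR_ge0 2 q) (lerD c2 d2); lra.
Qed.

Lemma sqint_lin N (c : nat -> R) : sqint (\sum_(n < N) c n *: u n).
Proof. by apply: sqint_sum => n _; exact: sqintZ. Qed.

Lemma apprD f g : sqint f -> sqint g -> appr f -> appr g -> appr (f + g).
Proof.
move=> sf sg hf hg q eta q2 eta0.
have e2 : 0 < eta / 2 by rewrite divr_gt0.
have [N [c [d [h1 h2 h3]]]] := two_coeffs q2 e2 hf hg.
exists N, (fun n => c n + d n); split.
  have -> : f + g - \sum_(n < N) (c n + d n) *: u n =
    (f - \sum_(n < N) c n *: u n) + (g - \sum_(n < N) d n *: u n).
    under eq_bigr do rewrite scalerDl.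
    by rewrite big_split /= opprD addrACA.
  apply: le_lt_trans (nmD (sqintB sf (sqint_lin _ _)) (sqintB sg (sqint_lin _ _))) _; lra.
apply: le_trans (_ : _ <= eta / 2) _; last lra.
apply: le_trans h3; apply: ler_sum => n _; apply: powR_add_le => //; first lra.
exact: ler_normD.
Qed.

Lemma apprZ a f : sqint f -> appr f -> appr (a *: f).
Proof.
move=> sf hf q eta q2 eta0.
pose e := Num.min (eta / (`|a| + 1)) (eta / (`|a| `^ q + 1)).
have a1 : 0 < `|a| + 1 by rewrite ltr_wpDl.
have a2 : 0 < `|a| `^ q + 1 by rewrite ltr_wpDl // powR_ge0.
have e0 : 0 < e by rewrite lt_min !divr_gt0.
have [N [c [h1 h2]]] := hf q e q2 e0.
have e1 : e * (`|a| + 1) <= eta by rewrite -ler_pdivlMr // ge_min lexx.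
have e2 : e * (`|a| `^ q + 1) <= eta by rewrite -ler_pdivlMr // ge_min lexx orbT.
exists N, (fun n => a * c n); split.
  have -> : a *: f - \sum_(n < N) (a * c n) *: u n = a *: (f - \sum_(n < N) c n *: u n).
    by rewrite scalerBr scaler_sumr; congr (_ - _); apply: eq_bigr => n _; rewrite scalerA.
  rewrite nmZ; last by apply: sqintB => //; exact: sqint_lin.
  have := normr_ge0 a; have := nm_ge0 (f - \sum_(n < N) c n *: u n); nra.
under eq_bigr do rewrite normrM powRM //.
rewrite -mulr_sumr; have p0 := powR_ge0 `|a| q.
have := ler_wpM2l p0 h2; lra.
Qed.

Lemma appr_lim f : sqint f ->
  (forall eta : R, 0 < eta -> exists g, [/\ sqint g, appr g & nm (f - g) < eta]) -> appr f.
Proof.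
move=> sf H q eta q2 eta0; have e2 : 0 < eta / 2 by rewrite divr_gt0.
have [g [sg hg hfg]] := H _ e2; have [N [c [h1 h2]]] := hg q _ q2 e2.
exists N, c; split; last lra.
apply: le_lt_trans (nm_tri sf (sqint_lin _ _) sg) _; lra.
Qed.

Lemma appr0 : appr 0.
Proof.
move=> q eta q2 eta0; exists 0%N, (fun _ => 0); rewrite !big_ord0 subr0 nm0.
by split=> //; exact: ltW.
Qed.

Lemma appr_all : (forall x : rat, appr (tr (ratr x) (box 1))) ->
  forall f, sqint f -> appr f.
Proof.
move=> H f hf; have [_ df] := dens_all hf.
apply: appr_lim => // eta eta0; have [s hs] := df _ eta0.
exists (combq s); split=> //; first exact: sqint_combq.
have hb (x : rat) : sqint (tr (ratr x) (@box R 1)).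
  by apply: sqint_tr; exact: sqint_box.
rewrite /combq; elim: s {hs} => [|p s IH]; first by rewrite big_nil; exact: appr0.
rewrite big_cons; apply: apprD => //.
- exact: sqintZ.
- exact: sqint_combq.
- by apply: apprZ.
Qed.
End Approximable.

(** * Enumeration of the targets, Bessel inequality and conclusion *)

Section Final.
Context {R : realType}.

(** Duality: the sum S of squares is the inner product of h with the combination whose coefficients
    are the [ip h (u n)], hence S <= |h| B sqrt S. *)
Lemma bessel_real (u : nat -> R -> R) (B : R) N (h : R -> R) : 0 <= B ->
  (forall n, sqint (u n)) -> sqint h ->
  (forall c : nat -> R, nm (\sum_(n < N) c n *: u n) <= B * Num.sqrt (\sum_(n < N) c n ^+ 2)) ->
  \sum_(n < N) ip h (u n) ^+ 2 <= B ^+ 2 * ip h h.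
Proof.
move=> B0 hu hh hB.
have hZ (n : nat) : sqint (ip h (u n) *: u n) by exact: sqintZ.
have := hB (fun n => ip h (u n)); set S := \sum_(n < N) ip h (u n) ^+ 2.
have S0 : 0 <= S by apply: sumr_ge0 => n _; exact: sqr_ge0.
have SE : S = ip h (\sum_(n < N) ip h (u n) *: u n).
  rewrite ip_sumr //; apply: eq_bigr => n _; by rewrite ipZr // expr2.
have hs : sqint (\sum_(n < N) ip h (u n) *: u n) by exact: sqint_sum.
have := ip_le_nm hh hs; rewrite -SE.
set X := nm (\sum_(n < N) _) => h1 h2; rewrite -nm_sqr.
have nh := nm_ge0 h; have s0 := sqrtr_ge0 S.
have sS : Num.sqrt S ^+ 2 = S by rewrite sqr_sqrtr.
move: s0 sS h2; set s := Num.sqrt S => s0 sS h2.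
have h3 : s ^+ 2 <= nm h * (B * s).
  by rewrite sS; apply: le_trans h1 _; rewrite ler_wpM2l.
have h4 : s <= nm h * B.
  move: s0; rewrite le_eqVlt => /predU1P[<-|s0]; first by rewrite mulr_ge0.
  by rewrite -(ler_pM2r s0) -expr2 -mulrA.
by rewrite -sS -exprMn mulrC lerXn2r ?nnegrE ?mulr_ge0.
Qed.

(** A single integer i serves for both q = 2 + 1 / (i + 1) and the tolerance 1 / (i + 1). Numbers
    that code no pair get a dummy admissible target. *)
Definition target (k : nat) : R * R * R :=
  if unpickle k is Some (x, i) then
    (ratr (x : rat), 2 + (i : nat).+1%:R^-1, i.+1%:R^-1) else (0, 3, 1).

Lemma targetP k : 2 < (target k).1.2 /\ 0 < (target k).2.
Proof.
rewrite /target; case: unpickle => [[x i]|] /=; last by split; lra.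
by rewrite ltrDl invr_gt0.
Qed.

(** A sum of (2 + d)-th powers bounded by d <= 1 forces all coefficients to be at most 1 in absolute
    value, so raising the exponent to any q >= 2 + d only decreases the sum. *)
Lemma appr_target (u : nat -> R -> R) :
  (forall k, exists (N : nat) (c : nat -> R),
     nm (tr (target k).1.1 (@box R 1) - \sum_(n < N) c n *: u n) <= (target k).2 /\
     \sum_(n < N) `|c n| `^ (target k).1.2 <= (target k).2) ->
  forall x : rat, appr u (tr (ratr x) (box 1)).
Proof.
move=> H x q eta q2 eta0.
pose e := Num.min (eta / 2) (q - 2).
have e0 : 0 < e by rewrite lt_min divr_gt0 //= subr_gt0.
have [i [i0 hi]] := natr_ceil (e^-1).
have [N [c]] := H (pickle (x, i)).
rewrite /target pickleK /=; set d := i.+1%:R^-1 => -[h1 h2].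
have i1 : 0 < i.+1%:R :> R by [].
have d0 : 0 < d by rewrite invr_gt0.
have d1 : d <= 1 by rewrite invf_le1 // ler1n.
have de : d <= e.
  rewrite /d -[e]invrK lef_pV2 ?posrE ?invr_gt0 //.
  by apply: le_trans hi _; rewrite ler_nat.
have de1 : d <= eta / 2 by apply: le_trans de _; rewrite ge_min lexx.
have de2 : d <= q - 2 by apply: le_trans de _; rewrite ge_min lexx orbT.
exists N, c; split; first by apply: le_lt_trans h1 _; lra.
apply: le_trans (_ : d <= _); last lra.
apply: le_trans (h2); apply: ler_sum => n _.
have cn : `|c n| <= 1.
  rewrite leNgt; apply/negP => c1.
  have : `|c n| `^ (2 + d) <= d.
    apply: le_trans h2; rewrite (bigD1 n) //= lerDl.
    by apply: sumr_ge0 => j _; exact: powR_ge0.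
  have : `|c n| `^ 1 <= `|c n| `^ (2 + d) by apply: ler_powR; [exact: ltW|lra].
  rewrite powRr1 //; lra.
have [->|c0] := eqVneq (c n) 0.
  by rewrite normr0 !powR0 // gt_eqF //; lra.
by apply: ger_powR; [rewrite normr_gt0 c0|lra].
Qed.

Lemma part_lin (f : R -> R[i]) N (c d : nat -> R) (u : nat -> R -> R) :
  let h := f - \sum_(n < N) (c n +i* d n)%C *: (fun t => ((u n t)%:C)%C) in
  rpart h = rpart f - \sum_(n < N) c n *: u n /\
  ipart h = ipart f - \sum_(n < N) d n *: u n.
Proof.
split; apply/funext => t.
- rewrite -[RHS]/(complex.Re (f t) - (\sum_(n < N) c n *: u n) t).
  rewrite -[LHS]/(complex.Re (f t - (\sum_(n < N) (c n +i* d n)%C *: (fun t => ((u n t)%:C)%C)) t)).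
  rewrite !fct_sumE (_ : forall a b : R[i], complex.Re (a - b) = complex.Re a - complex.Re b); last by case=> a b [].
  rewrite Re_sum; congr (_ - _); apply: eq_bigr => n _.
  by rewrite -[RHS]/(c n * u n t) -[LHS]/(complex.Re ((c n +i* d n)%C * ((u n t)%:C)%C)) /= mulr0 subr0.
- rewrite -[RHS]/(complex.Im (f t) - (\sum_(n < N) d n *: u n) t).
  rewrite -[LHS]/(complex.Im (f t - (\sum_(n < N) (c n +i* d n)%C *: (fun t => ((u n t)%:C)%C)) t)).
  rewrite !fct_sumE (_ : forall a b : R[i], complex.Im (a - b) = complex.Im a - complex.Im b); last by case=> a b [].
  rewrite Im_sum; congr (_ - _); apply: eq_bigr => n _.
  by rewrite -[RHS]/(d n * u n t) -[LHS]/(complex.Im ((c n +i* d n)%C * ((u n t)%:C)%C)) /= mulr0 add0r.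
Qed.

Lemma separated (l : nat -> R) : (forall n, l n + 1 <= l n.+1) ->
  forall i j, i != j -> 1 <= `|l i - l j|.
Proof.
move=> hl; have h i k : l i + 1 <= l (i + k).+1.
  elim: k => [|k IH]; first by rewrite addn0.
  by rewrite addnS; have := hl (i + k).+1; lra.
move=> i j ij; wlog lt : i j ij / (i < j)%N.
  move=> H; have [l1|l1|l1] := ltngtP i j; first exact: H.
    by rewrite distrC; apply: H => //; rewrite eq_sym.
  by rewrite l1 eqxx in ij.
have := h i (j - i.+1)%N; rewrite -addSn subnKC // => h1.
by rewrite distrC ger0_norm; lra.
Qed.
End Final.

Theorem theorem2 (R : realType) (eps : nat -> R)
    (eps_gt0 : forall n : nat, 0 < eps n)
    (eps_cvg0 : eps n @[n --> \oo] --> (0 : R)) :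
  exists (lambda : nat -> R) (g : R -> complex R),
    [/\ forall n : nat, lambda n != 0,
        uniformly_discrete (range lambda),
        forall n : nat, 1 + eps n < lambda n.+1 / lambda n,
        L2 g &
        QF_system (@L2 R) (@L2_dot R) (fun n => translate g (lambda n))].
Proof.
have [l [G [l0 hl sG bG happ]]] := main_real eps_gt0 eps_cvg0 (@targetP R).
pose u n := tr (l n) G.
have su n : sqint (u n) by exact: sqint_tr.
have hsep i j : i != j -> 1 <= `|l i - l j|.
  by move=> ij; apply: separated => // n; have [] := hl n.
have hap : forall f, sqint f -> appr u f.
  by apply: appr_all => //; exact: appr_target.
pose g : R -> complex R := fun t => ((G t)%:C)%C.
have s0 : sqint (0 : R -> R) by exact: sqint0.
exists l, g; split.
- by move=> n; rewrite gt_eqF.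
- apply: lt_le_trans (_ : (1%:E <= _)%E); first by rewrite lte_fin.
  apply: le_ereal_inf_tmp => _ [[x y] /= [[i _ <-] [j _ <-] ij] <-].
  by rewrite lee_fin; apply: hsep; apply: contra_notN ij => /eqP ->.
- by move=> n; rewrite ltr_pdivlMr //; have [] := hl n.
- by apply/L2P.
split.
- by move=> n; apply/L2P; split; [exact: su|exact: (sqint_tr (l n) s0)].
- move=> q q2; exists 1 => f hf e e0; rewrite mul1r.
  have q0 : q != 0 by rewrite gt_eqF //; lra.
  have [f1 f2] := (L2P f).1 hf.
  have nf0 : 0 <= dot_norm (@L2_dot R) f by exact: sqrtr_ge0.
  (* A vector of norm zero allows only zero coefficients; the empty combination serves. *)
  move: nf0; rewrite le_eqVlt => /predU1P[nf|nf].
    exists 0%N, (fun _ => 0); rewrite !big_ord0 subr0 -nf.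
    by rewrite powR0 // invr_eq0.
  set F := dot_norm _ f in nf *.
  (* e / 2 for each of the real and imaginary parts; F^q makes the l^q norm of the coefficients at
     most F, that is C(q) = 1. *)
  pose eta := Num.min (e / 2) (F `^ q).
  have eta0 : 0 < eta by rewrite lt_min divr_gt0 //= powR_gt0.
  have [N [c [d [h1 h2 h3]]]] := two_coeffs q2 eta0 (hap _ f1) (hap _ f2).
  pose cc n : complex R := (c n +i* d n)%C.
  exists N, cc.
  have [hr hi] := part_lin f N c d u.
  have hL : L2 (f - \sum_(n < N) cc n *: translate g (l n)).
    by apply/L2P; rewrite hr hi; split; apply: sqintB => //; apply: sqint_lin.
  have ee : eta <= e / 2 by rewrite ge_min lexx.
  have eF : eta <= F `^ q by rewrite ge_min lexx orbT.
  split; first by apply: le_lt_trans (dot_norm_le hL) _; rewrite hr hi; lra.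
  have hs : \sum_(n < N) cmod (cc n) `^ q <= F `^ q.
    apply: le_trans eF; apply: le_trans h3; apply: ler_sum => n _.
    apply: powR_add_le => //; [lra|exact: cmod_ge0|exact: cmod_le].
  have -> : F = (F `^ q) `^ q^-1 by rewrite -powRrM divff // powRr1 // ltW.
  apply: ge0_ler_powR; rewrite ?nnegrE ?powR_ge0 ?invr_ge0 //; first lra.
  by apply: sumr_ge0 => n _; exact: powR_ge0.
- exists 2 => f hf; have [f1 f2] := (L2P f).1 hf.
  have nf0 : 0 <= dot_norm (@L2_dot R) f by exact: sqrtr_ge0.
  set F := dot_norm _ f in nf0 *.
  (* As g is real, the real and imaginary parts of f decouple, and each satisfies the real Bessel
     inequality with the constant 2 of [bess 2 G]. *)
  have key N : \sum_(n < N) cmod (L2_dot f (translate g (l n))) ^+ 2 <= (2 * F) ^+ 2.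
    have hb (h : R -> R) : sqint h -> \sum_(n < N) ip h (u n) ^+ 2 <= 2 ^+ 2 * ip h h.
      move=> hh; apply: bessel_real => // c.
      by apply: bG => i j _ _; exact: hsep.
    have -> : \sum_(n < N) cmod (L2_dot f (translate g (l n))) ^+ 2 =
       \sum_(n < N) ip (rpart f) (u n) ^+ 2 + \sum_(n < N) ip (ipart f) (u n) ^+ 2.
      by rewrite -big_split; apply: eq_bigr => n _; exact: cmod_dot_real.
    rewrite exprMn -dot_norm_real // mulrDr; apply: lerD; exact: hb.
  have hsum : (\sum_(0 <= n <oo) (cmod (L2_dot f (translate g (l n))) ^+ 2)%:E
      <= ((2 * F) ^+ 2)%:E)%E.
    apply: lime_le.
      by apply: is_cvg_nneseries => n _ _; rewrite lee_fin sqr_ge0.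
    by apply: nearW => N; rewrite sumEFin lee_fin big_mkord.
  have h2F : 0 <= 2 * F by rewrite mulr_ge0.
  apply: le_trans (_ : (((2 * F) ^+ 2)%:E `^ 2^-1 <= _)%E).
    apply: gt0_ler_poweR => //; rewrite in_itv /= leey andbT.
      by apply: nneseries_ge0 => n _ _; rewrite lee_fin sqr_ge0.
    by rewrite lee_fin sqr_ge0.
  by rewrite poweR_EFin lee_fin powR12_sqrt ?sqr_ge0 // sqrtr_sqr ger0_norm.
Qed.
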